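(* There exists an absolute constant $C>0$ such that the following holds. Let $d,K\in\mathbb{N}$ with $K\ge d$, and let $F$ be a probability distribution on $\mathbb{R}^d$ such that: (1) $F=qI+\sum_{m=1}^K p_mF_m$, where $q,p_1,\dots,p_K\in(0,1)$, $\sum_{m=1}^K p_m=1-q$, and $F_1,\dots,F_K$ are probability distributions on $\mathbb{R}^d$; (2) there exist non-zero vectors $\vec y_1,\dots,\vec y_K\in\mathbb{R}^d$ such that $\operatorname{supp}F_m\subset\{k\vec y_m: k\in\mathbb{Z}\setminus\{0\}\}$ for each $m$, and $\operatorname{supp}F_m\cap\operatorname{supp}F_k=\emptyset$ for $k\neq m$; (3) each $\operatorname{supp}F_m\ne\emptyset$ and $F_m\{k\vec y_m\}=F_m\{-k\vec y_m\}$ for $k\in\{1,2,\dots\}$, $m=1,\dots,K$; (4) for each $m$ there exists an integer $k_m^0$ such that $F_m\{k_m^0\vec y_m\}>0$ and $F_m\{(k_m^0+1)\vec y_m\}>0$. Let $\sigma_m^2=2\sum_{k=1}^\infty k^2F_m\{k\vec y_m\}$. Then, for any $n\in\mathbb{N}$, $$d_{TV}\big(F^{*n},\exp(n(F-I))\big)\leq \frac{1.76}{n}\left(\sum_{m=1}^K\sqrt{1+\sigma_m}\right)^2\left(1+\frac{C}{\sqrt{n}\,q^5}\sum_{m=1}^K\sqrt{1+\sigma_m}\right).$$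
   Context: $I$ is the distribution concentrated at $\vec 0\in\mathbb{R}^d$; $*$ is convolution of finite signed measures on $\mathbb{R}^d$; $M^{*j}$ is the $j$-fold convolution power, $M^{*0}=I$; $\exp(M)=\sum_{j\ge 0}M^{*j}/j!$. $d_{TV}(F,G)=\sup_B|F\{B\}-G\{B\}|=\frac12\|F-G\|_{TV}$, supremum over Borel sets of $\mathbb{R}^d$. $\sigma_m\ge0$; if some $\sigma_m=\infty$ the right-hand side is understood as $+\infty$. *)

(* Defs.v *)
From HB Require Import structures.
From mathcomp Require Import all_boot all_order all_algebra.
From mathcomp Require Import all_classical all_reals all_analysis.
From mathcomp Require Import measurable_realfun.

Set Implicit Arguments.
Unset Strict Implicit.
Unset Printing Implicit Defensive.

Import Order.TTheory GRing.Theory Num.Theory.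
Import numFieldNormedType.Exports.

Local Open Scope classical_set_scope.
Local Open Scope ring_scope.

Section borel_instance.
Context (R : realType) (d : nat).
Local Notation G := (@open 'rV[R]_d).

HB.instance Definition _ := @isMeasurable.Build (sigma_display G) 'rV[R]_d
  <<s G >> (@sigma_algebra0 _ setT G) (@sigma_algebraC _ G)
  (@sigma_algebra_bigcup _ setT G).

End borel_instance.

Section borel.
Context (R : realType) (d : nat).
Implicit Types (U : set 'rV[R]_d) (i : 'I_d).

Lemma open_measurable_rV U : open U -> measurable U.
Proof. exact: sub_sigma_algebra. Qed.

Lemma measurable_coord i :
  measurable_fun [set: 'rV[R]_d] (fun x : 'rV[R]_d => x ord0 i).
Proof.
apply: (measurability _ (RGenOpens.measurableE R)).
move=> _ [_ [a [b ->] <-]]; rewrite setTI; apply: open_measurable_rV.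
by apply: open_comp => [x _|]; [exact: coord_continuous|exact: interval_open].
Qed.

Let rball (k : 'rV[rat]_d * nat) : set 'rV[R]_d :=
  ball (map_mx (@ratr R) k.1) k.2.+1%:R^-1.

Lemma open_bigcup_rball U : open U ->
  U = \bigcup_(k in [set k | rball k `<=` U]) rball k.
Proof.
move=> oU; apply/seteqP; split => [x Ux|x [k + kx]]; last exact.
have /nbhs_ballP[e /= e0 xeU] : nbhs x U by exact: open_nbhs_nbhs.
pose n := Num.truncn (2 / e).
have ne : n.+1%:R^-1 < e / 2.
  rewrite -[e / 2]invrK ltf_pV2 ?posrE ?invr_gt0 ?divr_gt0// invf_div.
  by rewrite truncnS_gt.
have n0 : 0 < n.+1%:R^-1 :> R by rewrite invr_gt0.
have qP i : exists q : rat, ratr q \in `]x ord0 i, (x ord0 i + n.+1%:R^-1)[.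
  by have [|q] := @rat_in_itvoo R (x ord0 i) (x ord0 i + n.+1%:R^-1);
    [rewrite ltrDl|exists q].
have [q qE] := choice qP.
have xq : ball (map_mx (@ratr R) (\row_i q i)) n.+1%:R^-1 x.
  split=> // j i; rewrite (ord1 j) !mxE -ball_normE /=.
  have := qE i; rewrite in_itv/= => /andP[h1 h2].
  by rewrite ger0_norm ?subr_ge0 ?ltrBlDl// ltW.
exists (\row_i q i, n) => //= y qy; apply: xeU.
rewrite [e]splitr; apply: (@ball_triangle _ _ (map_mx (@ratr R) (\row_i q i))).
  by apply: ball_sym; apply: le_ball xq; exact: ltW.
by apply: le_ball qy; exact: ltW.
Qed.

Definition addrV (p : 'rV[R]_d * 'rV[R]_d) : 'rV[R]_d := p.1 + p.2.

Lemma measurable_addrV : measurable_fun setT addrV.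
Proof.
apply: (@measurability _ _ _ _ setT addrV (@open 'rV[R]_d)); first by [].
move=> _ [U oU <-].
rewrite setTI (open_bigcup_rball oU) preimage_bigcup bigcup_mkcond.
apply: countable_bigcupT_measurable => [|k]; first exact: countableP.
case: ifPn => // _.
rewrite (_ : addrV @^-1` _ = \bigcap_(i in [set: 'I_d])
    (fun p : 'rV[R]_d * 'rV[R]_d =>
      `|ratr (k.1 ord0 i) - (p.1 ord0 i + p.2 ord0 i)|) @^-1`
    [set r | r < k.2.+1%:R^-1]); last first.
  apply/seteqP; split => p.
    move=> -[_ pk] i _ /=; have := pk ord0 i.
    by rewrite -ball_normE /= !mxE.
  move=> pk; split=> [|j i]; first by rewrite invr_gt0.
  by have := pk i I; rewrite (ord1 j) -ball_normE /= !mxE.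
apply: fin_bigcap_measurable => // i _.
rewrite -[X in measurable X]setTI.
have mf : measurable_fun [set: 'rV[R]_d * 'rV[R]_d]
    (fun p => `|ratr (k.1 ord0 i) - (p.1 ord0 i + p.2 ord0 i)|).
  apply: measurableT_comp => //; apply: measurable_funB => //.
  apply: measurable_funD.
    by apply: (measurableT_comp (measurable_coord i)); exact: measurable_fst.
  by apply: (measurableT_comp (measurable_coord i)); exact: measurable_snd.
apply: mf => [|]; first exact: measurableT.
by rewrite -set_itvNyo; exact: measurable_itv.
Qed.

End borel.

Local Open Scope ereal_scope.

Section finite_measure_convolution.
Context (R : realType) (d : nat).
Variables mu nu : {finite_measure set 'rV[R]_d -> \bar R}.

Definition mconv : set 'rV[R]_d -> \bar R :=
  pushforward (mu \x nu) (@addrV R d).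

Let law_add :=
  measure_function_pushforward__canonical__measure_function_Measure
    (mu \x nu) (@measurable_addrV R d).

Let mconv0 : mconv set0 = 0.
Proof. exact: (measure0 law_add). Qed.

Let mconv_ge0 A : 0 <= mconv A.
Proof. exact: (measure_ge0 law_add). Qed.

Let mconv_sigma_additive : semi_sigma_additive mconv.
Proof. exact: (@measure_semi_sigma_additive _ _ _ law_add). Qed.

HB.instance Definition _ :=
  isMeasure.Build _ _ _ mconv mconv0 mconv_ge0 mconv_sigma_additive.

Let mconv_fin : fin_num_fun mconv.
Proof.
apply: lty_fin_num_fun; rewrite /= /mconv /pushforward preimage_setT -setXTT.
rewrite product_measure1E// ltey_eq fin_numM//; exact: fin_num_measure.
Qed.

HB.instance Definition _ := @Measure_isFinite.Build _ _ _ mconv mconv_fin.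

End finite_measure_convolution.

(* Finite signed measures on R^d are charges. *)
Section signed_measure.
Context (R : realType) (d : nat).
Local Notation E := 'rV[R]_d.
Implicit Types M N : {charge set E -> \bar R}.

Lemma hahn_sig M : {PN : set E * set E | hahn_decomposition M PN.1 PN.2}.
Proof.
by apply: cid; have [P [N PN]] := Hahn_decomposition M; exists (P, N).
Qed.

Definition cpos M : {finite_measure set E -> \bar R} :=
  jordan_pos (projT2 (hahn_sig M)).

Definition cneg M : {finite_measure set E -> \bar R} :=
  jordan_neg (projT2 (hahn_sig M)).

(* The bilinear extension of mconv, through M = cpos M - cneg M. *)
Definition cconv M N : {charge set E -> \bar R} :=
  cadd (cadd (mconv (cpos M) (cpos N)) (mconv (cneg M) (cneg N)))
       (copp (cadd (mconv (cpos M) (cneg N)) (mconv (cneg M) (cpos N)))).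

Definition cunit : {charge set E -> \bar R} :=
  charge_of_finite_measure (\d_(0%R : E)).

Definition cpow M (j : nat) : {charge set E -> \bar R} :=
  iter j (cconv M) cunit.

(* The exponential series, summed setwise; only Borel B are meaningful. *)
Definition cexp M (B : set E) : \bar R :=
  \sum_(0 <= j <oo) (j`!%:R^-1)%:E * cpow M j B.

Definition dTV (F G : set E -> \bar R) : \bar R :=
  ereal_sup [set `|F B - G B| | B in measurable].

(* The topological support. *)
Definition msupport (mu : set E -> \bar R) : set E :=
  [set x | forall U, open U -> U x -> 0 < mu U].

(* The standard deviation of a symmetric law on Z y; it may be +oo. *)
Definition lattice_sigma (mu : set E -> \bar R) (y : E) : \bar R :=
  sqrte (2%:E * \sum_(1 <= k <oo) (k%:R ^+ 2)%:E * mu [set (y *+ k)%R]).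

End signed_measure.

(* Main.v *)
Require Import Defs.
From HB Require Import structures.
From mathcomp Require Import all_boot all_order all_algebra.
From mathcomp Require Import all_classical all_reals all_analysis.
From mathcomp Require Import measurable_realfun.
From mathcomp Require Import ring lra zify.

Set Implicit Arguments.
Unset Strict Implicit.
Unset Printing Implicit Defensive.

Import Order.TTheory GRing.Theory Num.Theory.
Import numFieldNormedType.Exports.

Local Open Scope classical_set_scope.
Local Open Scope ring_scope.

(* Both laws are approximated setwise by finite combinations of translations,
   which form a commutative ring (convolution is composition of operators).
   There F = 1 - X with X = sum_m p_m X_m and X_m = 1 - F_m, and exp(-X) is
   replaced by E = (1 - X/M)^M. Expanding E to second order and telescoping,
   F^n - E^n is (n/2) X^2 E^n plus terms in X^3 F^i E^j and X^4 F^i E^j. Writing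
   E as an approximate product of powers of lazy walks 1 - (p_m/M) X_m, everything
   reduces to bounds of total variation norms of X_m^j (1 - r X_m)^N on Z.
   These come from the Carlson-type inequality that bounds the l1 norm by the
   l2 norms of the coefficients and of their product with k; the l2 norms are
   means of symbols, compared pointwise with resolvents 1 / (1 + s x(t)).
   The remainder terms cost powers of q, since F^i is only known to contain a
   binomially distributed number of lazy steps in each direction. *)

(** * Finite combinations of translations *)

(** The bound does not contain the weights [p_m]. A factor [p_m X_m] must be smoothed by steps in
    direction [m], and [n] steps provide about [n p_m] of them, so [p_m] cancels. In [E^n] the
    directions factorise up to an error vanishing with [M]; in [F^i] the number of steps is random,
    and an average of its inverse has to be taken. Only the square root of [sigma_m] appears,
    because the Carlson-type inequality yields the geometric mean of two l2 norms and the variance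
    enters only one of them. The square of a smoothing bound has constant 7.04; the factor [n/2]
    leaves [3.52/n], and the distance is half of the norm, whence 1.76. The symbol of a step
    [1 - (1 - q) X_m] may come as low as [-1 + 2q], so each factor [X] smoothed by [F^i] costs
    [q^(-3/2)]. The terms of order 3 and 4 thus carry [q^(-9/2)] and [q^(-6)]; the latter improves
    to [q^(-5)], as the theorem is trivial unless the sum of the [sqrt(1 + sigma_m)] is at most
    [q sqrt(n)]. *)

Section group_algebra.
Context (R : realType) (V : zmodType).
Implicit Types (l : seq (R * V)) (h : V -> R) (x v : V) (c : R).

(* The combination [sum_l c T_v] is encoded by its action on functions, so that
   equality does not depend on the list [l]. *)
Definition fcomb l h x : R := \sum_(cv <- l) cv.1 * h (x + cv.2).

Definition is_fcomb : {pred (V -> R) -> V -> R} :=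
  [pred f | `[< exists l, f = fcomb l >]].

Record galg := Galg { gop :> (V -> R) -> V -> R; _ : gop \in is_fcomb }.

HB.instance Definition _ := [isSub for gop].
HB.instance Definition _ := [Choice of galg by <:].

Implicit Types f g : galg.

Lemma galgP f g : (forall h x, f h x = g h x) -> f = g.
Proof. by move=> fg; apply: val_inj; apply/funext => h; apply/funext => x; exact: fg. Qed.

Lemma galg_fcomb f : exists l, f = fcomb l :> ((V -> R) -> V -> R).
Proof. by case: f => f /= /asboolP. Qed.

Definition galg_of (F : (V -> R) -> V -> R) (HF : exists l, F = fcomb l) : galg :=
  Galg (introT (asboolP _) HF : F \in is_fcomb).

Definition gcomb l : galg := galg_of (ex_intro _ l erefl).

Let add_subproof f g : exists l, (fun h x => f h x + g h x) = fcomb l.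
Proof.
have [l fl] := galg_fcomb f; have [m gm] := galg_fcomb g.
exists (l ++ m); apply/funext => h; apply/funext => x.
by rewrite fl gm /fcomb big_cat.
Qed.

Let opp_subproof f : exists l, (fun h x => - f h x) = fcomb l.
Proof.
have [l fl] := galg_fcomb f; exists [seq (- cv.1, cv.2) | cv <- l].
apply/funext => h; apply/funext => x.
rewrite fl /fcomb big_map -sumrN; apply: eq_bigr => cv _ /=; by rewrite mulNr.
Qed.

Lemma fcomb_comp l m h x : fcomb l (fcomb m h) x =
  fcomb [seq (p.1 * q.1, p.2 + q.2) | p <- l, q <- m] h x.
Proof.
rewrite /fcomb big_allpairs_dep; apply: eq_bigr => p _.
by rewrite big_distrr; apply: eq_bigr => q _ /=; rewrite mulrA addrA.
Qed.

Let mul_subproof f g : exists l, (fun h => f (g h)) = fcomb l.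
Proof.
have [l fl] := galg_fcomb f; have [m gm] := galg_fcomb g.
exists [seq (p.1 * q.1, p.2 + q.2) | p <- l, q <- m].
by apply/funext => h; apply/funext => x; rewrite fl gm fcomb_comp.
Qed.

Definition gadd f g := galg_of (add_subproof f g).
Definition gopp f := galg_of (opp_subproof f).
Definition gmul f g := galg_of (mul_subproof f g).
Definition gzero := gcomb [::].
Definition gone := gcomb [:: (1, 0)].

Let gaddA : associative gadd.
Proof. by move=> f g k; apply: galgP => h x /=; rewrite addrA. Qed.
Let gaddC : commutative gadd.
Proof. by move=> f g; apply: galgP => h x /=; rewrite addrC. Qed.
Let gadd0 : left_id gzero gadd.
Proof. by move=> f; apply: galgP => h x /=; rewrite /fcomb big_nil add0r. Qed.
Let gaddN : left_inverse gzero gopp gadd.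
Proof. by move=> f; apply: galgP => h x /=; rewrite /fcomb big_nil addNr. Qed.

HB.instance Definition _ := GRing.isZmodule.Build galg gaddA gaddC gadd0 gaddN.

Let gmulA : associative gmul.
Proof. by move=> f g k; apply: galgP => h x. Qed.
Let gmulC : commutative gmul.
Proof.
move=> f g; apply: galgP => h x /=.
have [l fl] := galg_fcomb f; have [m gm] := galg_fcomb g.
rewrite fl gm /fcomb.
under eq_bigr do rewrite big_distrr.
rewrite exchange_big; apply: eq_bigr => p _.
rewrite big_distrr; apply: eq_bigr => q _ /=.
by rewrite mulrCA -!addrA (addrC p.2).
Qed.
Let gmul1 : left_id gone gmul.
Proof.
by move=> f; apply: galgP => h x /=; rewrite /fcomb big_seq1/= mul1r addr0.
Qed.
Let gmulDl : left_distributive gmul gadd.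
Proof. by move=> f g k; apply: galgP. Qed.
Let gone_neq0 : gone != gzero.
Proof.
apply/eqP => /(congr1 (fun f : galg => f (fun=> 1) 0)) /eqP /=.
by rewrite /fcomb big_seq1 big_nil/= mulr1 oner_eq0.
Qed.

HB.instance Definition _ := GRing.Zmodule_isComNzRing.Build galg
  gmulA gmulC gmul1 gmulDl gone_neq0.

Lemma gaddE f g h x : (f + g) h x = f h x + g h x. Proof. by []. Qed.
Lemma goppE f h x : (- f) h x = - f h x. Proof. by []. Qed.
Lemma gsubE f g h x : (f - g) h x = f h x - g h x. Proof. by []. Qed.
Lemma gmulE f g h x : (f * g) h x = f (g h) x. Proof. by []. Qed.
Lemma gcombE l h x : gcomb l h x = fcomb l h x. Proof. by []. Qed.
Lemma gzeroE h x : (0 : galg) h x = 0.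
Proof. by rewrite [LHS]gcombE /fcomb big_nil. Qed.
Lemma goneE h x : (1 : galg) h x = h x.
Proof. by rewrite [LHS]gcombE /fcomb big_seq1/= mul1r addr0. Qed.

Lemma gsumE (I : Type) (r : seq I) (P : pred I) (F : I -> galg) h x :
  (\sum_(i <- r | P i) F i) h x = \sum_(i <- r | P i) F i h x.
Proof. by elim/big_rec2: _ => [|i a b _ <-]; [exact: gzeroE|rewrite gaddE]. Qed.

Lemma gopD f h h' x : f (fun y => h y + h' y) x = f h x + f h' x.
Proof.
have [l ->] := galg_fcomb f.
by rewrite /fcomb -big_split/=; apply: eq_bigr => cv _; rewrite mulrDr.
Qed.

Lemma gopZ f c h x : f (fun y => c * h y) x = c * f h x.
Proof.
have [l ->] := galg_fcomb f.
by rewrite /fcomb big_distrr/=; apply: eq_bigr => cv _; rewrite mulrCA.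
Qed.

Lemma gop_shift f v h x : f (fun y => h (y + v)) x = f h (x + v).
Proof.
have [l ->] := galg_fcomb f.
by apply: eq_bigr => cv _; rewrite addrAC.
Qed.

Lemma gop0 f h x : f h x = f (fun y => h (y + x)) 0.
Proof. by rewrite gop_shift add0r. Qed.

Lemma gop_sum f (I : Type) (r : seq I) (P : pred I) (H : I -> V -> R) x :
  f (fun y => \sum_(i <- r | P i) H i y) x = \sum_(i <- r | P i) f (H i) x.
Proof.
elim: r => [|i r IH]; last first.
  rewrite big_cons -IH; case: ifP => Pi.
    by rewrite -gopD; congr (f _ x); apply/funext => y; rewrite big_cons Pi.
  by congr (f _ x); apply/funext => y; rewrite big_cons Pi.
rewrite big_nil.
have -> : (fun y : V => \sum_(i <- [::] | P i) H i y) = (fun y => 0 * 0).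
  by apply/funext => y; rewrite big_nil mul0r.
by rewrite gopZ mul0r.
Qed.

Definition gcst c : galg := gcomb [:: (c, 0)].
Lemma gcstE c h x : gcst c h x = c * h x.
Proof. by rewrite gcombE /fcomb big_seq1/= addr0. Qed.

Let gcst_zmod : zmod_morphism gcst.
Proof. by move=> a b; apply: galgP => h x; rewrite gsubE !gcstE mulrBl. Qed.
Let gcst_monoid : monoid_morphism gcst.
Proof.
split; first by [].
by move=> a b; apply: galgP => h x; rewrite gmulE !gcstE mulrA.
Qed.
HB.instance Definition _ := GRing.isZmodMorphism.Build R galg gcst gcst_zmod.
HB.instance Definition _ := GRing.isMonoidMorphism.Build R galg gcst gcst_monoid.

Definition trans v : galg := gcomb [:: (1, v)].
Lemma transE v h x : trans v h x = h (x + v).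
Proof. by rewrite gcombE /fcomb big_seq1/= mul1r. Qed.

Definition avg2 v : galg := gcst 2^-1 * (trans v + trans (- v)).
Lemma avg2E v h x : avg2 v h x = (h (x + v) + h (x - v)) / 2.
Proof. by rewrite gmulE gcstE gaddE !transE mulrC. Qed.

(* The total variation norm of the signed measure [f]. *)
Definition nrm f : R := sup [set `|f h 0| | h in [set h | forall x, `|h x| <= 1]].

Lemma fcomb_le l c h x : (forall y, `|h y| <= c) ->
  `|fcomb l h x| <= (\sum_(cv <- l) `|cv.1|) * c.
Proof.
move=> hc; rewrite big_distrl/=; apply: le_trans (ler_norm_sum _ _ _) _.
by apply: ler_sum => cv _; rewrite normrM ler_wpM2l.
Qed.

Lemma nrm_has_sup f :
  has_sup [set `|f h 0| | h in [set h | forall x, `|h x| <= 1]].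
Proof.
split; first by exists `|f (fun=> 0) 0|, (fun=> 0) => //= x; rewrite normr0.
have [l ->] := galg_fcomb f.
exists (\sum_(cv <- l) `|cv.1|) => _ [h /= h1 <-].
by rewrite -[leRHS]mulr1 fcomb_le.
Qed.

Lemma nrm_le f c : (forall h, (forall x, `|h x| <= 1) -> `|f h 0| <= c) ->
  nrm f <= c.
Proof.
move=> fc; apply: ge_sup; first by case: (nrm_has_sup f).
by move=> _ [h /= h1 <-]; exact: fc.
Qed.

Lemma le_nrm1 f h x : (forall x, `|h x| <= 1) -> `|f h x| <= nrm f.
Proof.
move=> h1; rewrite gop0; apply: ub_le_sup; first by case: (nrm_has_sup f).
by exists (fun y => h (y + x)).
Qed.

Lemma nrm_ge0 f : 0 <= nrm f.
Proof.
apply: le_trans (le_nrm1 f (h := fun=> 0) 0 _); first exact: normr_ge0.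
by move=> x; rewrite normr0.
Qed.

Lemma le_nrm f h c x : 0 <= c -> (forall x, `|h x| <= c) -> `|f h x| <= nrm f * c.
Proof.
rewrite le_eqVlt => /predU1P[<- h0|c0 hc].
  have -> : h = (fun y => 0 * 0).
    by apply/funext => y; apply/eqP; rewrite mul0r -normr_le0.
  by rewrite gopZ mul0r mulr0 normr0.
have -> : h = (fun y => c * (c^-1 * h y)).
  by apply/funext => y; rewrite mulrA divff ?mul1r// gt_eqF.
rewrite gopZ normrM mulrC (gtr0_norm c0) ler_wpM2r ?(ltW c0)// le_nrm1// => y.
by rewrite normrM gtr0_norm ?invr_gt0// mulrC ler_pdivrMr// mul1r.
Qed.

Lemma nrm0 : nrm 0 = 0.
Proof.
apply/eqP; rewrite eq_le nrm_ge0 andbT; apply: nrm_le => h _.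
by rewrite gzeroE normr0.
Qed.

Lemma nrmD f g : nrm (f + g) <= nrm f + nrm g.
Proof.
apply: nrm_le => h h1; rewrite gaddE; apply: le_trans (ler_normD _ _) _.
by rewrite lerD// le_nrm1.
Qed.

Lemma nrmN f : nrm (- f) = nrm f.
Proof. by congr sup; apply: eq_imagel => h _; rewrite goppE normrN. Qed.

Lemma nrmM f g : nrm (f * g) <= nrm f * nrm g.
Proof.
apply: nrm_le => h h1; rewrite gmulE; apply: le_nrm; first exact: nrm_ge0.
by move=> x; exact: le_nrm1.
Qed.

Lemma nrm_cst_le c : nrm (gcst c) <= `|c|.
Proof.
apply: nrm_le => h h1; rewrite gcstE normrM -[leRHS]mulr1.
by rewrite ler_wpM2l.
Qed.

(** A bound on [nrm] gives no hold on coefficients. Here a list is exhibited, so that an error made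
    for each translation can be summed when a measure is convolved with a combination. *)
Definition lbnd f c := exists2 l, f = gcomb l & \sum_(cv <- l) `|cv.1| <= c.

Lemma nrm_lbnd f c : lbnd f c -> nrm f <= c.
Proof.
move=> [l -> lc]; apply: nrm_le => h h1; rewrite gcombE.
by apply: le_trans lc; rewrite -[leRHS]mulr1 fcomb_le.
Qed.

Lemma lbndM f g a b : lbnd f a -> lbnd g b -> lbnd (f * g) (a * b).
Proof.
move=> [l -> la] [m -> mb].
exists [seq (p.1 * q.1, p.2 + q.2) | p <- l, q <- m].
  by apply: galgP => h x; rewrite gmulE !gcombE -fcomb_comp.
rewrite big_allpairs_dep/=.
apply: le_trans (ler_pM _ _ la mb); [|exact: sumr_ge0|exact: sumr_ge0].
rewrite big_distrl/=; apply: ler_sum => p _.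
by rewrite big_distrr/=; apply: ler_sum => q _; rewrite normrM.
Qed.

Lemma lbndD f g a b : lbnd f a -> lbnd g b -> lbnd (f + g) (a + b).
Proof.
move=> [l -> la] [m -> mb]; exists (l ++ m); last by rewrite big_cat lerD.
by apply: galgP => h x; rewrite gaddE !gcombE /fcomb big_cat.
Qed.

Lemma lbnd_cst c : lbnd (gcst c) `|c|.
Proof. by exists [:: (c, 0)] => //; rewrite big_seq1. Qed.

Lemma lbnd_trans v : lbnd (trans v) 1.
Proof. by exists [:: (1, v)] => //; rewrite big_seq1 normr1. Qed.

Lemma lbnd0 : lbnd 0 0.
Proof. by exists [::] => //; rewrite big_nil. Qed.

Lemma lbndX f a n : lbnd f a -> lbnd (f ^+ n) (a ^+ n).
Proof.
move=> fa; elim: n => [|n IH]; last by rewrite !exprS; exact: lbndM.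
by have := lbnd_cst 1; rewrite normr1 rmorph1 !expr0.
Qed.

Lemma lbnd_sum (I : Type) (r : seq I) (F : I -> galg) (a : I -> R) :
  (forall i, lbnd (F i) (a i)) -> lbnd (\sum_(i <- r) F i) (\sum_(i <- r) a i).
Proof.
move=> Fa; elim: r => [|i r IH]; first by rewrite !big_nil; exact: lbnd0.
by rewrite !big_cons; exact: lbndD.
Qed.

Lemma lbnd_avg2 v : lbnd (avg2 v) 1.
Proof.
have := lbndM (lbnd_cst 2^-1) (lbndD (lbnd_trans v) (lbnd_trans (- v))).
by rewrite ger0_norm ?invr_ge0// mulVf// pnatr_eq0.
Qed.

End group_algebra.

Section spreading.
Context (R : realType) (V : zmodType) (y : V).

(** [g] is the image of [f] under the homomorphism [k |-> y *~ k]. Test functions pull back along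
    it, so norms on [V] are at most those on the integers, and smoothing need only be proved in
    dimension one. *)
Definition spread (f : galg R int) (g : galg R V) :=
  forall h x, g h x = f (fun k => h (x + y *~ k)) 0.

Lemma nrm_spread f g : spread f g -> nrm g <= nrm f.
Proof. by move=> fg; apply: nrm_le => h h1; rewrite fg le_nrm1. Qed.

Lemma spreadM f g f' g' : spread f g -> spread f' g' -> spread (f * f') (g * g').
Proof.
move=> fg fg' h x; rewrite !gmulE fg; congr (f _ 0); apply/funext => k.
rewrite fg' [RHS]gop0; congr (f' _ 0); apply/funext => j.
by rewrite mulrzDr addrA addrAC.
Qed.

Lemma spreadD f g f' g' : spread f g -> spread f' g' -> spread (f + f') (g + g').
Proof. by move=> fg fg' h x; rewrite !gaddE fg fg'. Qed.

Lemma spreadN f g : spread f g -> spread (- f) (- g).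
Proof. by move=> fg h x; rewrite !goppE fg. Qed.

Lemma spread_cst c : spread (gcst int c) (gcst V c).
Proof. by move=> h x; rewrite !gcstE mulr0z addr0. Qed.

Lemma spread1 : spread 1 1.
Proof. by rewrite -(rmorph1 (gcst int)) -(rmorph1 (gcst V)); exact: spread_cst. Qed.

Lemma spreadX f g n : spread f g -> spread (f ^+ n) (g ^+ n).
Proof.
move=> fg; elim: n => [|n IH]; first by rewrite !expr0; exact: spread1.
by rewrite !exprS; exact: spreadM.
Qed.

Lemma spread_avg2 (k : int) : spread (avg2 R k) (avg2 R (y *~ k)).
Proof. by move=> h x; rewrite !avg2E !add0r mulrNz. Qed.

Lemma spread_sum (I : Type) (r : seq I) F G :
  (forall i : I, spread (F i) (G i)) ->
  spread (\sum_(i <- r) F i) (\sum_(i <- r) G i).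
Proof.
move=> FG h x; rewrite !gsumE; apply: eq_bigr => i _; exact: FG.
Qed.

End spreading.

(** * Elementary inequalities and cosine sums *)

Section finite_sums.
Context (R : realType).

(** Lagrange's identity: the difference of the two sides is half of a weighted double sum of the
    squares [(a i * b j - a j * b i) ^+ 2]. *)
Lemma cauchy_schwarz_sum (I : finType) (w a b : I -> R) : (forall i, 0 <= w i) ->
  (\sum_i w i * (a i * b i)) ^+ 2 <=
  (\sum_i w i * a i ^+ 2) * (\sum_i w i * b i ^+ 2).
Proof.
move=> w0.
have : 0 <= \sum_i \sum_j w i * w j * (a i * b j - a j * b i) ^+ 2.
  by apply: sumr_ge0 => i _; apply: sumr_ge0 => j _; rewrite mulr_ge0 ?sqr_ge0// mulr_ge0.
have -> : \sum_i \sum_j w i * w j * (a i * b j - a j * b i) ^+ 2 =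
    \sum_i \sum_j ((w i * a i ^+ 2) * (w j * b j ^+ 2)) +
    \sum_i \sum_j ((w i * b i ^+ 2) * (w j * a j ^+ 2)) -
    2 * \sum_i \sum_j ((w i * (a i * b i)) * (w j * (a j * b j))).
  rewrite mulr_sumr -big_split -sumrB /=; apply: eq_bigr => i _.
  rewrite mulr_sumr -big_split -sumrB /=; apply: eq_bigr => j _; ring.
rewrite -!big_distrlr /=; nra.
Qed.

Lemma sum_sym_range (g : int -> R) (L : nat) :
  \sum_(i < L.*2.+1) g (i%:Z - L%:Z) =
  g 0 + \sum_(k < L) (g k.+1%:Z + g (- k.+1%:Z)).
Proof.
elim: L => [|L IH]; first by rewrite big_ord_recl !big_ord0 subr0.
rewrite doubleS big_ord_recl big_ord_recr /= [in RHS]big_ord_recr /= [RHS]addrA -IH.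
have -> : 0%:Z - L.+1%:Z = - L.+1%:Z by lia.
have -> : (bump 0 L.*2.+1)%:Z - L.+1%:Z = L.+1%:Z by rewrite /bump; lia.
rewrite [LHS]addrCA; congr (_ + _); last by rewrite addrC.
by apply: eq_bigr => i _; congr g; rewrite /bump; lia.
Qed.

Lemma sum_weights_le (b : R) (L : nat) : 0 < b ->
  \sum_(i < L.*2.+1) (1 + `|(i%:Z - L%:Z)%:~R| / b) ^- 2 <= 1 + 2 * b.
Proof.
move=> b0; rewrite (sum_sym_range (fun k => (1 + `|k%:~R| / b) ^- 2)).
rewrite normr0 mul0r addr0 expr1n invr1 lerD2l.
(* A telescoping bound, suited to induction: with [x = L], the next term [b ^+ 2 / (b + x + 1) ^+ 2]
   is at most [b ^+ 2 / (b + x) - b ^+ 2 / (b + x + 1)]. *)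
suff : \sum_(k < L) ((1 + `|(k.+1%:Z)%:~R| / b) ^- 2 +
   (1 + `|(- k.+1%:Z)%:~R| / b) ^- 2) <= 2 * (b - b ^+ 2 / (b + L%:R)).
  move=> /le_trans; apply; rewrite ler_wpM2l// gerBl divr_ge0 ?sqr_ge0//.
  by rewrite addr_ge0// ltW.
elim: L => [|L IH].
  by rewrite big_ord0 addr0 expr2 mulfK ?gt_eqF// subrr mulr0.
rewrite big_ord_recr /=; apply: le_trans (lerD IH (lexx _)) _.
rewrite rmorphN normrN -mulr2n -[X in _ + X]mulr_natl -mulrDr ler_wpM2l//.
rewrite ger0_norm ?ler0n// -[(L.+1%:Z)%:~R]/(L.+1%:R).
rewrite -[L.+1]addn1 natrD.
set x : R := L%:R; have x0 : 0 <= x by exact: ler0n.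
have -> : 1 + (x + 1) / b = (b + x + 1) / b by field; rewrite gt_eqF.
rewrite expr_div_n invf_div.
have h1 : 0 < b + x by lra.
have h2 : 0 < b + x + 1 by lra.
rewrite -subr_ge0.
have -> : b - b ^+ 2 / (b + (x + 1)) - (b - b ^+ 2 / (b + x) + b ^+ 2 / (b + x + 1) ^+ 2)
  = b ^+ 2 / ((b + x) * (b + x + 1) ^+ 2).
  by field; rewrite ?gt_eqF//; lra.
by rewrite divr_ge0 ?sqr_ge0// (mulr_ge0 (ltW h1)) ?sqr_ge0.
Qed.

Lemma sum_cos (a : R) n :
  2 * sin (a / 2) * \sum_(j < n) cos (j%:R * a) =
  sin (n%:R * a - a / 2) + sin (a / 2).
Proof.
elim: n => [|n IH]; first by rewrite big_ord0 mulr0 mul0r add0r sinN addNr.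
rewrite big_ord_recr /= mulrDr IH -[n.+1]addn1 natrD.
have -> : (n%:R + 1) * a - a / 2 = n%:R * a + a / 2 by lra.
by rewrite sinB sinD; ring.
Qed.

Lemma sum_cos_dft (N v : nat) : (0 < v < N)%N ->
  \sum_(j < N) cos (v%:R * (j%:R * (pi *+ 2 / N%:R))) = 0 :> R.
Proof.
move=> /andP[v0 vN].
have N0 : 0 < N%:R :> R by rewrite ltr0n (leq_trans _ vN).
pose a : R := v%:R * (pi *+ 2 / N%:R).
have -> : \sum_(j < N) cos (v%:R * (j%:R * (pi *+ 2 / N%:R))) =
    \sum_(j < N) cos (j%:R * a).
  by apply: eq_bigr => j _; rewrite mulrCA.
have s0 : 0 < sin (a / 2).
  apply: sin_gt0_pi.
  have -> : a / 2 = pi * (v%:R / N%:R) by rewrite /a; field; rewrite gt_eqF.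
  have p0 := pi_gt0 R.
  rewrite mulr_gt0 ?divr_gt0 ?ltr0n//= ?(ltn_trans v0)//.
  by rewrite -[ltRHS]mulr1 ltr_pM2l// ltr_pdivrMr// mul1r ltr_nat.
(* [N * a] amounts to [v] full turns, so the two sines on the right cancel, while [sin (a / 2)] is
   positive. *)
have := sum_cos a N.
have -> : N%:R * a - a / 2 = - (a / 2) + (pi *+ 2) *+ v.
  by rewrite /a -(mulr_natr _ v); field; rewrite gt_eqF.
rewrite (periodicn (@sinD2pi R)) sinN addNr => /eqP.
by rewrite mulf_eq0 mulf_eq0 pnatr_eq0 (gt_eqF s0) /= => /eqP.
Qed.

End finite_sums.

(** * Fourier analysis on the integers *)

Section one_dim.
Context (R : realType).
Implicit Types (f g : galg R int) (h : int -> R) (t c : R).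

Definition kron (k j : int) : R := (j == k)%:R.
Definition tau f : R := f (kron 0) 0.
Definition coef f (k : int) : R := f (kron k) 0.
Definition csn t (k : int) : R := cos (k%:~R * t).
Definition snn t (k : int) : R := sin (k%:~R * t).

Lemma csn0 t : csn t 0 = 1. Proof. by rewrite /csn mul0r cos0. Qed.

Lemma csnD t (x k : int) :
  csn t (x + k) = csn t x * cos (k%:~R * t) - snn t x * sin (k%:~R * t).
Proof. by rewrite /csn rmorphD /= mulrDl cosD. Qed.

Lemma snnD t (x k : int) :
  snn t (x + k) = snn t x * cos (k%:~R * t) + csn t x * sin (k%:~R * t).
Proof. by rewrite /snn rmorphD /= mulrDl sinD. Qed.

Lemma fcomb_range (l : seq (R * int)) :
  exists L : nat, forall cv, cv \in l -> (`|cv.2| <= L)%N.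
Proof.
exists (\max_(cv <- l) `|cv.2|)%N => cv cvl.
exact: (leq_bigmax_seq (F := fun cv : R * int => `|cv.2|%N)).
Qed.

(* Fourier inversion on Z/N, exact because N exceeds the diameter of the
   support of [f]; it replaces an integral over the circle. *)
Lemma tau_dft f : exists2 N : nat, (0 < N)%N &
  tau f = N%:R^-1 * \sum_(j < N) f (csn (j%:R * (pi *+ 2 / N%:R))) 0.
Proof.
have [l fl] := galg_fcomb f; have [L Ll] := fcomb_range l.
exists L.+1 => //; rewrite -gop_sum /tau -gopZ fl.
apply: eq_big_seq => cv /Ll vL; congr (_ * _); rewrite add0r /csn /kron.
have [->|v0] := eqVneq cv.2 0.
  under eq_bigr do rewrite mul0r cos0.
  by rewrite sumr_const card_ord mulVf// pnatr_eq0.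
apply/esym/eqP; rewrite mulf_eq0; apply/orP; right; apply/eqP.
have -> : \sum_(j < L.+1) cos (cv.2%:~R * (j%:R * (pi *+ 2 / L.+1%:R))) =
    \sum_(j < L.+1) cos (`|cv.2|%N%:R * (j%:R * (pi *+ 2 / L.+1%:R))) :> R.
  apply: eq_bigr => j _.
  case: (cv.2) => k //=; rewrite NegzE mulrNz mulNr cosN.
  by congr (cos (_ * _)); rewrite abszN.
by apply: sum_cos_dft; rewrite absz_gt0 v0 ltnS.
Qed.

(** Inversion is applied to the difference [g - f], so a single finite set of angles serves both.
    This is how pointwise comparison of symbols yields l2 bounds. *)
Lemma tau_le f g : (forall t, f (csn t) 0 <= g (csn t) 0) -> tau f <= tau g.
Proof.
move=> fg; rewrite -subr_ge0.
have -> : tau g - tau f = tau (g - f) by rewrite /tau gsubE.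
have [N N0 ->] := tau_dft (g - f).
rewrite mulr_ge0 ?invr_ge0//; apply: sumr_ge0 => j _.
by rewrite gsubE subr_ge0.
Qed.

Lemma shift_range (v : int) (L : nat) : (`|v| <= L)%N ->
  0 <= v + L%:Z /\ (absz (v + L%:Z)%R < L.*2.+1)%N.
Proof. move=> vL; split; lia. Qed.

(** Every large enough window works, so that [f] and [der f] can later be expanded over a common
    one. *)
Lemma gop_range f : exists L0 : nat, forall L h, (L0 <= L)%N ->
  f h 0 = \sum_(i < L.*2.+1) coef f (i%:Z - L%:Z) * h (i%:Z - L%:Z).
Proof.
have [l fl] := galg_fcomb f; have [L Ll] := fcomb_range l.
exists L => L' h LL; have {LL}Ll cv : cv \in l -> (`|cv.2| <= L')%N by move=> /Ll /leq_trans; exact.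
move: L' Ll => {}L Ll; rewrite /coef fl.
transitivity (\sum_(i < L.*2.+1) \sum_(cv <- l)
   cv.1 * kron (i%:Z - L%:Z) cv.2 * h (i%:Z - L%:Z)); last first.
  by apply: eq_bigr => i _; rewrite /fcomb big_distrl; apply: eq_bigr => cv _; rewrite add0r.
rewrite exchange_big; apply: eq_big_seq => cv /Ll vL.
rewrite add0r /=.
have [vL0 iP] := shift_range vL.
have iE : (Ordinal iP : nat)%:Z - L%:Z = cv.2 by rewrite /= gez0_abs ?addrK.
rewrite (bigD1 (Ordinal iP)) //= iE /kron eqxx mulr1 big1 ?addr0// => i ii.
rewrite (_ : (cv.2 == _) = false) ?mulr0 ?mul0r//.
apply: contra_neqF ii => /eqP ii; apply: val_inj; apply/eqP.
by rewrite -eqz_nat -(can_eq (addrK (- L%:Z))) iE ii.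
Qed.

(** A real substitute for the eigenvectors [exp(i k t)]: a symmetric combination multiplies the
    cosine and the sine by the same real number, its symbol at [t]. *)
Definition eig t f c :=
  (forall x, f (csn t) x = c * csn t x) /\ (forall x, f (snn t) x = c * snn t x).

Lemma eigD t f g a b : eig t f a -> eig t g b -> eig t (f + g) (a + b).
Proof. by move=> [f1 f2] [g1 g2]; split=> x; rewrite gaddE (f1, f2) (g1, g2) mulrDl. Qed.

Lemma eigN t f a : eig t f a -> eig t (- f) (- a).
Proof. by move=> [f1 f2]; split=> x; rewrite goppE (f1, f2) mulNr. Qed.

Lemma eigM t f g a b : eig t f a -> eig t g b -> eig t (f * g) (a * b).
Proof.
move=> [f1 f2] [g1 g2]; split=> x; rewrite gmulE.
  by rewrite (funext g1) gopZ f1 mulrCA mulrA.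
by rewrite (funext g2) gopZ f2 mulrCA mulrA.
Qed.

Lemma eig_cst t c : eig t (gcst int c) c.
Proof. by split=> x; rewrite gcstE. Qed.

Lemma eig1 t : eig t 1 1.
Proof. by have := eig_cst t 1; rewrite rmorph1. Qed.

Lemma eigX t f a n : eig t f a -> eig t (f ^+ n) (a ^+ n).
Proof.
move=> fa; elim: n => [|n IH]; first by rewrite !expr0; exact: eig1.
by rewrite !exprS; exact: eigM.
Qed.

Lemma eig_sum t (I : finType) (F : I -> galg R int) (a : I -> R) :
  (forall i, eig t (F i) (a i)) -> eig t (\sum_i F i) (\sum_i a i).
Proof.
move=> Fa; split=> x; rewrite gsumE mulr_suml; apply: eq_bigr => i _;
  by case: (Fa i).
Qed.

Lemma eig_avg2 t (k : int) : eig t (avg2 R k) (cos (k%:~R * t)).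
Proof.
by split=> x; rewrite avg2E ?csnD ?snnD !mulrNz !mulNr cosN sinN; field.
Qed.

Lemma eig_csn0 t f a : eig t f a -> f (csn t) 0 = a.
Proof. by case=> + _ => ->; rewrite csn0 mulr1. Qed.

(** [c = 1] stands for symmetric coefficients and [c = -1] for antisymmetric ones; the sign is a
    parameter because [der] reverses it. *)
Definition parity c f := forall h x, f (fun y => h (- y)) x = c * f h (- x).

Lemma parity_coef c f k : parity c f -> coef f (- k) = c * coef f k.
Proof.
move=> fc; rewrite /coef -[X in _ = _ * f _ X]oppr0 -fc; congr (f _ _).
by apply/funext => j; rewrite /kron eqr_oppLR.
Qed.

Lemma parityD c f g : parity c f -> parity c g -> parity c (f + g).
Proof. by move=> fc gc h x; rewrite !gaddE fc gc mulrDr. Qed.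

Lemma parityN c f : parity c f -> parity c (- f).
Proof. by move=> fc h x; rewrite !goppE fc mulrN. Qed.

Lemma parityM a b f g : parity a f -> parity b g -> parity (a * b) (f * g).
Proof. by move=> fa gb h x; rewrite !gmulE (funext (gb h)) gopZ fa mulrA (mulrC b). Qed.

Lemma parity_cst c : parity 1 (gcst int c).
Proof. by move=> h x; rewrite !gcstE mul1r. Qed.

Lemma parity1 : parity 1 1.
Proof. by have := parity_cst 1; rewrite rmorph1. Qed.

Lemma parityX f n : parity 1 f -> parity 1 (f ^+ n).
Proof.
move=> f1; elim: n => [|n IH]; first exact: parity1.
by rewrite exprS -[1]mulr1; exact: parityM.
Qed.

Lemma parity_sum c (I : finType) (F : I -> galg R int) :
  (forall i, parity c (F i)) -> parity c (\sum_i F i).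
Proof. by move=> Fc h x; rewrite !gsumE mulr_sumr; apply: eq_bigr => i _; exact: Fc. Qed.

Lemma parity_avg2 (k : int) : parity 1 (avg2 R k).
Proof.
move=> h x; rewrite !avg2E mul1r addrC; congr ((h _ + h _) / _); lia.
Qed.

(** Parseval: the constant coefficient of [f * f] is the sum of [coef f k * coef f (- k)], and
    parity turns each product into [c] times a square. *)
Lemma tau_sqr c f : parity c f ->
  exists L0 : nat, forall L, (L0 <= L)%N -> [/\ forall h,
     f h 0 = \sum_(i < L.*2.+1) coef f (i%:Z - L%:Z) * h (i%:Z - L%:Z) &
   tau (f * f) = c * \sum_(i < L.*2.+1) coef f (i%:Z - L%:Z) ^+ 2].
Proof.
move=> fc; have [L0 fL0] := gop_range f; exists L0 => L LL0; have {LL0}fL h := fL0 L h LL0.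
split => //.
rewrite /tau gmulE fL mulr_sumr; apply: eq_bigr => i _.
rewrite expr2 [RHS]mulrCA; congr (_ * _); rewrite -parity_coef// gop0.
congr (f _ _); apply/funext => j.
by rewrite /kron addr_eq0.
Qed.

Let der_subproof f : exists l,
  (fun h x => f (fun y => y%:~R * h y) x - x%:~R * f h x) = fcomb l.
Proof.
have [l fl] := galg_fcomb f; exists [seq (cv.1 * cv.2%:~R, cv.2) | cv <- l].
apply/funext => h; apply/funext => x.
rewrite fl /fcomb big_map mulr_sumr -sumrB; apply: eq_bigr => cv _ /=.
by rewrite rmorphD /=; ring.
Qed.

(** The commutator with multiplication by the coordinate, hence a derivation. It multiplies the
    coefficient at [k] by [k]; on symbols it is differentiation in [t], up to a factor [i]. *)
Definition der f := galg_of (der_subproof f).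

Lemma derE f h x : der f h x = f (fun y => y%:~R * h y) x - x%:~R * f h x.
Proof. by []. Qed.

Lemma derD f g : der (f + g) = der f + der g.
Proof. by apply: galgP => h x; rewrite gaddE !derE !gaddE; ring. Qed.

Lemma derN f : der (- f) = - der f.
Proof. by apply: galgP => h x; rewrite goppE !derE !goppE; ring. Qed.

Lemma derM f g : der (f * g) = der f * g + f * der g.
Proof.
apply: galgP => h x; rewrite gaddE !gmulE !derE !gmulE.
have -> : (der g h) = fun y => g (fun y => y%:~R * h y) y + (-1) * (y%:~R * g h y).
  by apply/funext => y; rewrite derE mulN1r.
by rewrite gopD gopZ; ring.
Qed.

Lemma der_cst c : der (gcst int c) = 0.
Proof. by apply: galgP => h x; rewrite derE !gcstE gzeroE; ring. Qed.

Lemma der1 : der 1 = 0.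
Proof. by have := der_cst 1; rewrite rmorph1. Qed.

Lemma derX f n : der (f ^+ n) = n%:R * f ^+ n.-1 * der f.
Proof.
elim: n => [|n IH]; first by rewrite expr0 der1 !mul0r.
case: n IH => [|n] IH; first by rewrite expr1 expr0 !mul1r.
by rewrite exprS derM IH /= [n.+2%:R]mulrS !exprS; ring.
Qed.

Lemma der_sum (I : finType) (F : I -> galg R int) :
  der (\sum_i F i) = \sum_i der (F i).
Proof.
by elim/big_rec2: _ => [|i a b _ <-]; [have := der_cst 0; rewrite rmorph0|rewrite derD].
Qed.

Lemma der_avg2_csn t (k : int) x :
  der (avg2 R k) (csn t) x = - (k%:~R * sin (k%:~R * t)) * snn t x.
Proof.
by rewrite derE !avg2E !csnD !rmorphD !mulrNz !mulNr cosN sinN; field.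
Qed.

Lemma der_avg2_snn t (k : int) x :
  der (avg2 R k) (snn t) x = (k%:~R * sin (k%:~R * t)) * csn t x.
Proof.
by rewrite derE !avg2E !snnD !rmorphD !mulrNz !mulNr cosN sinN; field.
Qed.

Lemma coef_der f k : coef (der f) k = k%:~R * coef f k.
Proof.
rewrite /coef derE mul0r subr0 -gopZ; congr (f _ _); apply/funext => j.
by rewrite /kron; case: eqP => [->|]; rewrite ?mulr0.
Qed.

Lemma parity_der c f : parity c f -> parity (- c) (der f).
Proof.
move=> fc h x; rewrite !derE fc.
rewrite (_ : f _ x = c * f (fun y : int => - 1 * (y%:~R * h y)) (- x)).
  by rewrite gopZ mulrNz; ring.
by rewrite -fc; congr (f _ x); apply/funext => y; rewrite mulrNz; ring.
Qed.

(* Cauchy-Schwarz with the weights [(1 + |k| / b) ^+ 2]. *)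
Lemma nrm_carlson f A B b : 0 < b -> parity 1 f ->
  tau (f * f) <= A -> - tau (der f * der f) <= B ->
  nrm f ^+ 2 <= (1 + 2 * b) * (2 * (A + B / b ^+ 2)).
Proof.
move=> b0 f1 fA dB.
have [L1 fL1] := tau_sqr f1; have [L2 fL2] := tau_sqr (parity_der f1).
pose L := maxn L1 L2.
have [fL] := fL1 _ (leq_maxl L1 L2); rewrite mul1r => tf.
(* [der f] is antisymmetric, so Parseval comes with the sign -1; this is the minus sign in the
   hypothesis on [B]. *)
have [_] := fL2 _ (leq_maxr L1 L2); rewrite mulN1r => td.
rewrite -/L in fL tf td.
pose k (i : 'I_L.*2.+1) : int := i%:Z - L%:Z.
pose W i : R := 1 + `|(k i)%:~R| / b.
have W0 i : 0 < W i by rewrite /W ltr_pwDl// divr_ge0// ltW.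
have n1 : nrm f <= \sum_i `|coef f (k i)|.
  apply: nrm_le => h h1; rewrite fL; apply: le_trans (ler_norm_sum _ _ _) _.
  by apply: ler_sum => i _; rewrite normrM -[leRHS]mulr1 ler_wpM2l.
have cs : (\sum_i `|coef f (k i)|) ^+ 2 <=
    (\sum_i W i ^- 2) * (\sum_i W i ^+ 2 * coef f (k i) ^+ 2).
  have := cauchy_schwarz_sum (w := fun=> 1) (fun i => (W i)^-1)
     (fun i => W i * `|coef f (k i)|) (fun=> ler01).
  under eq_bigr do rewrite mul1r mulrA mulVf ?gt_eqF// mul1r.
  under [X in _ <= X * _]eq_bigr do rewrite mul1r exprVn.
  by under [X in _ <= _ * X]eq_bigr do rewrite mul1r exprMn real_normK ?num_real//.
apply: le_trans (_ : _ <= (\sum_i `|coef f (k i)|) ^+ 2) _.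
  by rewrite ler_sqr ?nnegrE ?nrm_ge0// sumr_ge0.
apply: le_trans cs _; apply: ler_pM.
- by apply: sumr_ge0 => i _; rewrite invr_ge0 sqr_ge0.
- by apply: sumr_ge0 => i _; rewrite mulr_ge0 ?sqr_ge0.
- exact: sum_weights_le.
have : 2 * (tau (f * f) + - tau (der f * der f) / b ^+ 2) <=
    2 * (A + B / b ^+ 2).
  by rewrite ler_wpM2l// lerD// ler_wpM2r// invr_ge0 sqr_ge0.
apply: le_trans; rewrite tf td opprK mulr_suml -big_split mulr_sumr.
apply: ler_sum => i _; rewrite coef_der -/(k i) exprMn.
rewrite [X in _ <= 2 * (_ + X)]mulrAC -[X in _ <= 2 * (X + _)]mul1r -mulrDl mulrA.
rewrite ler_wpM2r ?sqr_ge0//.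
have -> : (k i)%:~R ^+ 2 / b ^+ 2 = (`|(k i)%:~R| / b) ^+ 2 :> R.
  by rewrite exprMn real_normK ?num_real// exprVn.
rewrite /W; set x := `|_| / b.
by have := sqr_ge0 (1 - x); rewrite !expr2; lra.
Qed.

End one_dim.

Section poisson_kernel.
Context (R : realType).
Implicit Types (r u t : R).

Lemma poisson_partial r t T :
  (1 - 2 * r * cos t + r ^+ 2) *
    (1 + 2 * \sum_(j < T) r ^+ j.+1 * cos (j.+1%:R * t)) =
  1 - r ^+ 2 - 2 * r ^+ T.+1 * cos (T.+1%:R * t) + 2 * r ^+ T.+2 * cos (T%:R * t).
Proof.
elim: T => [|T IH].
  by rewrite big_ord0 mul0r cos0 mul1r !exprS expr0; ring.
rewrite big_ord_recr /= [2 * (_ + _)]mulrDr addrA mulrDr IH.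
have -> : cos (T%:R * t) = 2 * cos t * cos (T.+1%:R * t) - cos (T.+2%:R * t).
  rewrite -[T.+2]addn1 natrD -[T.+1]addn1 natrD.
  have -> : T%:R * t = (T%:R + 1) * t - t by ring.
  have -> : (T%:R + 1 + 1) * t = (T%:R + 1) * t + t by ring.
  by rewrite cosB cosD; ring.
by rewrite !exprS; ring.
Qed.

(* The right-hand side is the Poisson kernel, truncated so that it is the symbol
   of a finite combination; the last term covers the truncation error. *)
Lemma resolvent_le u t T : 1 <= u -> forall r, r = (u - 1) / (u + 1) ->
  (1 + (u ^+ 2 - 1) / 2 * (1 - cos t))^-1 <=
  u^-1 * (1 + 2 * \sum_(j < T) r ^+ j.+1 * cos (j.+1%:R * t) +
          4 * r ^+ T / (1 - r) ^+ 2).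
Proof.
move=> u1 r rE; have u0 : 0 < u by lra.
have r0 : 0 <= r by rewrite rE divr_ge0//; lra.
have r1 : r < 1 by rewrite rE ltr_pdivrMr; lra.
have c1 := cos_le1 t; have cN1 := cos_geN1 t.
set D := 1 - 2 * r * cos t + r ^+ 2.
have D0 : (1 - r) ^+ 2 <= D by rewrite /D; nra.
have sr0 : 0 < (1 - r) ^+ 2 by rewrite exprn_gt0// subr_gt0.
have {}D0' : 0 < D by exact: lt_le_trans D0.
(* The value of [r] is the one for which the resolvent is exactly [u^-1] times the Poisson
   kernel. *)
have -> : (1 + (u ^+ 2 - 1) / 2 * (1 - cos t))^-1 = u^-1 * ((1 - r ^+ 2) / D).
  have uc : 0 <= (u ^+ 2 - 1) * (1 - cos t).
    by rewrite mulr_ge0 ?subr_ge0// exprn_ege1.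
  rewrite /D rE; field; apply/and4P; split; rewrite gt_eqF//; [lra| |lra].
  have -> : (u + 1 - 2 * (u - 1) * cos t) * (u + 1) + (u - 1) ^+ 2 =
    2 * ((u ^+ 2 - 1) * (1 - cos t)) + 4 by ring.
  lra.
rewrite ler_wpM2l ?invr_ge0 ?(ltW u0)// ler_pdivrMr// mulrC.
rewrite mulrDr poisson_partial -/D.
have cT : 2 * r ^+ T.+1 * cos (T.+1%:R * t) <= 2 * r ^+ T.
  rewrite -mulrA ler_wpM2l// exprS mulrAC -[leRHS]mul1r.
  rewrite ler_wpM2r ?exprn_ge0//.
  by have := cos_le1 (T.+1%:R * t); have := cos_geN1 (T.+1%:R * t); nra.
have cT' : - (2 * r ^+ T) <= 2 * r ^+ T.+2 * cos (T%:R * t).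
  rewrite -mulrA -mulrN ler_wpM2l// !exprS mulrA mulrAC -[leLHS]mulN1r.
  rewrite ler_wpM2r ?exprn_ge0//.
  have rr : r * r <= 1 by nra.
  have rr0 : 0 <= r * r by rewrite mulr_ge0.
  by have := cos_le1 (T%:R * t); have := cos_geN1 (T%:R * t); nra.
(* The two boundary terms left by the truncation are at most [2 * r ^+ T] each, and [D0] lets the
   error term of the statement absorb both. *)
have : 4 * r ^+ T <= D * (4 * r ^+ T / (1 - r) ^+ 2).
  rewrite mulrA ler_pdivlMr// mulrC ler_wpM2r// mulr_ge0// exprn_ge0//.
lra.
Qed.

End poisson_kernel.

Section walk.
Context (R : realType) (L : nat) (w : 'I_L -> R).
Hypotheses (w0 : forall i, 0 <= w i) (w1 : \sum_i w i = 1).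
Implicit Types (t s : R) (f : galg R int).

Definition walk_gen : galg R int :=
  \sum_i gcst int (w i) * (1 - avg2 R (i.+1%:Z)).
Definition walk_symbol t : R := \sum_i w i * (1 - cos (i.+1%:R * t)).
Definition walk_var : R := \sum_i w i * i.+1%:R ^+ 2.

Local Notation X := walk_gen.
Local Notation x := walk_symbol.

Lemma eig_walk t : eig t X (x t).
Proof.
apply: eig_sum => i; apply: eigM; first exact: eig_cst.
by apply: eigD; [exact: eig1|apply: eigN; exact: eig_avg2].
Qed.

Lemma parity_walk : parity 1 X.
Proof.
apply: parity_sum => i.
have := parityM (parity_cst (w i)) (parityD (@parity1 R)
  (parityN (@parity_avg2 R i.+1%:Z))).
by rewrite mulr1.
Qed.

Lemma walk_symbol_ge0 t : 0 <= x t.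
Proof. by apply: sumr_ge0 => i _; rewrite mulr_ge0// subr_ge0 cos_le1. Qed.

Lemma walk_symbol_le2 t : x t <= 2.
Proof.
have -> : 2 = \sum_i w i * 2 :> R by rewrite -mulr_suml w1 mul1r.
apply: ler_sum => i _; by rewrite ler_wpM2l//; have := cos_geN1 (i.+1%:R * t); lra.
Qed.

(** The derivative of [walk_symbol] in [t]. *)
Definition walk_slope t : R := \sum_i w i * (i.+1%:R * sin (i.+1%:R * t)).

Lemma der_walk_csn t : der X (csn t) = fun y => walk_slope t * snn t y.
Proof.
apply/funext => y; rewrite der_sum gsumE /walk_slope mulr_suml; apply: eq_bigr => i _.
rewrite derM der_cst mul0r add0r gmulE gcstE derD derN der1 add0r goppE.
rewrite der_avg2_csn mulNr opprK; exact: mulrA.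
Qed.

Lemma der_walk_snn t : der X (snn t) = fun y => - walk_slope t * csn t y.
Proof.
apply/funext => y; rewrite der_sum gsumE /walk_slope -sumrN mulr_suml; apply: eq_bigr => i _.
rewrite derM der_cst mul0r add0r gmulE gcstE derD derN der1 add0r goppE.
rewrite der_avg2_snn mulNr mulrN; congr (- _); exact: mulrA.
Qed.

(** Cauchy-Schwarz together with [sin ^+ 2 <= 2 * (1 - cos)]. This is where the variance enters the
    norm bounds. *)
Lemma walk_slope_le t : walk_slope t ^+ 2 <= 2 * walk_var * x t.
Proof.
rewrite /walk_slope; apply: le_trans (cauchy_schwarz_sum (fun i : 'I_L => i.+1%:R)
  (fun i : 'I_L => sin (i.+1%:R * t)) w0) _.
rewrite -/walk_var -mulrA [leRHS]mulrCA ler_wpM2l//.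
  by apply: sumr_ge0 => i _; rewrite mulr_ge0 ?sqr_ge0.
rewrite /walk_symbol mulr_sumr; apply: ler_sum => i _; rewrite [leRHS]mulrCA ler_wpM2l//.
rewrite sin2cos2; have := cos_le1 (i.+1%:R * t); have := cos_geN1 (i.+1%:R * t).
nra.
Qed.

Lemma resolvent_convex s (a : 'I_L -> R) : 0 <= s -> (forall i, 0 <= a i) ->
  (1 + s * \sum_i w i * a i)^-1 <= \sum_i w i * (1 + s * a i)^-1.
Proof.
move=> s0 a0; set A := 1 + s * _.
have A0 : 0 < A by rewrite ltr_pwDl// mulr_ge0// sumr_ge0// => i _; rewrite mulr_ge0.
have AE : A = \sum_i w i * (1 + s * a i).
  rewrite /A mulr_sumr -[in LHS]w1 -big_split; apply: eq_bigr => i _ /=; ring.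
(* Jensen's inequality through the tangent of [1 / z] at the mean [A]: each term of the comparison
   then differs by a square over a positive number. *)
have -> : A^-1 = \sum_i w i * (2 / A - (1 + s * a i) / A ^+ 2).
  rewrite (eq_bigr (fun i => w i * (2 / A) - w i * (1 + s * a i) / A ^+ 2)).
    rewrite sumrB -!mulr_suml w1 -AE; field; lra.
  by move=> i _; rewrite mulrBr [X in _ - X]mulrA.
apply: ler_sum => i _; rewrite ler_wpM2l//.
have b0 : 0 < 1 + s * a i by rewrite ltr_pwDl// mulr_ge0.
rewrite -subr_ge0.
have -> : (1 + s * a i)^-1 - (2 / A - (1 + s * a i) / A ^+ 2) =
   (A - (1 + s * a i)) ^+ 2 / ((1 + s * a i) * A ^+ 2).
  by field; rewrite !gt_eqF.
by rewrite divr_ge0 ?sqr_ge0// (mulr_ge0 (ltW b0)) ?sqr_ge0.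
Qed.

Lemma tau_avg2 (k : int) : k != 0 -> tau (avg2 R k) = 0.
Proof.
move=> k0; rewrite /tau avg2E add0r sub0r /kron oppr_eq0 (negbTE k0).
by rewrite addr0 mul0r.
Qed.

(* By convexity of [1 / y] the resolvent of the walk is dominated by a mixture
   of resolvents of the walks with steps [k] and [- k], where [resolvent_le]
   applies. *)
Lemma tau_resolvent f kap s : 0 <= kap -> 0 <= s ->
  (forall t, f (csn t) 0 <= kap / (1 + s * x t)) ->
  tau f <= kap / Num.sqrt (1 + 2 * s).
Proof.
move=> k0 s0 fs; set u := Num.sqrt _.
have u1 : 1 <= u by rewrite /u -[leLHS]sqrtr1 ler_wsqrtr//; lra.
have sE : s = (u ^+ 2 - 1) / 2 by rewrite sqr_sqrtr; lra.
pose r := (u - 1) / (u + 1).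
have r0 : 0 <= r by rewrite divr_ge0//; lra.
have r1 : r < 1 by rewrite ltr_pdivrMr; lra.
pose e T := 4 * r ^+ T / (1 - r) ^+ 2.
have main T : tau f <= kap / u * (1 + e T).
  (* A mixture of truncated Poisson kernels, one for each step size. Its symbol dominates that of
     [f], and the averages in it move by nonzero amounts, so only the constant term contributes to
     [tau g]. *)
  pose g : galg R int := \sum_i gcst int (kap / u * w i) * (gcst int (1 + e T) +
    \sum_(j < T) gcst int (2 * r ^+ j.+1) * avg2 R (j.+1 * i.+1)%N%:Z).
  have -> : kap / u * (1 + e T) = tau g.
    transitivity (\sum_i kap / u * w i * (1 + e T)).
      by rewrite -mulr_suml -mulr_sumr w1 mulr1.
    rewrite /tau gsumE; apply: eq_bigr.
    move=> i _; rewrite gmulE gcstE gaddE gsumE big1 ?addr0.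
      by rewrite gcstE mulr1.
    by move=> j _; rewrite gmulE gcstE [X in _ * X]tau_avg2// mulr0.
  apply: tau_le => t; apply: le_trans (fs t) _.
  have gE : eig t g (\sum_i (kap / u * w i) * ((1 + e T) +
     \sum_(j < T) (2 * r ^+ j.+1) * cos ((j.+1 * i.+1)%N%:R * t))).
    apply: eig_sum => i; apply: eigM; first exact: eig_cst.
    apply: eigD; first exact: eig_cst.
    apply: eig_sum => j; apply: eigM; first exact: eig_cst.
    exact: eig_avg2.
  rewrite (eig_csn0 gE).
  apply: le_trans (ler_wpM2l k0 (resolvent_convex s0 _)) _.
    by move=> i; rewrite subr_ge0 cos_le1.
  rewrite mulr_sumr; apply: ler_sum => i _.
  rewrite mulrCA [leRHS]mulrAC [leRHS]mulrC ler_wpM2l//.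
  rewrite -mulrA ler_wpM2l// sE.
  apply: le_trans (resolvent_le _ T u1 (erefl r)) _; rewrite -/(e T).
  rewrite ler_wpM2l ?invr_ge0 ?sqrtr_ge0// addrAC lerD2l.
  rewrite mulr_sumr; apply: ler_sum => j _.
  by rewrite mulrA natrM mulrA.
(* The bound holds for every truncation, and the truncation error is geometric in [T]. *)
have cv : (fun T => kap / u * (1 + e T)) @ \oo --> kap / u * (1 + 4 * 0 / (1 - r) ^+ 2).
  apply: cvgM; first exact: cvg_cst.
  apply: cvgD; first exact: cvg_cst.
  apply: cvgM; last exact: cvg_cst.
  apply: cvgM; first exact: cvg_cst.
  by apply: cvg_expr; rewrite ger0_norm.
have <- : lim ((fun T => kap / u * (1 + e T)) @ \oo) = kap / u.
  by rewrite (cvg_lim _ cv)// mulr0 mul0r addr0 mulr1.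
apply: limr_ge; first by apply/cvg_ex; eexists; exact: cv.
by near=> T; exact: main.
Unshelve. all: by end_near.
Qed.

(** [nrm_carlson] with both l2 norms bounded by [tau_resolvent]. As [der f = g * der X], the norm
    weighted by [k] is a mean of [m1 ^+ 2] times the squared slope, whence the factor
    [2 * walk_var * x]; [b] is free to balance the two norms. *)
Lemma smoothing_criterion f g (m m1 : R -> R) kap b s :
  0 <= kap -> 0 < b -> 0 <= s -> parity 1 f -> der f = g * der X ->
  (forall t, eig t f (m t)) -> (forall t, eig t g (m1 t)) ->
  (forall t, m t ^+ 2 <= kap / (1 + s * x t)) ->
  (forall t, 2 * walk_var * x t * m1 t ^+ 2 <= b ^+ 2 * kap / (1 + s * x t)) ->
  nrm f ^+ 2 <= (1 + 2 * b) * (4 * kap) / Num.sqrt (1 + 2 * s).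
Proof.
move=> k0 b0 s0 pf df fm gm mk m1k.
apply: le_trans (nrm_carlson b0 pf (A := kap / Num.sqrt (1 + 2 * s))
  (B := b ^+ 2 * kap / Num.sqrt (1 + 2 * s)) _ _) _.
- apply: tau_resolvent => // t.
  have [+ _] := eigM (fm t) (fm t); move=> ->; rewrite csn0 mulr1 -expr2; exact: mk.
- have -> : - tau (der f * der f) = tau (- (der f * der f)) by [].
  apply: tau_resolvent => //; first by rewrite mulr_ge0 ?sqr_ge0.
  move=> t; rewrite goppE df mulrACA gmulE.
  have -> : (der X * der X) (csn t) = fun y => - walk_slope t ^+ 2 * csn t y.
    apply/funext => y; rewrite gmulE der_walk_csn gopZ der_walk_snn expr2; ring.
  have [+ _] := eigM (gm t) (gm t); rewrite gopZ => ->; rewrite csn0 mulr1 mulNr opprK.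
  apply: le_trans (m1k t); rewrite -expr2 ler_wpM2r ?sqr_ge0//.
  exact: walk_slope_le.
have bE : b ^+ 2 != 0 by rewrite expf_neq0// gt_eqF.
rewrite -[leRHS]mulrA ler_wpM2l//; first by lra.
set S := Num.sqrt _; have -> : b ^+ 2 * kap / S / b ^+ 2 = kap / S.
  by rewrite mulrC mulrA mulrA mulVf ?mul1r.
by rewrite -[leRHS]mulrA; lra.
Qed.

End walk.

(** * Smoothing by lazy walks *)

Section exp_bounds.
Context (R : realType).
Implicit Types (y z c : R).

(** The bound [1 + z <= expR z] at [z = 1/16], squared four times with rounding down. *)
Lemma expR1_ge : 13 / 5 <= expR 1 :> R.
Proof.
have -> : 1 = 16%:R * 16^-1 :> R by rewrite divff// pnatr_eq0.
rewrite expRM_natl.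
have h : 17 / 16 <= expR 16^-1 :> R.
  by apply: le_trans (expR_ge1Dx _); lra.
set e := expR _ in h *.
have h2 : 1128 / 1000 <= e ^+ 2 by rewrite expr2; nra.
have h4 : 1272 / 1000 <= (e ^+ 2) ^+ 2 by rewrite [leRHS]expr2; nra.
have h8 : 1617 / 1000 <= ((e ^+ 2) ^+ 2) ^+ 2 by rewrite [leRHS]expr2; nra.
have -> : e ^+ 16 = (((e ^+ 2) ^+ 2) ^+ 2) ^+ 2 by rewrite -!exprM.
by rewrite [leRHS]expr2; nra.
Qed.

Lemma mul_expRN_le z : z * expR (- z) <= 5 / 13.
Proof.
have h : z <= expR (z - 1) by apply: le_trans (expR_ge1Dx _); lra.
apply: le_trans (_ : _ <= expR (z - 1) * expR (- z)) _.
  by rewrite ler_wpM2r ?expR_ge0.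
rewrite -expRD addrAC subrr add0r expRN -[leRHS]invf_div lef_pV2 ?posrE ?expR_gt0//.
exact: expR1_ge.
Qed.

(** The maximum of [z * expR (- z)] is taken at [z = c * y / n.+1] and raised to the power [n.+1];
    apart from replacing [e] by 13/5 this is the true maximum over [y]. *)
Lemma pow_expRN_le y c n : 0 <= y -> 0 < c ->
  y ^+ n.+1 * expR (- (c * y)) <= (n.+1%:R * 5 / (13 * c)) ^+ n.+1.
Proof.
move=> y0 c0.
have n0 : 0 < n.+1%:R :> R by rewrite ltr0n.
have nM := expRM_natl n.+1 (- (c * y / n.+1%:R)).
have := mul_expRN_le (c * y / n.+1%:R).
move: nM n0; set m : R := n.+1%:R => nM n0.
have -> : - (c * y) = m * - (c * y / m) by field; rewrite gt_eqF.
rewrite nM; set E := expR _ => h.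
have E0 : 0 <= E by exact: expR_ge0.
have k0 : 0 <= m * 5 / (13 * c) by rewrite divr_ge0 ?mulr_ge0// ltW.
rewrite -exprMn lerXn2r ?nnegrE//; first by rewrite mulr_ge0.
have -> : y * E = (c * y / m * E) * (m / c) by field; rewrite !gt_eqF.
have -> : m * 5 / (13 * c) = 5 / 13 * (m / c) by field; rewrite !gt_eqF.
by rewrite ler_wpM2r// divr_ge0// ltW.
Qed.

Lemma pow_expRN_num n c k y : 0 <= y -> 0 < c ->
  (n.+1%:R * 5 / (13 * c)) ^+ n.+1 <= k -> y ^+ n.+1 * expR (- (c * y)) <= k.
Proof. by move=> y0 c0; exact: le_trans (pow_expRN_le _ y0 c0). Qed.

(* The exponents in the next four lemmas are left unreduced, as the instances
   j = 0 and j = 1 of the hypotheses of [walk_smoothing]. *)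
Lemma smooth1_kap y : 0 <= y ->
  y ^+ (1 * 2) * expR (- (2 * y)) * (1 + y) <= 342 / 1000.
Proof.
move=> y0; have h2 := @pow_expRN_num 1 2 (148 / 1000) y y0 ltac:(lra) ltac:(lra).
have h3 := @pow_expRN_num 2 2 (193 / 1000) y y0 ltac:(lra) ltac:(lra).
move: h2 h3; set E := expR _ => h2 h3.
have -> : y ^+ (1 * 2) * E * (1 + y) = y ^+ 2 * E + y ^+ 3 * E by ring.
lra.
Qed.

Lemma smooth1_beta y : 0 <= y ->
  4 * (1 ^+ 2 * y ^+ (0 * 2).+1 * expR (- (2 * y)) +
    y ^+ (0 * 2).+3 * expR (- (19 / 10 * y))) * (1 + y) <=
  (342 / 100) ^+ 2 * (342 / 1000).
Proof.
move=> y0; have h1 := @pow_expRN_num 0 2 (193 / 1000) y y0 ltac:(lra) ltac:(lra).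
have h2 := @pow_expRN_num 1 2 (148 / 1000) y y0 ltac:(lra) ltac:(lra).
have h3 := @pow_expRN_num 2 (19/10) (224 / 1000) y y0 ltac:(lra) ltac:(lra).
have h4 := @pow_expRN_num 3 (19/10) (43 / 100) y y0 ltac:(lra) ltac:(lra).
move: h1 h2 h3 h4; set E := expR _; set E' := expR _ => h1 h2 h3 h4.
have -> : 4 * (1 ^+ 2 * y ^+ (0 * 2).+1 * E + y ^+ (0 * 2).+3 * E') * (1 + y) =
  4 * (y ^+ 1 * E + y ^+ 2 * E + y ^+ 3 * E' + y ^+ 4 * E') by ring.
lra.
Qed.

Lemma smooth2_kap y : 0 <= y ->
  y ^+ (2 * 2) * expR (- (2 * y)) * (1 + y) <= 118 / 100.
Proof.
move=> y0; have h2 := @pow_expRN_num 3 2 (351 / 1000) y y0 ltac:(lra) ltac:(lra).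
have h3 := @pow_expRN_num 4 2 (822 / 1000) y y0 ltac:(lra) ltac:(lra).
move: h2 h3; set E := expR _ => h2 h3.
have -> : y ^+ (2 * 2) * E * (1 + y) = y ^+ 4 * E + y ^+ 5 * E by ring.
lra.
Qed.

Lemma smooth2_beta y : 0 <= y ->
  4 * (2 ^+ 2 * y ^+ (1 * 2).+1 * expR (- (2 * y)) +
    y ^+ (1 * 2).+3 * expR (- (19 / 10 * y))) * (1 + y) <=
  (469 / 100) ^+ 2 * (118 / 100).
Proof.
move=> y0; have h1 := @pow_expRN_num 2 2 (193 / 1000) y y0 ltac:(lra) ltac:(lra).
have h2 := @pow_expRN_num 3 2 (351 / 1000) y y0 ltac:(lra) ltac:(lra).
have h3 := @pow_expRN_num 4 (19/10) (107 / 100) y y0 ltac:(lra) ltac:(lra).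
have h4 := @pow_expRN_num 5 (19/10) (322 / 100) y y0 ltac:(lra) ltac:(lra).
move: h1 h2 h3 h4; set E := expR _; set E' := expR _ => h1 h2 h3 h4.
have -> : 4 * (2 ^+ 2 * y ^+ (1 * 2).+1 * E + y ^+ (1 * 2).+3 * E') * (1 + y) =
  4 * (4 * (y ^+ 3 * E) + 4 * (y ^+ 4 * E) + y ^+ 5 * E' + y ^+ 6 * E') by ring.
lra.
Qed.

Lemma le_of_sqr y z : 0 <= z -> y ^+ 2 <= z ^+ 2 -> y <= z.
Proof. by move=> z0; rewrite !expr2; case: (leP y z) => // zy; nra. Qed.

(** 71/100 is slightly more than the inverse square root of 2. *)
Lemma sqrt_ratio y : 0 <= y -> Num.sqrt y <= 71 / 100 * Num.sqrt (1 + 2 * y).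
Proof.
move=> y0; have h : 0 <= 1 + 2 * y by lra.
have c0 : 0 <= 71 / 100 :> R by lra.
rewrite -ler_sqr ?nnegrE ?(mulr_ge0 c0) ?sqrtr_ge0//.
rewrite exprMn (sqr_sqrtr y0) (sqr_sqrtr h) expr2; lra.
Qed.

End exp_bounds.

Section smoothing.
Context (R : realType) (L : nat) (w : 'I_L -> R).
Hypotheses (w0 : forall i, 0 <= w i) (w1 : \sum_i w i = 1).
Implicit Types (r lam : R) (N : nat).

Local Notation X := (walk_gen w).
Local Notation x := (walk_symbol w).
Local Notation V := (walk_var w).

Lemma walk_var_ge1 : 1 <= V.
Proof.
rewrite -w1; apply: ler_sum => i _; rewrite -[leLHS]mulr1 ler_wpM2l//.
by rewrite exprn_ege1// ler1n.
Qed.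

Definition lazy_step r : galg R int := 1 - gcst int r * X.

Lemma eig_lazy r t : eig t (lazy_step r) (1 - r * x t).
Proof.
apply: eigD; first exact: eig1.
by apply/eigN/eigM; [exact: eig_cst|exact: eig_walk].
Qed.

Lemma parity_lazy r : parity 1 (lazy_step r).
Proof.
apply: parityD; first exact: parity1.
have := parityN (parityM (parity_cst r) (parity_walk w)).
by rewrite mulr1.
Qed.

Lemma der_lazy r : der (lazy_step r) = - (gcst int r * der X).
Proof. by rewrite derD der1 add0r derN derM der_cst mul0r add0r. Qed.

Lemma parity_smooth r j N : parity 1 (X ^+ j * lazy_step r ^+ N).
Proof.
have := parityM (parityX j (parity_walk w)) (parityX N (parity_lazy r)).
by rewrite mulr1.
Qed.

(** With [a = lam * N] and [y = a * x t], the squared symbol is at most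
    [y ^+ (j.+1 * 2) * expR (- (2 * y))] over a power of [a]. Comparison with a resolvent of
    parameter [a] thus reduces to the two inequalities in [y]. A [lam] smaller than [r] allows for
    negative values of [1 - r * x], at the price of the ratio [r / lam]. *)
Lemma walk_smoothing r lam j N kap beta :
  0 < lam -> lam <= r -> (forall t, `|1 - r * x t| <= expR (- (lam * x t))) ->
  (20 <= N)%N -> 0 < kap -> 0 < beta ->
  (forall y, 0 <= y ->
    y ^+ (j.+1 * 2) * expR (- (2 * y)) * (1 + y) <= kap) ->
  (forall y, 0 <= y ->
    4 * (j.+1%:R ^+ 2 * y ^+ (j * 2).+1 * expR (- (2 * y)) +
      y ^+ (j * 2).+3 * expR (- (19 / 10 * y))) * (1 + y) <= beta ^+ 2 * kap) ->
  nrm (X ^+ j.+1 * lazy_step r ^+ N) ^+ 2 <=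
  (4 * kap + 8 * (71 / 100) * beta * kap * (r / lam) * Num.sqrt V) /
  (lam * N%:R) ^+ (j.+1 * 2).
Proof.
move=> l0 lr lx N20 k0 b0 hk hb; set a := lam * N%:R.
have N0 : 0 < N%:R :> R by rewrite ltr0n (leq_trans _ N20).
have a0 : 0 < a by rewrite mulr_gt0.
have V0 : 0 < V by apply: lt_le_trans walk_var_ge1.
have [rho rhoE] : {rho : R | rho = r / lam} by exists (r / lam).
have rho1 : 1 <= rho by rewrite rhoE ler_pdivlMr// mul1r.
(* The scale at which the weighted norm matches the plain one. Its factor [sqrt a] is compensated at
   the end by [1 / sqrt (1 + 2 * a)], which leaves only [sqrt V]. *)
pose b := beta * rho * Num.sqrt V * Num.sqrt a.
have bgt0 : 0 < b by rewrite !mulr_gt0 ?sqrtr_gt0//; rewrite (lt_le_trans _ rho1).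
have bE : b ^+ 2 = beta ^+ 2 * rho ^+ 2 * V * a.
  by rewrite /b !exprMn !sqr_sqrtr// ltW.
pose m t := x t ^+ j.+1 * (1 - r * x t) ^+ N.
pose m1 t := j.+1%:R * x t ^+ j * (1 - r * x t) ^+ N -
  r * (N%:R * x t ^+ j.+1 * (1 - r * x t) ^+ N.-1).
pose g : galg R int := j.+1%:R * X ^+ j * lazy_step r ^+ N -
  gcst int r * (N%:R * X ^+ j.+1 * lazy_step r ^+ N.-1).
have fm t : eig t (X ^+ j.+1 * lazy_step r ^+ N) (m t).
  by apply: eigM; apply: eigX; [exact: eig_walk|exact: eig_lazy].
have eign t n : eig t n%:R n%:R.
  by rewrite -[X in eig _ X _](rmorph_nat (gcst int)); exact: eig_cst.
have gm t : eig t g (m1 t).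
  have ex i := eigX i (eig_walk w t); have el i := eigX i (eig_lazy r t).
  apply: eigD; first by apply: eigM => //; apply: eigM.
  apply: eigN; apply: eigM; first exact: eig_cst.
  by apply: eigM => //; apply: eigM.
have dg : der (X ^+ j.+1 * lazy_step r ^+ N) = g * der X.
  by rewrite derM !derX der_lazy /g /=; ring.
have ex t n c : c <= 2 * n%:R / N%:R -> (0 < n)%N ->
    ((1 - r * x t) ^+ n) ^+ 2 <= expR (- (c * (a * x t))).
  move=> cn n0; rewrite -exprM mulnC exprM -[X in X ^+ n]real_normK ?num_real//.
  apply: le_trans (_ : _ <= (expR (- (lam * x t)) ^+ 2) ^+ n) _.
    by rewrite lerXn2r ?nnegrE ?sqr_ge0// lerXn2r ?nnegrE ?expR_ge0.
  rewrite -exprM -expRM_natl ler_expR mulrN lerN2.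
  have x0 := walk_symbol_ge0 w0 t.
  have -> : (2 * n)%N%:R * (lam * x t) = 2 * n%:R / N%:R * (a * x t).
    by rewrite natrM /a; field; rewrite gt_eqF.
  by rewrite ler_wpM2r// mulr_ge0// ltW.
have N1 : 0 < N.-1%:R :> R by rewrite ltr0n; case: (N) N20 => [|[]].
apply: le_trans (smoothing_criterion (kap := kap / a ^+ (j.+1 * 2)) (s := a)
  w0 w1 _ bgt0 (ltW a0) (parity_smooth r j.+1 N) dg fm gm _ _) _.
- by rewrite divr_ge0 ?exprn_ge0// ltW.
- move=> t; have x0 := walk_symbol_ge0 w0 t; set y := a * x t.
  have y0 : 0 <= y by rewrite mulr_ge0// ltW.
  rewrite ler_pdivlMr; last by lra.
  rewrite ler_pdivlMr ?exprn_gt0//; apply: le_trans (hk y y0).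
  rewrite /m exprMn -exprM mulrAC ler_wpM2r//; first by lra.
  rewrite mulrAC -exprMn (mulrC _ a) -/y ler_wpM2l ?exprn_ge0//.
  apply: ex; last by rewrite (leq_trans _ N20).
  by rewrite mulfK// gt_eqF.
- move=> t; have x0 := walk_symbol_ge0 w0 t; set y := a * x t.
  have y0 : 0 <= y by rewrite mulr_ge0// ltW.
  rewrite ler_pdivlMr; last by lra.
  rewrite mulrA ler_pdivlMr ?exprn_gt0// bE.
  set E2 := expR (- (2 * y)); set E19 := expR (- (19 / 10 * y)).
  have e2 : ((1 - r * x t) ^+ N) ^+ 2 <= E2.
    apply: ex; last by rewrite (leq_trans _ N20).
    by rewrite mulfK// gt_eqF.
  (* Differentiation removes one factor, and [20 <= N] ensures [2 * (N - 1) / N >= 19 / 10]. *)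
  have e19 : ((1 - r * x t) ^+ N.-1) ^+ 2 <= E19.
    apply: ex; last by rewrite -(ltr0n R).
    have NE : N%:R = N.-1%:R + 1 :> R by rewrite natr1 (ltn_predK N20).
    rewrite ler_pdivlMr// NE.
    have : 19 <= N.-1%:R :> R by rewrite ler_nat -ltnS (ltn_predK N20).
    lra.
  have := hb y y0; rewrite -/E2 -/E19 => hby.
  have m1le : m1 t ^+ 2 * a ^+ (j * 2) <= 2 * rho ^+ 2 *
      (j.+1%:R ^+ 2 * y ^+ (j * 2) * E2 + y ^+ (j * 2).+2 * E19).
    rewrite /m1; set u := j.+1%:R * _ * _; set v := r * _.
    have uv : (u - v) ^+ 2 <= 2 * (u ^+ 2 + v ^+ 2).
      by have := sqr_ge0 (u + v); rewrite !expr2; lra.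
    apply: le_trans (ler_wpM2r (exprn_ge0 _ (ltW a0)) uv) _.
    rewrite -[leLHS]mulrA -[leRHS]mulrA ler_wpM2l// mulrDl mulrDr; apply: lerD.
      have -> : u ^+ 2 * a ^+ (j * 2) =
          j.+1%:R ^+ 2 * y ^+ (j * 2) * ((1 - r * x t) ^+ N) ^+ 2.
        by rewrite /u /y (exprMn _ a) !(exprMn 2) -(exprM (x t) j 2); ring.
      apply: le_trans (_ : _ <= 1 * (j.+1%:R ^+ 2 * y ^+ (j * 2) * E2)) _.
        by rewrite mul1r ler_wpM2l// mulr_ge0 ?exprn_ge0.
      rewrite ler_wpM2r ?exprn_ege1//.
      by rewrite !mulr_ge0 ?exprn_ge0 ?expR_ge0.
    have -> : v ^+ 2 * a ^+ (j * 2) =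
        rho ^+ 2 * (y ^+ (j * 2).+2 * ((1 - r * x t) ^+ N.-1) ^+ 2).
      have rE : r = rho * lam by rewrite rhoE divfK// gt_eqF.
      have -> : v = rho * (a * x t ^+ j.+1 * (1 - r * x t) ^+ N.-1).
        by rewrite /v {1}rE /a; ring.
      have -> : y ^+ (j * 2).+2 = a ^+ (j * 2) * a ^+ 2 * (x t ^+ j.+1) ^+ 2.
        by rewrite -(exprM (x t)) /y (exprMn _ a) -exprD addn2.
      by ring.
    by rewrite ler_wpM2l ?sqr_ge0// ler_wpM2l// exprn_ge0.
  have -> : 2 * V * x t * m1 t ^+ 2 * (1 + y) * a ^+ (j.+1 * 2) =
     2 * V * a * (y * (1 + y) * (m1 t ^+ 2 * a ^+ (j * 2))).
    have -> : a ^+ (j.+1 * 2) = a ^+ (j * 2) * a ^+ 2 by rewrite -exprD addn2.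
    by rewrite /y; ring.
  apply: le_trans (_ : _ <= 2 * V * a * (y * (1 + y) * (2 * rho ^+ 2 *
      (j.+1%:R ^+ 2 * y ^+ (j * 2) * E2 + y ^+ (j * 2).+2 * E19)))) _.
    rewrite ler_wpM2l//; first exact: (mulr_ge0 (mulr_ge0 _ (ltW V0)) (ltW a0)).
    by rewrite ler_wpM2l// mulr_ge0//; lra.
  have -> : 2 * V * a * (y * (1 + y) * (2 * rho ^+ 2 *
      (j.+1%:R ^+ 2 * y ^+ (j * 2) * E2 + y ^+ (j * 2).+2 * E19))) =
    rho ^+ 2 * V * a * (4 * (j.+1%:R ^+ 2 * y ^+ (j * 2).+1 * E2 +
      y ^+ (j * 2).+3 * E19) * (1 + y)).
    by rewrite !exprS; ring.
  have -> : beta ^+ 2 * rho ^+ 2 * V * a * kap = rho ^+ 2 * V * a * (beta ^+ 2 * kap).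
    by ring.
  rewrite ler_wpM2l//; exact: (mulr_ge0 (mulr_ge0 (sqr_ge0 _) (ltW V0)) (ltW a0)).
set D := a ^+ _; have D0 : 0 < D by rewrite exprn_gt0.
set u := Num.sqrt (1 + 2 * a).
have u1 : 1 <= u by rewrite /u -[leLHS]sqrtr1 ler_wsqrtr//; lra.
have u0 : 0 < u by lra.
have ua : Num.sqrt a <= 71 / 100 * u := sqrt_ratio (ltW a0).
rewrite -rhoE ler_pdivrMr// [leRHS]mulrAC ler_pdivlMr//.
have -> : (1 + 2 * b) * (4 * (kap / D)) * D = 4 * kap + 8 * b * kap.
  by field; rewrite gt_eqF.
rewrite [leRHS]mulrDl; apply: lerD; first by rewrite ler_peMr// mulr_ge0// ltW.
have -> : 8 * b * kap = 8 * beta * kap * rho * Num.sqrt V * Num.sqrt a.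
  by rewrite /b; ring.
have -> : 8 * (71 / 100) * beta * kap * rho * Num.sqrt V * u =
   8 * beta * kap * rho * Num.sqrt V * (71 / 100 * u) by ring.
rewrite ler_wpM2l// !mulr_ge0 ?sqrtr_ge0//; try exact: ltW.
by rewrite (le_trans _ rho1).
Qed.

(** The constants obtained are [4 * 0.342 = 1.368] and [8 * 0.71 * 3.42 * 0.342 < 6.65]. Both are
    below 7.04, which is four times 1.76. *)
Lemma walk_smoothing1 r lam N : 0 < lam -> lam <= r ->
  (forall t, `|1 - r * x t| <= expR (- (lam * x t))) -> (20 <= N)%N ->
  nrm (X * lazy_step r ^+ N) ^+ 2 <=
  704 / 100 * (r / lam) * (1 + Num.sqrt V) / (lam * N%:R) ^+ 2.
Proof.
move=> l0 lr lx N20.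
have N0 : 0 < N%:R :> R by rewrite ltr0n (leq_trans _ N20).
have rho1 : 1 <= r / lam by rewrite ler_pdivlMr// mul1r.
have k0 : 0 < 342 / 1000 :> R by lra.
have b0 : 0 < 342 / 100 :> R by lra.
have := walk_smoothing (j := 0) l0 lr lx N20 k0 b0 (@smooth1_kap R) (@smooth1_beta R).
rewrite expr1 mul1n => /le_trans; apply.
rewrite ler_wpM2r ?invr_ge0 ?exprn_ge0 ?mulr_ge0 ?(ltW l0)//.
have : 0 <= Num.sqrt V by exact: sqrtr_ge0.
move: (Num.sqrt V) (r / lam) rho1 => s rho rho1 s0.
have := mulr_ge0 (le_trans ler01 rho1) s0; lra.
Qed.

(** For [r <= 1 / 2] the factor [1 - r * x] is nonnegative, so [lam = r] is allowed. The constant is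
    rounded up to the one for the square of the first-order bound, so that in a double sum over
    directions the diagonal terms look like the others. *)
Lemma walk_smoothing2 r N : 0 < r <= 1 / 2 -> (20 <= N)%N ->
  nrm (X ^+ 2 * lazy_step r ^+ N) <=
  704 / 100 * (1 + Num.sqrt V) / (r * N%:R) ^+ 2.
Proof.
move=> /andP[r0 r2] N20.
have N0 : 0 < N%:R :> R by rewrite ltr0n (leq_trans _ N20).
have lx t : `|1 - r * x t| <= expR (- (r * x t)).
  rewrite ger0_norm; first by apply: le_trans (expR_ge1Dx _); lra.
  have := walk_symbol_le2 w0 w1 t; have := walk_symbol_ge0 w0 t; nra.
have s0 : 0 <= Num.sqrt V by exact: sqrtr_ge0.
have D0 : 0 < (r * N%:R) ^+ 2 by rewrite exprn_gt0// mulr_gt0.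
apply: le_of_sqr; first by apply: divr_ge0 (ltW D0); lra.
have k0 : 0 < 118 / 100 :> R by lra.
have b0 : 0 < 469 / 100 :> R by lra.
have := walk_smoothing (j := 1) r0 (lexx r) lx N20 k0 b0 (@smooth2_kap R) (@smooth2_beta R).
move=> /le_trans; apply.
rewrite divff ?gt_eqF// [leRHS]exprMn exprVn -exprM; apply: ler_wpM2r.
  by rewrite invr_ge0 exprn_ge0// mulr_ge0// ltW.
rewrite mulr1 [leRHS]expr2; move: (Num.sqrt V) s0 => s s0.
have := mulr_ge0 s0 s0; lra.
Qed.

End smoothing.

Section seminorm.
Context (R : realType) (V : zmodType).
Implicit Types (f g : galg R V) (c : R).

Lemma nrm1 : nrm (1 : galg R V) <= 1.
Proof. by apply: nrm_le => h h1; rewrite goneE. Qed.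

Lemma nrmM_le f g a b : nrm f <= a -> nrm g <= b -> nrm (f * g) <= a * b.
Proof.
by move=> fa gb; apply: le_trans (nrmM f g) _; apply: ler_pM => //; exact: nrm_ge0.
Qed.

Lemma nrmM1 f g a : nrm f <= a -> nrm g <= 1 -> nrm (f * g) <= a.
Proof. by move=> fa g1; rewrite -[leRHS]mulr1; exact: nrmM_le. Qed.

Lemma nrmD_le f g a b : nrm f <= a -> nrm g <= b -> nrm (f + g) <= a + b.
Proof. by move=> fa gb; apply: le_trans (nrmD f g) _; exact: lerD. Qed.

Lemma nrmB_le f g a b : nrm f <= a -> nrm g <= b -> nrm (f - g) <= a + b.
Proof. by move=> fa gb; apply: nrmD_le; rewrite ?nrmN. Qed.

Lemma nrmX1 f n : nrm f <= 1 -> nrm (f ^+ n) <= 1.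
Proof.
move=> f1; elim: n => [|n IH]; first exact: nrm1.
by rewrite exprS; exact: nrmM1.
Qed.

Lemma nrmX_le f a n : nrm f <= a -> nrm (f ^+ n) <= a ^+ n.
Proof.
move=> fa; elim: n => [|n IH]; first exact: nrm1.
by rewrite !exprS; exact: nrmM_le.
Qed.

Lemma nrm_sum_le (I : Type) (r : seq I) (P : pred I) (F : I -> galg R V) (a : I -> R) :
  (forall i, P i -> nrm (F i) <= a i) ->
  nrm (\sum_(i <- r | P i) F i) <= \sum_(i <- r | P i) a i.
Proof.
move=> Fa; elim/big_rec2: _ => [|i x y Pi yx]; first by rewrite nrm0.
by apply: nrmD_le => //; exact: Fa.
Qed.

Lemma nrm_sum_const n (F : 'I_n -> galg R V) a :
  (forall i, nrm (F i) <= a) -> nrm (\sum_i F i) <= n%:R * a.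
Proof.
move=> Fa; apply: le_trans (nrm_sum_le (a := fun=> a) _ _) _ => //.
by rewrite sumr_const card_ord mulr_natl.
Qed.

Lemma nrmZ_le c f a : nrm f <= a -> nrm (gcst V c * f) <= `|c| * a.
Proof. by move=> fa; apply: nrmM_le => //; exact: nrm_cst_le. Qed.

Lemma nrm_sub_X f g n : nrm f <= 1 -> nrm g <= 1 ->
  nrm (f ^+ n - g ^+ n) <= n%:R * nrm (f - g).
Proof.
move=> f1 g1; rewrite subrXX mulrC; apply: nrmM_le => //.
rewrite -[leRHS]mulr1; apply: nrm_sum_const => i.
by rewrite -[leRHS]mulr1; apply: nrmM_le; exact: nrmX1.
Qed.

End seminorm.

(** * Comparison of powers with exponentials *)

Section exp_expansion.
Context (R : realType) (V : zmodType) (X : galg R V) (M : nat).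
Hypotheses (M0 : (0 < M)%N) (P1 : nrm (1 - gcst V M%:R^-1 * X) <= 1).

Local Notation u := (gcst V (M%:R^-1 : R)).
Local Notation P := (1 - u * X).

Lemma uM : u * M%:R = 1 :> galg R V.
Proof. by rewrite -(rmorph_nat (gcst V)) -rmorphM mulVf ?rmorph1// pnatr_eq0 -lt0n. Qed.

Lemma pow_sum1 l : P ^+ l = 1 - u * X * \sum_(t < l) P ^+ t.
Proof.
elim: l => [|l IH]; first by rewrite big_ord0 mulr0 subr0.
by rewrite big_ord_recr /= mulrDr opprD addrA -IH exprS mulrBl mul1r.
Qed.

Lemma one_sub_exp : exists2 f, nrm f <= 1 & 1 - P ^+ M = X * f.
Proof.
exists (u * \sum_(t < M) P ^+ t); last by rewrite pow_sum1; ring.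
rewrite [leRHS](_ : 1 = `|M%:R^-1| * (M%:R * 1)); last first.
  by rewrite ger0_norm ?invr_ge0// mulr1 mulVf// pnatr_eq0 -lt0n.
by apply: nrmZ_le; apply: nrm_sum_const => i; exact: nrmX1.
Qed.

(** Three applications of [pow_sum1]. The remainder is [u ^+ 3] times a sum of at most [M ^ 3]
    powers of the contraction [P], so it is bounded by 1 whatever the size of [X]; the quadratic
    coefficient is [M (M - 1) / 2] over [M ^ 2]. *)
Lemma exp_third_order : exists2 f, nrm f <= 1 &
  P ^+ M = 1 - X + gcst V ((1 - M%:R^-1) / 2) * X ^+ 2 - X ^+ 3 * f.
Proof.
pose S1 l := \sum_(t < l) P ^+ t; pose S2 l := \sum_(t < l) S1 t.
pose S3 := \sum_(t < M) S2 t.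
have M0' : M%:R != 0 :> R by rewrite pnatr_eq0 -lt0n.
have b1 l : nrm (S1 l) <= l%:R.
  by rewrite -[leRHS]mulr1; apply: nrm_sum_const => i; exact: nrmX1.
have b2 l : nrm (S2 l) <= l%:R * l%:R.
  apply: nrm_sum_const => i; apply: le_trans (b1 i) _.
  by rewrite ler_nat ltnW.
have b3 : nrm S3 <= M%:R * (M%:R * M%:R).
  apply: nrm_sum_const => i; apply: le_trans (b2 i) _.
  by rewrite -!natrM ler_nat leq_mul// ltnW.
exists (u ^+ 3 * S3).
  rewrite [leRHS](_ : 1 = (`|M%:R^-1| ^+ 3) * (M%:R * (M%:R * M%:R))); last first.
    by rewrite ger0_norm ?invr_ge0//; field.
  by apply: nrmM_le => //; apply: nrmX_le; exact: nrm_cst_le.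
have e1 l : S1 l = l%:R - u * X * S2 l.
  rewrite /S1 (eq_bigr (fun t : 'I_l => 1 - u * X * S1 t)); last first.
    by move=> t _; rewrite pow_sum1.
  by rewrite sumrB sumr_const card_ord -mulr_sumr.
have e2 : S2 M = gcst V (M%:R * (M%:R - 1) / 2) - u * X * S3.
  rewrite /S2 (eq_bigr (fun t : 'I_M => t%:R - u * X * S2 t)); last first.
    by move=> t _; rewrite e1.
  rewrite sumrB -mulr_sumr; congr (_ - _).
  have : \sum_(t < M) (t%:R : galg R V) = gcst V (\sum_(t < M) t%:R).
    by rewrite rmorph_sum /=; apply: eq_bigr => t _; rewrite rmorph_nat.
  move=> ->; congr (gcst V _).
  elim: (M) => [|m IH]; first by rewrite big_ord0 mul0r mul0r.
  by rewrite big_ord_recr /= IH -[m.+1]addn1 natrD; field.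
rewrite pow_sum1 -/(S1 M) e1 e2.
have -> : gcst V (M%:R * (M%:R - 1) / 2 : R) = M%:R ^+ 2 * gcst V ((1 - M%:R^-1) / 2).
  rewrite -(rmorph_nat (@gcst R V) M) -rmorphXn -rmorphM; congr (gcst V _).
  by field.
have := uM; set m : galg R V := M%:R; set v := u; set k := gcst V _ => vm.
have -> : 1 - v * X * (m - v * X * (m ^+ 2 * k - v * X * S3)) =
  1 - (v * m) * X + (v * m) ^+ 2 * k * X ^+ 2 - X ^+ 3 * (v ^+ 3 * S3) by ring.
by rewrite vm expr1n !mul1r.
Qed.

End exp_expansion.

Section second_order.
Context (R : realType) (V : zmodType) (X : galg R V) (M : nat).
Hypotheses (M0 : (0 < M)%N) (P1 : nrm (1 - gcst V M%:R^-1 * X) <= 1).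
Hypothesis X2 : nrm X <= 2.

Local Notation F := (1 - X).
Local Notation E := ((1 - gcst V M%:R^-1 * X) ^+ M).

(** Telescoping extracts [F - E], which is [- c2 X^2] with [c2] at most 1/2, plus a cubic rest. The
    rest contributes 1 to the coefficient of [T3] and the correction of the quadratic part another
    1/2; 5/4 is half of 5/2, the bound for [- c2 + X * r]. *)
Lemma nrm_pow_sub_exp n T3 T4 : 0 <= T3 -> 0 <= T4 ->
  (forall i j, (i + j = n.-1)%N -> nrm (X ^+ 3 * (F ^+ i * E ^+ j)) <= T3) ->
  (forall i j, (i + j = n.-2)%N -> nrm (X ^+ 4 * (F ^+ i * E ^+ j)) <= T4) ->
  nrm (F ^+ n - E ^+ n) <= n%:R / 2 * nrm (X ^+ 2 * E ^+ n) +
    3 / 2 * n%:R * T3 + 5 / 4 * n%:R ^+ 2 * T4.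
Proof.
move=> T30 T40 h3 h4; case: n h3 h4 => [|n] h3 h4.
  by rewrite !expr0 subrr nrm0 mulr0 expr0n !(mul0r, mulr0) !addr0.
have E1 : nrm E <= 1 by exact: nrmX1.
have [r r1 Er] := exp_third_order M0 P1.
have [r' r'1 Er'] := one_sub_exp M0 P1.
set c2 : R := (1 - M%:R^-1) / 2 in Er.
have M1 : 0 <= (M%:R^-1 : R) <= 1 by rewrite invr_ge0 ler0n invf_le1 ?ler1n ?ltr0n.
have c2b : `|c2| <= 1 / 2 by rewrite ger0_norm /c2; lra.
set e := E in Er Er' h3 h4 E1 *.
have FE : F - e = - (gcst V c2 * X ^+ 2) + X ^+ 3 * r by rewrite Er; ring.
have FE2 : F - e = X ^+ 2 * (- gcst V c2 + X * r) by rewrite FE; ring.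
have r2 : nrm (- gcst V c2 + X * r) <= 1 / 2 + 2 * 1.
  apply: nrmD_le; first by rewrite nrmN; apply: le_trans (nrm_cst_le _ _) _.
  exact: nrmM_le.
(* Passage from [F ^+ j * e ^+ k] to [e ^+ n.+1]: each [F] changed into [e] costs a further
   [X ^+ 2], and the one additional [e] costs a factor [X], since [1 - e = X * r']. *)
have step j k : (j + k = n)%N -> nrm (X ^+ 2 * (F ^+ j * e ^+ k)) <=
    nrm (X ^+ 2 * e ^+ n.+1) + T3 + 5 / 2 * n.+1%:R * T4.
  move=> jk.
  have -> : X ^+ 2 * (F ^+ j * e ^+ k) = X ^+ 2 * e ^+ n.+1 +
     X ^+ 3 * (F ^+ 0 * e ^+ n) * r' +
     (- gcst V c2 + X * r) * \sum_(i < j) X ^+ 4 * (F ^+ (j.-1 - i) * e ^+ (i + k)).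
    have -> : F ^+ j = e ^+ j + X ^+ 2 * (- gcst V c2 + X * r) *
        \sum_(i < j) F ^+ (j.-1 - i) * e ^+ i.
      by rewrite -FE2 -subrXX [RHS]addrC subrK.
    rewrite mulrDl -exprD jk mulrDr; congr (_ + _).
      rewrite expr0 mul1r [e ^+ n.+1]exprS.
      have -> : X ^+ 3 * e ^+ n * r' = X ^+ 2 * e ^+ n * (X * r') by ring.
      by rewrite -Er'; ring.
    rewrite !mulr_sumr mulr_suml mulr_sumr; apply: eq_bigr => i _.
    by rewrite (exprD e i k); ring.
  apply: nrmD_le; first apply: nrmD_le => //.
    by apply: nrmM1 => //; apply: h3.
  have -> : 5 / 2 * n.+1%:R * T4 = (1 / 2 + 2 * 1) * (n.+1%:R * T4) by field.
  apply: nrmM_le => //; apply: le_trans (_ : _ <= j%:R * T4) _.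
    apply: nrm_sum_const => i; apply: h4; rewrite /=.
    by move: (nat_of_ord i) (ltn_ord i) jk => i0; clear; lia.
  by rewrite ler_wpM2r// ler_nat -jk (leq_trans (leq_addr k j)).
rewrite subrXX FE mulrDl; set T2 := nrm (X ^+ 2 * e ^+ n.+1) in step *.
have -> : n.+1%:R / 2 * T2 + 3 / 2 * n.+1%:R * T3 + 5 / 4 * n.+1%:R ^+ 2 * T4 =
  1 / 2 * (n.+1%:R * (T2 + T3 + 5 / 2 * n.+1%:R * T4)) + n.+1%:R * T3 by field.
apply: nrmD_le.
  rewrite mulNr nrmN -[Z in nrm Z]mulrA mulr_sumr; apply: nrmM_le.
    by apply: le_trans (nrm_cst_le _ _) _.
  by apply: nrm_sum_const => i; apply: step => /=; rewrite subnK // -ltnS.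
rewrite mulrAC mulr_sumr; apply: nrmM1 => //.
by apply: nrm_sum_const => i; apply: h3 => /=; rewrite subnK // -ltnS.
Qed.

End second_order.

Section scalar.
Context (R : realType).

(** The mean of [1 / (B + 1)] for a binomial variable [B]. Absorbing [1 / i.+1] into the binomial
    coefficient gives the expansion of [(1 - a + a) ^+ k.+1] without its first term. *)
Lemma binomial_average (a : R) k : 0 <= a <= 1 ->
  a * \sum_(i < k.+1) 'C(k, i)%:R * (1 - a) ^+ (k - i) * a ^+ i * (i.+1%:R)^-1 <=
  k.+1%:R^-1.
Proof.
move=> /andP[a0 a1].
have -> : a * \sum_(i < k.+1) 'C(k, i)%:R * (1 - a) ^+ (k - i) * a ^+ i * (i.+1%:R)^-1
  = k.+1%:R^-1 * \sum_(i < k.+1) ((1 - a) ^+ (k.+1 - i.+1) * a ^+ i.+1) *+ 'C(k.+1, i.+1).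
  rewrite !mulr_sumr; apply: eq_bigr => i _.
  rewrite subSS -mulr_natr exprS.
  have := mul_bin_diag k.+1 i; rewrite /= => /(congr1 (fun n => n%:R : R)).
  rewrite !natrM => h.
  have i0 : i.+1%:R != 0 :> R by rewrite pnatr_eq0.
  have k0 : k.+1%:R != 0 :> R by rewrite pnatr_eq0.
  move: h i0 k0; set A : R := i.+1%:R; set B : R := k.+1%:R => h i0 k0.
  set c := 'C(k, i)%:R in h *; set d := 'C(k.+1, i.+1)%:R in h *.
  have -> : c = A * d / B by rewrite -h mulrAC divff// mul1r.
  by field; apply/andP.
have h1 : (1 - a + a) ^+ k.+1 = 1 by rewrite subrK expr1n.
rewrite ler_piMr// -[leRHS]h1 exprDn [leRHS]big_ord_recl lerDr.
by rewrite bin0 mulr1n mulr_ge0// exprn_ge0// subr_ge0.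
Qed.

End scalar.

Section product.
Context (R : realType) (V : zmodType) (I : eqType).

(** Allows one step of a mixture to be replaced by a product over directions at a second-order cost:
    the error added in the induction is the cross term [t i * T], which fits into the square of the
    sum. *)
Lemma prod_approx (r : seq I) (U : I -> galg R V) (t : I -> R) :
  (forall i, nrm (1 - U i) <= 1) -> (forall i, nrm (U i) <= t i) ->
  [/\ nrm (\prod_(i <- r) (1 - U i)) <= 1,
      nrm (1 - \prod_(i <- r) (1 - U i)) <= \sum_(i <- r) t i &
      nrm (\prod_(i <- r) (1 - U i) - (1 - \sum_(i <- r) U i)) <=
        (\sum_(i <- r) t i) ^+ 2].
Proof.
move=> U1 Ut; have t0 i : 0 <= t i by apply: le_trans (Ut i); exact: nrm_ge0.
elim: r => [|i r [h1 h2 h3]].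
  by rewrite !big_nil subr0 subrr nrm0 expr0n; split => //; exact: nrm1.
rewrite !big_cons.
set P := \prod_(_ <- _) _ in h1 h2 h3 *; set T := \sum_(_ <- _) t _ in h2 h3 *.
set Y := \sum_(_ <- _) _ in h3 *.
have T0 : 0 <= T by exact: sumr_ge0.
split.
- exact: nrmM1.
- have -> : 1 - (1 - U i) * P = U i * P + (1 - P) by ring.
  by apply: nrmD_le => //; exact: nrmM1.
- have -> : (1 - U i) * P - (1 - (U i + Y)) = U i * (1 - P) + (P - (1 - Y)) by ring.
  apply: le_trans (nrmD_le (nrmM_le (Ut i) h2) h3) _.
  by have := t0 i; nra.
Qed.

End product.

(** * Smoothing bounds for the mixture of all directions *)

Section mixture.
Context (R : realType) (V : zmodType) (K : nat) (X : 'I_K -> galg R V).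
Context (p s : 'I_K -> R) (q t c1 : R).
Hypotheses (F1 : forall m, nrm (1 - X m) <= 1) (q01 : 0 < q < 1).
Hypotheses (p0 : forall m, 0 < p m) (pq : \sum_m p m = 1 - q) (s1 : forall m, 1 <= s m).
Hypotheses (t0 : 0 < t) (tq : t ^+ 2 = q) (c10 : 0 <= c1) (c1E : c1 ^+ 2 = 704 / 100).
Hypothesis smooth1 : forall m r N, 0 < r <= 1 / 2 -> (20 <= N)%N ->
  nrm (X m * (1 - gcst V r * X m) ^+ N) <= c1 * s m / (r * N%:R).
Hypothesis smooth2 : forall m r N, 0 < r <= 1 / 2 -> (20 <= N)%N ->
  nrm (X m ^+ 2 * (1 - gcst V r * X m) ^+ N) <= c1 ^+ 2 * s m ^+ 2 / (r * N%:R) ^+ 2.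
Hypothesis smooth3 : forall m N,
  nrm (X m * (1 - gcst V (1 - q) * X m) ^+ N) <=
  60 * s m / ((1 - q) * t ^+ 3 * N.+1%:R).

Local Notation XX := (\sum_m gcst V (p m) * X m).
Local Notation F := (1 - XX).
Local Notation S := (\sum_m s m).

Lemma lazy_contraction m r : 0 <= r <= 1 -> nrm (1 - gcst V r * X m) <= 1.
Proof.
move=> /andP[r0 r1].
have -> : 1 - gcst V r * X m = gcst V (1 - r) + gcst V r * (1 - X m).
  by rewrite rmorphB rmorph1; ring.
apply: le_trans (nrmD_le (nrm_cst_le V (1 - r)) (nrmZ_le r (F1 m))) _.
by rewrite !ger0_norm; lra.
Qed.

Lemma nrm_gen m : nrm (X m) <= 2.
Proof.
have -> : X m = 1 - (1 - X m) by ring.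
have -> : 2 = 1 + 1 :> R by ring.
by apply: nrmB_le => //; exact: nrm1.
Qed.

Let p1 : 0 < 1 - q. Proof. by case/andP: q01 => _; rewrite subr_gt0. Qed.

(** As the [p m] add up to [1 - q], the atom at the origin can be shared among the directions: each
    becomes a lazy walk that rests with probability [q]. *)
Lemma mixture_split : F = \sum_m gcst V (p m / (1 - q)) * (1 - gcst V (1 - q) * X m).
Proof.
under [RHS]eq_bigr do rewrite mulrBr mulr1 mulrA -rmorphM divfK ?gt_eqF//.
rewrite sumrB -rmorph_sum -mulr_suml pq divff ?gt_eqF// rmorph1.
Qed.

Lemma mixture_contraction : nrm F <= 1.
Proof.
rewrite mixture_split; apply: le_trans (nrm_sum_le (a := fun m => p m / (1 - q)) _ _) _.
  move=> m _; rewrite -[leRHS]mulr1 -[X in X * 1]ger0_norm.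
    by apply: nrmZ_le; apply: lazy_contraction; case/andP: q01 => *; apply/andP; split; lra.
  by rewrite divr_ge0// ltW.
by rewrite -mulr_suml pq divff// gt_eqF.
Qed.

(** [F = W + a * L], where [L] steps in direction [m] and [W] has norm at most [1 - a]. Expanding
    the power leaves a binomial mean of [1 / i.+1], and [p m = a * (1 - q)] supplies both the [a]
    required by [binomial_average] and the [1 - q] in the denominator of [smooth3]. *)
Lemma mixture_smooth3 m k :
  p m * nrm (X m * F ^+ k) <= 60 * s m / (t ^+ 3 * k.+1%:R).
Proof.
have [a aE] : {a : R | a = p m / (1 - q)} by exists (p m / (1 - q)).
set L := 1 - gcst V (1 - q) * X m.
have a0 : 0 < a by rewrite aE divr_gt0.
pose W := F - gcst V a * L.
have W1 : nrm W <= 1 - a.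
  rewrite /W mixture_split (bigD1 m)//= aE addrC addrK -aE.
  apply: le_trans (nrm_sum_le (a := fun m => p m / (1 - q)) _ _) _.
    move=> i _; rewrite -[leRHS]mulr1 -[X in X * 1]ger0_norm.
      by apply: nrmZ_le; apply: lazy_contraction; case/andP: q01 => *; apply/andP; split; lra.
    by rewrite divr_ge0// ltW.
  have : \sum_i p i / (1 - q) = 1 by rewrite -mulr_suml pq divff// gt_eqF.
  by rewrite (bigD1 m)//= -aE => h; rewrite lerBrDl h.
have a1 : a <= 1 by rewrite -subr_ge0; apply: le_trans W1; exact: nrm_ge0.
have -> : F = W + gcst V a * L by rewrite /W subrK.
rewrite exprDn mulr_sumr.
pose c := 60 * s m / ((1 - q) * t ^+ 3).
have c0 : 0 <= c.
  by rewrite divr_ge0 ?mulr_ge0 ?exprn_ge0 ?(ltW p1) ?(ltW t0)// (le_trans _ (s1 m)).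
apply: le_trans (_ : _ <= p m * (c * \sum_(i < k.+1)
   'C(k, i)%:R * (1 - a) ^+ (k - i) * a ^+ i * (i.+1%:R)^-1)) _.
  rewrite ler_wpM2l ?(ltW (p0 m))// mulr_sumr; apply: nrm_sum_le => i _.
  have -> : X m * (W ^+ (k - i) * (gcst V a * L) ^+ i *+ 'C(k, i)) =
    gcst V ('C(k, i)%:R * a ^+ i) * (W ^+ (k - i) * (X m * L ^+ i)).
    by rewrite rmorphM rmorph_nat rmorphXn /= exprMn -mulr_natl; ring.
  apply: le_trans (nrmZ_le _ (nrmM_le (nrmX_le (k - i) W1) (smooth3 m i))) _.
  rewrite ger0_norm ?mulr_ge0 ?exprn_ge0 ?(ltW a0)// invfM -/c.
  by rewrite le_eqVlt; apply/orP; left; apply/eqP; rewrite /c; ring.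
rewrite mulrCA.
have -> : p m = a * (1 - q) by rewrite aE divfK// gt_eqF.
rewrite (mulrC a) -[_ * a * _]mulrA.
apply: le_trans (ler_wpM2l c0 (ler_wpM2l (ltW p1) (binomial_average k _))) _.
  by rewrite ltW.
rewrite le_eqVlt; apply/orP; left; apply/eqP.
by rewrite /c; field; rewrite addrC natr1 pnatr_eq0 !gt_eqF.
Qed.

Let S0 : 0 <= S.
Proof. by apply: sumr_ge0 => m _; rewrite (le_trans _ (s1 m)). Qed.

Lemma nrm_XX_F k : nrm (XX * F ^+ k) <= 60 * S / (t ^+ 3 * k.+1%:R).
Proof.
rewrite mulr_suml mulr_sumr mulr_suml.
apply: nrm_sum_le => m _; apply: le_trans (mixture_smooth3 m k).
by rewrite -mulrA; apply: le_trans (nrmZ_le _ (lexx _)) _; rewrite gtr0_norm.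
Qed.

Lemma nrm_XX : nrm XX <= 2.
Proof.
have -> : XX = 1 - F by ring.
have -> : 2 = 1 + 1 :> R by ring.
by apply: nrmB_le; [exact: nrm1|exact: mixture_contraction].
Qed.

Section exponential.
(* [P ^+ M] plays the role of [exp(-XX)]; as 12 divides [M], it splits into
   2, 3 or 4 equal powers, one for each factor [XX]. *)
Variable (M' : nat).
Hypothesis (M7 : (7 <= M')%N).
Let M := (12 * M')%N.

Let M0 : 0 < M%:R :> R. Proof. by rewrite ltr0n muln_gt0 (leq_trans _ M7). Qed.

Let p_le1 m : p m <= 1.
Proof.
apply: le_trans (_ : _ <= \sum_m p m) _.
  by rewrite (bigD1 m)//= lerDl; apply: sumr_ge0 => i _; exact: ltW.
by rewrite pq; case/andP: q01 => *; lra.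
Qed.

Let r_bnd m : 0 < p m / M%:R <= 1 / 2.
Proof.
rewrite divr_gt0//= ler_pdivrMr// (le_trans (p_le1 m))//.
have : 2 <= M%:R :> R by rewrite ler_nat /M; lia.
lra.
Qed.

Local Notation L m := (1 - gcst V (p m / M%:R) * X m).
Local Notation PP := (\prod_(m <- index_enum 'I_K) L m).
Local Notation P := (1 - gcst V M%:R^-1 * XX).

Lemma exp_step_contraction : nrm P <= 1.
Proof.
have -> : P = gcst V (1 - M%:R^-1) + gcst V M%:R^-1 * F.
  by rewrite rmorphB rmorph1; ring.
apply: le_trans (nrmD_le (nrm_cst_le V _) (nrmZ_le _ mixture_contraction)) _.
have M1 : M%:R^-1 <= 1 :> R by rewrite invf_le1// ler1n -(ltr0n R).
rewrite !ger0_norm ?invr_ge0 ?subr_ge0 ?(ltW M0)//; lra.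
Qed.

Let U m := gcst V (p m / M%:R) * X m.

(** [U m] has norm at most [2 * p m / M], so one step has an error of at most [(2 / M) ^ 2]. Over
    [k * M] steps this adds up to [4 * k / M], which vanishes as [M] grows. *)
Let prodP : nrm PP <= 1 /\ nrm (PP - P) <= 4 / M%:R ^+ 2.
Proof.
have [|i|h1 _] := @prod_approx R V 'I_K (index_enum 'I_K) U (fun m => p m / M%:R * 2).
- move=> i; apply: lazy_contraction; have /andP[h1 h2] := r_bnd i.
  by apply/andP; split; lra.
- apply: le_trans (nrmZ_le _ (nrm_gen i)) _.
  by rewrite gtr0_norm//; case/andP: (r_bnd i).
rewrite -mulr_suml -mulr_suml pq => h; split => //; move: h.
have -> : \sum_(i <- index_enum 'I_K) U i = gcst V M%:R^-1 * XX.
  by rewrite mulr_sumr; apply: eq_bigr => i _; rewrite /U rmorphM /=; ring.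
move=> /le_trans; apply.
rewrite -mulrA exprMn mulrC [leRHS]mulrC.
have -> : (M%:R^-1 * 2) ^+ 2 = (M%:R ^+ 2)^-1 * 4 :> R by field; rewrite gt_eqF.
rewrite ler_piMr ?mulr_ge0 ?invr_ge0 ?sqr_ge0//.
by rewrite exprn_ile1 ?(ltW p1)//; case/andP: q01 => *; lra.
Qed.

Lemma exp_approx k : nrm (P ^+ M ^+ k - PP ^+ (k * M)) <= 4 * k%:R / M%:R.
Proof.
have [PP1 PPP] := prodP; rewrite -exprM mulnC.
apply: le_trans (nrm_sub_X _ exp_step_contraction PP1) _.
rewrite -nrmN opprB.
apply: le_trans (ler_wpM2l _ PPP) _ => //.
by rewrite natrM le_eqVlt; apply/orP; left; apply/eqP; field; rewrite gt_eqF.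
Qed.

Let prod_split m k : exists2 f, nrm f <= 1 & PP ^+ k = L m ^+ k * f.
Proof.
exists ((\prod_(i | i != m) L i) ^+ k); last by rewrite (bigD1 m)//= exprMn.
apply: nrmX1; rewrite -big_filter.
have [] // := @prod_approx R V 'I_K [seq i <- index_enum 'I_K | i != m] U (fun m => nrm (U m)).
move=> i; apply: lazy_contraction; have /andP[h1 h2] := r_bnd i.
by apply/andP; split; lra.
Qed.

Let prod_split2 m m' k : m != m' ->
  exists2 f, nrm f <= 1 & PP ^+ k = L m ^+ k * L m' ^+ k * f.
Proof.
move=> mm'; exists ((\prod_(i | (i != m) && (i != m')) L i) ^+ k); last first.
  by rewrite (bigD1 m)//= (bigD1 m')//= 1?eq_sym// !exprMn mulrA.
apply: nrmX1; rewrite -big_filter.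
pose r := [seq i <- index_enum 'I_K | (i != m) && (i != m')].
have [] // := @prod_approx R V 'I_K r U (fun m => nrm (U m)).
move=> i; apply: lazy_contraction; have /andP[h1 h2] := r_bnd i.
by apply/andP; split; lra.
Qed.

Lemma nrm_XX_PP k : (20 <= k)%N -> nrm (XX * PP ^+ k) <= c1 * S * M%:R / k%:R.
Proof.
move=> k20; have k0 : 0 < k%:R :> R by rewrite ltr0n (leq_trans _ k20).
rewrite mulr_suml mulr_sumr !mulr_suml.
apply: nrm_sum_le => m _; have [f f1 ->] := prod_split m k.
have -> : gcst V (p m) * X m * (L m ^+ k * f) = gcst V (p m) * (X m * L m ^+ k * f) by ring.
apply: le_trans (nrmZ_le _ (nrmM1 (smooth1 m (r_bnd m) k20) f1)) _.
rewrite gtr0_norm// le_eqVlt; apply/orP; left; apply/eqP.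
by field; rewrite !gt_eqF.
Qed.

(** This bound carries the leading constant, so the exponent is not divided: an off-diagonal pair
    uses two different factors of the product, each with its full power, and the diagonal uses
    [smooth2]. *)
Lemma nrm_XX2_PP k : (20 <= k)%N ->
  nrm (XX ^+ 2 * PP ^+ k) <= 704 / 100 * (S * M%:R / k%:R) ^+ 2.
Proof.
move=> k20; have k0 : 0 < k%:R :> R by rewrite ltr0n (leq_trans _ k20).
have -> : 704 / 100 * (S * M%:R / k%:R) ^+ 2 =
   \sum_m \sum_m' c1 ^+ 2 * s m * s m' * (M%:R / k%:R) ^+ 2.
  transitivity (c1 ^+ 2 * (M%:R / k%:R) ^+ 2 * (S * S)).
    by rewrite c1E; field; rewrite gt_eqF.
  rewrite big_distrlr /= mulr_sumr; apply: eq_bigr => m _.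
  by rewrite mulr_sumr; apply: eq_bigr => m' _; ring.
rewrite expr2 big_distrlr /= mulr_suml; apply: nrm_sum_le => m _.
rewrite mulr_suml; apply: nrm_sum_le => m' _.
have pm := p0 m; have pm' := p0 m'.
have -> : gcst V (p m) * X m * (gcst V (p m') * X m') * PP ^+ k =
  gcst V (p m * p m') * (X m * X m' * PP ^+ k) by rewrite rmorphM; ring.
have [<-|mm'] := eqVneq m m'.
  have [f f1 ->] := prod_split m k.
  have -> : X m * X m * (L m ^+ k * f) = X m ^+ 2 * L m ^+ k * f by ring.
  apply: le_trans (nrmZ_le _ (nrmM1 (smooth2 m (r_bnd m) k20) f1)) _.
  rewrite gtr0_norm ?mulr_gt0// le_eqVlt; apply/orP; left; apply/eqP.
  by field; rewrite !gt_eqF.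
have [f f1 ->] := prod_split2 k mm'.
have -> : X m * X m' * (L m ^+ k * L m' ^+ k * f) =
  (X m * L m ^+ k) * (X m' * L m' ^+ k) * f by ring.
apply: le_trans (nrmZ_le _ (nrmM1 (nrmM_le (smooth1 m (r_bnd m) k20)
  (smooth1 m' (r_bnd m') k20)) f1)) _.
rewrite gtr0_norm ?mulr_gt0// le_eqVlt; apply/orP; left; apply/eqP.
by field; rewrite !gt_eqF.
Qed.

Let t1 : t < 1.
Proof. by move: q01 => /andP[_]; rewrite -tq; have := t0; nra. Qed.

Let c13 : c1 <= 3.
Proof. by have := c1E; have := c10; rewrite expr2; nra. Qed.

(** For the remainders only: each factor [XX] gets one of [d] equal parts of the power, which loses
    a factor [d] in each but handles all directions at once. *)
Lemma nrm_XX_exp d j : (0 < d)%N -> (d %| 12)%N -> (d <= 4)%N -> (0 < j)%N ->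
  nrm (XX ^+ d * P ^+ M ^+ j) <=
  (3 * d%:R * S / j%:R) ^+ d + 2 ^+ d * (4 * j%:R / M%:R).
Proof.
move=> d0 /dvdnP[e e12] d4 j0.
have -> : XX ^+ d * P ^+ M ^+ j = XX ^+ d * PP ^+ (j * M) +
  XX ^+ d * (P ^+ M ^+ j - PP ^+ (j * M)) by ring.
apply: nrmD_le; last first.
  by apply: nrmM_le (exp_approx j); apply: nrmX_le; exact: nrm_XX.
have ME : M = (e * M' * d)%N by rewrite /M e12 mulnAC.
have -> : (j * M = j * (e * M') * d)%N by rewrite ME mulnA.
rewrite exprM -exprMn; apply: nrmX_le.
have e3 : (3 <= e)%N.
  rewrite leqNgt; apply/negP => e2.
  by have : (e * d <= 2 * 4)%N; [rewrite leq_mul|rewrite -e12].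
(* [e = 12 / d >= 3] and [M' >= 7] give at least 21 steps, just above the 20 that smoothing asks
   for. *)
have k20 : (20 <= j * (e * M'))%N.
  apply: (@leq_trans (1 * (3 * 7))%N) => //.
  by rewrite !leq_mul.
apply: le_trans (nrm_XX_PP k20) _.
have j0' : 0 < j%:R :> R by rewrite ltr0n.
have e0' : 0 < (e * M')%N%:R :> R.
  by rewrite ltr0n muln_gt0 (leq_trans _ e3)// (leq_trans _ M7).
rewrite ME !natrM; move: e0'; rewrite natrM; set u := e%:R * _ => u0.
have -> : c1 * S * (u * d%:R) / (j%:R * u) = c1 * (d%:R * S / j%:R).
  by field; rewrite !gt_eqF.
rewrite -!mulrA ler_wpM2r// mulrA divr_ge0 ?mulr_ge0//.
Qed.

Lemma nrm_XX_pow d i : (0 < d)%N ->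
  nrm (XX ^+ d * F ^+ i) <= (60 * S / (t ^+ 3 * (i %/ d).+1%:R)) ^+ d.
Proof.
move=> d0; rewrite {1}(divn_eq i d) exprD mulrA exprM -exprMn.
apply: nrmM1; last by apply: nrmX1; exact: mixture_contraction.
by apply: nrmX_le; exact: nrm_XX_F.
Qed.

(** The power with the larger exponent does all the smoothing, the other being a contraction. If it
    is [F], then [n <= 8 * (i %/ d).+1], whence 480 = 8 * 60; if it is [P ^+ M], then [n <= 4 * j]
    is more than enough. *)
Lemma nrm_mixed n d i j : (4 <= n)%N -> (0 < d)%N -> (d %| 12)%N -> (d <= 4)%N ->
  (n <= i + j + 2)%N -> (j <= n)%N ->
  nrm (XX ^+ d * (F ^+ i * P ^+ M ^+ j)) <=
  (480 * S / (t ^+ 3 * n%:R)) ^+ d + 2 ^+ d * (4 * n%:R / M%:R).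
Proof.
move=> n4 d0 d12 d4 nij jn.
have n0 : 0 < n%:R :> R by rewrite ltr0n (leq_trans _ n4).
have t3 : 0 < t ^+ 3 by rewrite exprn_gt0.
have E1 : nrm (P ^+ M) <= 1 by apply: nrmX1; exact: exp_step_contraction.
have S480 : 0 <= 480 * S := mulr_ge0 (ler0n _ _) S0.
have S60 : 0 <= 60 * S := mulr_ge0 (ler0n _ _) S0.
have b0 : 0 <= 480 * S / (t ^+ 3 * n%:R) := divr_ge0 S480 (mulr_ge0 (ltW t3) (ltW n0)).
have [ij|ij] := leqP (i + j) (2 * i).
  rewrite mulrA; apply: le_trans (nrmM1 (nrm_XX_pow i d0) (nrmX1 j E1)) _.
  apply: le_trans (_ : _ <= (480 * S / (t ^+ 3 * n%:R)) ^+ d) _; last first.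
    have e0 : 0 <= 2 ^+ d * (4 * n%:R / M%:R) :> R.
      apply: (mulr_ge0 (exprn_ge0 _ (ler0n _ 2))).
      exact: (divr_ge0 (mulr_ge0 (ler0n _ 4) (ltW n0)) (ltW M0)).
    by rewrite lerDl.
  have k0 : 0 < (i %/ d).+1%:R :> R by rewrite ltr0n.
  apply: lerXn2r; [|exact: b0|].
    exact: (divr_ge0 S60 (mulr_ge0 (ltW t3) (ltW k0))).
  rewrite ler_pdivrMr ?(mulr_gt0 t3)// mulrAC ler_pdivlMr ?(mulr_gt0 t3)//.
  have nk : n%:R <= 8 * (i %/ d).+1%:R :> R.
    rewrite -natrM ler_nat.
    have ik := leq_trans (ltn_ceil i d0) (leq_mul (leqnn (i %/ d).+1) d4).
    by move: ik nij ij; move: (i %/ d).+1 => k; clear; lia.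
  have -> : 480 * S * (t ^+ 3 * (i %/ d).+1%:R) =
    60 * S * (t ^+ 3 * (8 * (i %/ d).+1%:R)) by ring.
  by rewrite (ler_wpM2l S60)// ler_wpM2l// ltW.
have j4 : (n <= 4 * j)%N by move: n4 nij ij; clear; lia.
have j0 : (0 < j)%N by move: n4 j4; clear; lia.
have j0' : 0 < j%:R :> R by rewrite ltr0n.
rewrite mulrCA mulrC; apply: le_trans (nrmM1 (nrm_XX_exp d0 d12 d4 j0)
  (nrmX1 i mixture_contraction)) _.
apply: lerD; last first.
  rewrite ler_wpM2l ?exprn_ge0// ler_wpM2r ?invr_ge0// ?(ltW M0)//.
  by rewrite ler_wpM2l// ler_nat.
have d3 : 0 <= 3 * d%:R * S := mulr_ge0 (mulr_ge0 (ler0n _ _) (ler0n _ _)) S0.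
apply: lerXn2r; [exact: (divr_ge0 d3 (ltW j0'))|exact: b0|].
rewrite ler_pdivrMr// [leRHS]mulrAC ler_pdivlMr ?(mulr_gt0 t3)//.
have dS : 3 * d%:R * S <= 12 * S.
  by rewrite (ler_wpM2r S0)// -natrM ler_nat (leq_mul2l 3 _ 4).
have tn : t ^+ 3 * n%:R <= 4 * j%:R.
  apply: le_trans (_ : _ <= n%:R) _; last by rewrite -natrM ler_nat.
  by rewrite ler_piMl ?(ltW n0)// exprn_ile1// ltW.
apply: le_trans (ler_pM d3 (mulr_ge0 (ltW t3) (ltW n0)) dS tn) _.
have := mulr_ge0 S0 (ltW j0'); lra.
Qed.

(** 352 is half of 704, by the factor [n / 2] of the quadratic term. The last term collects the
    errors due to finite [M], which are [56 n^2 + 80 n^3] over [M]. *)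
Lemma mixture_estimate n : (4 <= n)%N ->
  nrm (F ^+ n - P ^+ M ^+ n) <= 352 / 100 * S ^+ 2 / n%:R +
    3 / 2 * n%:R * (480 * S / (t ^+ 3 * n%:R)) ^+ 3 +
    5 / 4 * n%:R ^+ 2 * (480 * S / (t ^+ 3 * n%:R)) ^+ 4 + 136 * n%:R ^+ 3 / M%:R.
Proof.
move=> n4; have n0 : 0 < n%:R :> R by rewrite ltr0n (leq_trans _ n4).
have n1 : 1 <= n%:R :> R by rewrite ler1n (leq_trans _ n4).
have t3 : 0 < t ^+ 3 by rewrite exprn_gt0.
have Mn0 : (0 < M)%N by rewrite -(ltr0n R).
set Q := 480 * S / (t ^+ 3 * n%:R).
have Q0 : 0 <= Q := divr_ge0 (mulr_ge0 (ler0n _ 480) S0) (mulr_ge0 (ltW t3) (ltW n0)).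
have e0 k : 0 <= Q ^+ k + 2 ^+ k * (4 * n%:R / M%:R).
  by rewrite addr_ge0 ?exprn_ge0// mulr_ge0 ?exprn_ge0// divr_ge0// mulr_ge0.
apply: le_trans (nrm_pow_sub_exp Mn0 exp_step_contraction nrm_XX
  (e0 3) (e0 4) _ _) _.
- by move=> i j ij; apply: nrm_mixed => //; move: n4 ij; clear; lia.
- by move=> i j ij; apply: nrm_mixed => //; move: n4 ij; clear; lia.
have h2 : nrm (XX ^+ 2 * P ^+ M ^+ n) <=
    704 / 100 * (S / n%:R) ^+ 2 + 2 ^+ 2 * (4 * n%:R / M%:R).
  have -> : XX ^+ 2 * P ^+ M ^+ n = XX ^+ 2 * PP ^+ (n * M) +
    XX ^+ 2 * (P ^+ M ^+ n - PP ^+ (n * M)) by ring.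
  apply: nrmD_le; last first.
    by apply: nrmM_le (exp_approx n); apply: nrmX_le; exact: nrm_XX.
  have k20 : (20 <= n * M)%N.
    by rewrite (@leq_trans (4 * (12 * 7))%N)// leq_mul// leq_mul2l.
  apply: le_trans (nrm_XX2_PP k20) _.
  have -> : S * M%:R / (n * M)%:R = S / n%:R.
    by rewrite natrM; field; rewrite !gt_eqF.
  by [].
have M0' := ltW M0.
apply: le_trans (lerD (lerD (ler_wpM2l _ h2) (lexx _)) (lexx _)) _.
  by rewrite divr_ge0.
set A := Q ^+ 3; set B := Q ^+ 4.
have -> : n%:R / 2 * (704 / 100 * (S / n%:R) ^+ 2 + 2 ^+ 2 * (4 * n%:R / M%:R)) +
   3 / 2 * n%:R * (A + 2 ^+ 3 * (4 * n%:R / M%:R)) +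
   5 / 4 * n%:R ^+ 2 * (B + 2 ^+ 4 * (4 * n%:R / M%:R)) =
  352 / 100 * S ^+ 2 / n%:R + 3 / 2 * n%:R * A + 5 / 4 * n%:R ^+ 2 * B +
   (56 * n%:R ^+ 2 + 80 * n%:R ^+ 3) / M%:R.
  by field; rewrite !gt_eqF.
rewrite lerD2l ler_wpM2r ?invr_ge0//.
have : n%:R ^+ 2 <= n%:R ^+ 3 :> R by rewrite ler_weXn2l.
lra.
Qed.

End exponential.

End mixture.

(** * Truncated exponential series and powers *)

Section exp_trunc.
Context (R : realType) (V : zmodType).
Implicit Types (a : galg R V).

Definition exp_trunc a J : galg R V := \sum_(j < J) gcst V (j`!%:R^-1) * a ^+ j.

Lemma ffact_ratio_ge (N j : nat) : (0 < N)%N -> (j <= N)%N ->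
  1 - j%:R ^+ 2 / N%:R <= ((N ^_ j)%:R / N%:R ^+ j : R) <= 1.
Proof.
move=> N0; have N0' : 0 < N%:R :> R by rewrite ltr0n.
elim: j => [|j IH] jN; first by rewrite ffactn0 expr0n mul0r subr0 expr0 divr1 lexx.
have /andP[h1 h2] := IH (ltnW jN).
rewrite ffactnSr natrM (exprSr N%:R j) -mulf_div natrB ?(ltnW jN)//.
rewrite [(N%:R - _) / _]mulrBl divff ?gt_eqF//.
set b := _ / N%:R ^+ j in h1 h2 *.
have b0 : 0 <= b by rewrite divr_ge0 ?exprn_ge0// ltW.
have j0 : 0 <= j%:R / N%:R :> R by rewrite divr_ge0// ltW.
have j1 : j%:R / N%:R <= 1 :> R by rewrite ler_pdivrMr// mul1r ler_nat ltnW.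
have -> : j.+1%:R ^+ 2 / N%:R = j%:R ^+ 2 / N%:R + 2 * (j%:R / N%:R) + N%:R^-1 :> R.
  by rewrite -natr1; field; rewrite gt_eqF.
have i0 : 0 <= N%:R^-1 :> R by rewrite invr_ge0 ltW.
apply/andP; split; nra.
Qed.

(** The order of quantifiers matters: [J] and [N] depend on [a] only through [al], as [a] will be
    constructed after they are fixed. Coefficients below [J] have relative error at most
    [J ^ 2 / N]; the others are dominated by the tail of the series of [expR al]. *)
Lemma exp_trunc_approx (al eta : R) : 0 <= al -> 0 < eta ->
  exists J0 : nat, forall J, (J0 <= J)%N -> exists N0 : nat, forall N, (N0 <= N)%N ->
  forall a, nrm a <= al -> nrm (exp_trunc a J - (1 + gcst V N%:R^-1 * a) ^+ N) <= eta.
Proof.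
move=> al0 eta0.
pose ser J : R := \sum_(j < J) al ^+ j / j`!%:R.
have serE J : ser J = series (exp_coeff al) J.
  rewrite /series /= big_mkord; apply: eq_bigr => j _; by rewrite /exp_coeff.
have ser_le J : ser J <= expR al.
  rewrite serE; apply: nondecreasing_cvgn_le; last exact: is_cvg_series_exp_coeff.
  by apply: nondecreasing_series => n _ _; exact: exp_coeff_ge0.
have [J0 _ hJ0] : \forall J \near \oo, expR al - ser J < eta / 2.
  have cv : ser @ \oo --> expR al.
    rewrite (_ : ser = series (exp_coeff al)); last by apply/funext => J; exact: serE.
    exact: is_cvg_series_exp_coeff.
  have /cvgrPdist_lt /(_ (eta / 2)) := cv.
  move=> /(_ (divr_gt0 eta0 (ltr0Sn _ _))); apply: filterS => J.
  by rewrite ger0_norm ?subr_ge0.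
exists J0 => J J0J; have {}hJ0 := hJ0 J J0J.
pose B : R := J%:R ^+ 2 * expR al / (eta / 2).
exists (maxn J (Num.trunc B).+1) => N; rewrite geq_max => /andP[JN BN] a aal.
have N0 : (0 < N)%N by apply: leq_trans BN.
have N0' : 0 < N%:R :> R by rewrite ltr0n.
have hB : J%:R ^+ 2 * expR al / N%:R <= eta / 2.
  have : B <= N%:R.
    by apply: le_trans (ltW (truncnS_gt _)) _; rewrite ler_nat.
  rewrite /B ler_pdivrMr ?divr_gt0// => h.
  by rewrite ler_pdivrMr// [leRHS]mulrC.
pose c (j : nat) : R := 'C(N, j)%:R / N%:R ^+ j.
have cE j : c j = (N ^_ j)%:R / N%:R ^+ j / j`!%:R.
  have f0 : j`!%:R != 0 :> R by rewrite pnatr_eq0 -lt0n fact_gt0.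
  by rewrite /c -bin_ffact natrM; field; rewrite f0 expf_neq0// gt_eqF.
have f0 (j : nat) : 0 < j`!%:R :> R by rewrite ltr0n fact_gt0.
have -> : (1 + gcst V N%:R^-1 * a) ^+ N = \sum_(j < N.+1) gcst V (c j) * a ^+ j.
  rewrite exprDn; apply: eq_bigr => j _.
  rewrite expr1n mul1r exprMn -mulr_natl mulrA; congr (_ * _).
  by rewrite /c rmorphM rmorph_nat -exprVn rmorphXn.
rewrite -(subnKC (leqW JN)) big_split_ord /= /exp_trunc opprD addrA.
have -> : eta = eta / 2 + eta / 2 by field.
apply: nrmB_le.
  rewrite -sumrB.
  apply: le_trans (nrm_sum_le (a := fun j : 'I_J => J%:R ^+ 2 / N%:R * (al ^+ j / j`!%:R)) _ _) _.
    move=> j _; rewrite -mulrBl -rmorphB.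
    apply: le_trans (nrmZ_le _ (nrmX_le j aal)) _.
    rewrite [leRHS]mulrCA mulrC ler_wpM2l ?exprn_ge0//.
    have /andP[h1 h2] := ffact_ratio_ge N0 (ltnW (leq_trans (ltn_ord j) JN)).
    rewrite cE -[X in X - _]mul1r -mulrBl normrM ger0_norm ?subr_ge0//.
    rewrite ger0_norm ?invr_ge0// ler_wpM2r ?invr_ge0//.
    rewrite lerBlDr -lerBlDl; apply: le_trans h1.
    rewrite lerD2l lerN2 ler_wpM2r ?invr_ge0 ?(ltW N0')//.
    by rewrite lerXn2r ?nnegrE// ler_nat ltnW.
  rewrite -mulr_sumr -/(ser J) mulrAC; apply: le_trans hB.
  by rewrite ler_wpM2r ?invr_ge0 ?(ltW N0')// ler_wpM2l// exprn_ge0.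
apply: le_trans (nrm_sum_le (a := fun j : 'I_(N.+1 - J) => al ^+ (J + j) / (J + j)`!%:R) _ _) _.
  move=> j _; apply: le_trans (nrmZ_le _ (nrmX_le _ aal)) _.
  rewrite mulrC ler_wpM2l ?exprn_ge0//.
  have jN : (J + j <= N)%N by have := ltn_ord j; lia.
  have /andP[_ h2] := ffact_ratio_ge N0 jN.
  have c0 : 0 <= c (J + j)%N by rewrite /c divr_ge0// exprn_ge0// ltW.
  by rewrite ger0_norm// cE ler_piMl// ?invr_ge0// ltW.
apply: le_trans (ltW hJ0); rewrite lerBrDl.
by have := ser_le (J + (N.+1 - J))%N; rewrite /ser big_split_ord.
Qed.

End exp_trunc.

Section final_bound.
Context (R : realType).

(** [nu] and [t] are the square roots of [n] and [q]. If [S > nu * t ^+ 2], the right-hand side is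
    at least 1 and [N <= 2] suffices. Otherwise [S / (nu * t ^+ 2) <= 1] reduces the quartic
    remainder from [t ^ -12] to [t ^ -10], the origin of [q ^+ 5]; the cubic one has only
    [t ^ -9]. *)
Lemma final_bound (S nu t q e N : R) : 1 <= S -> 0 < nu -> 0 < t -> t < 1 -> q = t ^+ 2 ->
  N <= 2 ->
  (N <= 352 / 100 * S ^+ 2 / nu ^+ 2 +
    3 / 2 * nu ^+ 2 * (480 * S / (t ^+ 3 * nu ^+ 2)) ^+ 3 +
    5 / 4 * (nu ^+ 2) ^+ 2 * (480 * S / (t ^+ 3 * nu ^+ 2)) ^+ 4 + 2 * e) ->
  0 <= e ->
  N / 2 <= 176 / 100 / nu ^+ 2 * S ^+ 2 * (1 + 480 ^+ 4 / (nu * q ^+ 5) * S) + e.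
Proof.
move=> S1 nu0 t0 t1 qE N2 hN e0.
have S0 : 0 < S by lra.
have q5 : q ^+ 5 = t ^+ 10 by rewrite qE -exprM.
have t10 : 0 < t ^+ 10 by rewrite exprn_gt0.
have a0 : 0 < 480 :> R by rewrite ltr0n.
set a : R := 480 in a0 hN *.
have a1 : 1 <= a by rewrite ler1n.
have W0 : 0 < S ^+ 3 / (nu ^+ 3 * t ^+ 10) by rewrite divr_gt0 ?mulr_gt0 ?exprn_gt0.
have aW k : 0 <= a ^+ k * (S ^+ 3 / (nu ^+ 3 * t ^+ 10)) :=
  mulr_ge0 (exprn_ge0 k (ltW a0)) (ltW W0).
have -> : 176 / 100 / nu ^+ 2 * S ^+ 2 * (1 + a ^+ 4 / (nu * q ^+ 5) * S) =
  176 / 100 * S ^+ 2 / nu ^+ 2 + 176 / 100 * a ^+ 4 * (S ^+ 3 / (nu ^+ 3 * t ^+ 10)).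
  by rewrite q5; field; rewrite !gt_eqF.
have [Sq|Sq] := leP S (nu * t ^+ 2).
  have h3 : nu ^+ 2 * (a * S / (t ^+ 3 * nu ^+ 2)) ^+ 3 <=
      a ^+ 3 * (S ^+ 3 / (nu ^+ 3 * t ^+ 10)).
    have -> : nu ^+ 2 * (a * S / (t ^+ 3 * nu ^+ 2)) ^+ 3 =
        a ^+ 3 * (S ^+ 3 / (nu ^+ 3 * t ^+ 10)) * (t / nu).
      by field; rewrite !gt_eqF.
    have nu1 : nu * t ^+ 2 <= nu by rewrite ler_piMr ?(ltW nu0)// exprn_ile1// ltW.
    by rewrite (ler_piMr (aW 3%N))// ler_pdivrMr// mul1r; lra.
  have h4 : (nu ^+ 2) ^+ 2 * (a * S / (t ^+ 3 * nu ^+ 2)) ^+ 4 <=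
      a ^+ 4 * (S ^+ 3 / (nu ^+ 3 * t ^+ 10)).
    have -> : (nu ^+ 2) ^+ 2 * (a * S / (t ^+ 3 * nu ^+ 2)) ^+ 4 =
        a ^+ 4 * (S ^+ 3 / (nu ^+ 3 * t ^+ 10)) * (S / (nu * t ^+ 2)).
      by field; rewrite !gt_eqF.
    by rewrite (ler_piMr (aW 4%N))// ler_pdivrMr ?mulr_gt0 ?exprn_gt0// mul1r.
  have h34 : a ^+ 3 * (S ^+ 3 / (nu ^+ 3 * t ^+ 10)) <=
      a ^+ 4 * (S ^+ 3 / (nu ^+ 3 * t ^+ 10)).
    by rewrite ler_wpM2r ?(ltW W0)// ler_weXn2l.
  have W4 := aW 4%N.
  move: hN h3 h4 h34 W4; set Y3 := (a * S / _) ^+ 3; set Y4 := (a * S / _) ^+ 4.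
  set W := S ^+ 3 / _; clear; lra.
have : 1 <= 176 / 100 * a ^+ 4 * (S ^+ 3 / (nu ^+ 3 * t ^+ 10)).
  rewrite mulrA ler_pdivlMr ?mulr_gt0 ?exprn_gt0// mul1r.
  apply: le_trans (_ : _ <= 1 * S ^+ 3) _; last first.
    rewrite ler_wpM2r ?exprn_ge0 ?(ltW S0)//.
    by have := exprn_ege1 4 a1; lra.
  rewrite mul1r; apply: le_trans (_ : _ <= (nu * t ^+ 2) ^+ 3) _; last first.
    by rewrite lerXn2r ?nnegrE ?mulr_ge0 ?exprn_ge0 ?(ltW S0) ?(ltW nu0) ?(ltW t0)// ltW.
  rewrite exprMn -exprM ler_wpM2l ?exprn_ge0 ?(ltW nu0)//.
  by rewrite ler_wiXn2l// ltW.
have : 0 <= 176 / 100 * S ^+ 2 / nu ^+ 2.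
  apply: divr_ge0 (sqr_ge0 _); apply: mulr_ge0 (sqr_ge0 _); lra.
lra.
Qed.

End final_bound.

(** * Mixtures of finitely supported lattice walks *)

Section lattice_model.
Context (R : realType) (V : zmodType) (K L : nat).
Context (w : 'I_K -> 'I_L -> R) (y : 'I_K -> V) (p : 'I_K -> R) (q : R).
Hypotheses (w0 : forall m k, 0 <= w m k) (w1 : forall m, \sum_k w m k = 1).
Hypotheses (q01 : 0 < q < 1) (p0 : forall m, 0 < p m) (pq : \sum_m p m = 1 - q).

Definition model_gen m : galg R V :=
  \sum_k gcst V (w m k) * (1 - avg2 R (y m *~ k.+1%:Z)).
Definition model_weight m : R := Num.sqrt (1 + Num.sqrt (walk_var (w m))).

Local Notation X := model_gen.
Local Notation s := model_weight.
Local Notation XX := (\sum_m gcst V (p m) * X m).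
Local Notation F := (1 - XX).
Local Notation S := (\sum_m s m).

Lemma spread_model m : spread (y m) (walk_gen (w m)) (X m).
Proof.
apply: spread_sum => k; apply: spreadM; first exact: spread_cst.
by apply: spreadD; [exact: spread1|apply/spreadN/spread_avg2].
Qed.

Lemma nrm_model m j r N :
  nrm (X m ^+ j * (1 - gcst V r * X m) ^+ N) <=
  nrm (walk_gen (w m) ^+ j * lazy_step (w m) r ^+ N).
Proof.
have Xm := spread_model m.
apply: nrm_spread; apply: spreadM; apply: spreadX => //.
apply: spreadD; first exact: spread1.
by apply/spreadN/spreadM => //; exact: spread_cst.
Qed.

Lemma model_law m : 1 - X m = \sum_k gcst V (w m k) * avg2 R (y m *~ k.+1%:Z).
Proof.
rewrite -[1](rmorph1 (gcst V)) -(w1 m) rmorph_sum -sumrB.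
by apply: eq_bigr => k _; rewrite /=; ring.
Qed.

Lemma model_contraction m : nrm (1 - X m) <= 1.
Proof.
rewrite model_law.
rewrite -[leRHS](w1 m); apply: nrm_sum_le => k _; rewrite -[leRHS]mulr1.
rewrite -[X in _ <= X * _]ger0_norm//; apply: nrmZ_le.
by apply: nrm_lbnd; exact: lbnd_avg2.
Qed.

Let sE m : s m ^+ 2 = 1 + Num.sqrt (walk_var (w m)).
Proof. by rewrite sqr_sqrtr// addr_ge0. Qed.

Let s1 m : 1 <= s m.
Proof. by rewrite /model_weight -[leLHS]sqrtr1 ler_wsqrtr// lerDl. Qed.

Let s2 m : 2 <= s m ^+ 2.
Proof.
rewrite sE; have -> : 2 = 1 + 1 :> R by ring.
by rewrite lerD2l -[leLHS]sqrtr1 ler_wsqrtr// walk_var_ge1.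
Qed.

Let c1 : R := Num.sqrt (704 / 100).
Let c10 : 0 <= c1. Proof. exact: sqrtr_ge0. Qed.
Let c1E : c1 ^+ 2 = 704 / 100. Proof. have h : 0 <= 704 / 100 :> R by lra. exact: sqr_sqrtr. Qed.
Let t : R := Num.sqrt q.
Let t0 : 0 < t. Proof. by rewrite sqrtr_gt0; case/andP: q01. Qed.
Let tq : t ^+ 2 = q. Proof. by rewrite sqr_sqrtr//; case/andP: q01 => /ltW. Qed.

Let model_smooth1 m r N : 0 < r <= 1 / 2 -> (20 <= N)%N ->
  nrm (X m * (1 - gcst V r * X m) ^+ N) <= c1 * s m / (r * N%:R).
Proof.
move=> /andP[r0 r2] N20.
have N0 : 0 < N%:R :> R by rewrite ltr0n (leq_trans _ N20).
have rN : 0 < r * N%:R by rewrite mulr_gt0.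
have := nrm_model m 1 r N; rewrite !expr1 => /le_trans; apply.
apply: le_of_sqr; first by rewrite divr_ge0 ?(ltW rN)// mulr_ge0// (le_trans _ (s1 m)).
apply: le_trans (walk_smoothing1 (w0 m) (w1 m) r0 (lexx r) _ N20) _.
  move=> x; have := walk_symbol_le2 (w0 m) (w1 m) x.
  have := walk_symbol_ge0 (w0 m) x => x0 x2.
  rewrite ger0_norm; last by nra.
  by apply: le_trans (expR_ge1Dx _); lra.
rewrite divff ?gt_eqF// mulr1 -sE -c1E.
by rewrite [leRHS]exprMn exprVn (exprMn 2 c1).
Qed.

Let model_smooth2 m r N : 0 < r <= 1 / 2 -> (20 <= N)%N ->
  nrm (X m ^+ 2 * (1 - gcst V r * X m) ^+ N) <= c1 ^+ 2 * s m ^+ 2 / (r * N%:R) ^+ 2.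
Proof.
move=> r0 N20; apply: le_trans (nrm_model m 2 r N) _.
by rewrite sE c1E; exact: walk_smoothing2.
Qed.

Let t1 : t < 1.
Proof. by move: q01 => /andP[_]; rewrite -tq; have := t0; nra. Qed.

(** [1 - (1 - q) * x] may be negative, but as [x <= 2] its modulus is still at most
    [expR (- ((1 - q) * q * x))]. So [r / lam = 1 / q], and the square root of the bound carries [q]
    to the power -3/2, that is [t ^ -3]. Below 20 steps the trivial bound 2 is enough, since
    [2 * N.+1 <= 60]. *)
Let model_smooth3 m N :
  nrm (X m * (1 - gcst V (1 - q) * X m) ^+ N) <=
  60 * s m / ((1 - q) * t ^+ 3 * N.+1%:R).
Proof.
have /andP[q0 q1] := q01.
have r0 : 0 < 1 - q by lra.
have t3 : 0 < t ^+ 3 by rewrite exprn_gt0.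
have sm0 : 0 <= s m by rewrite (le_trans _ (s1 m)).
have Nn : 0 < N.+1%:R :> R by rewrite ltr0n.
have [N20|N20] := leqP 20 N; last first.
  apply: le_trans (_ : _ <= 2) _.
    have -> : X m = 1 - (1 - X m) by ring.
    have -> : 2 = 1 + 1 :> R by ring.
    apply: nrmM1; first by apply: nrmB_le; [exact: nrm1|exact: model_contraction].
    apply: nrmX1.
    have -> : 1 - gcst V (1 - q) * (1 - (1 - X m)) = gcst V q + gcst V (1 - q) * (1 - X m).
      by rewrite rmorphB rmorph1; ring.
    apply: le_trans (nrmD_le (nrm_cst_le V q) (nrmZ_le _ (model_contraction m))) _.
    by rewrite !gtr0_norm//; lra.
  rewrite ler_pdivlMr ?mulr_gt0//.
  have t31 : t ^+ 3 <= 1 by rewrite exprn_ile1// ltW.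
  have r1 : 1 - q <= 1 by lra.
  have h : (1 - q) * t ^+ 3 <= 1 := mulr_ile1 (ltW r0) (ltW t3) r1 t31.
  have {}h : (1 - q) * t ^+ 3 * N.+1%:R <= N.+1%:R by rewrite ler_piMl.
  have : N.+1%:R <= 30 :> R by rewrite ler_nat (leq_trans N20).
  by have := s1 m; lra.
have N0 : 0 < N%:R :> R by rewrite ltr0n (leq_trans _ N20).
pose lam := (1 - q) * q.
have l0 : 0 < lam by rewrite mulr_gt0.
have lr : lam <= 1 - q by rewrite ler_piMr// ltW.
have := nrm_model m 1 (1 - q) N; rewrite !expr1 => /le_trans; apply.
have D0 : 0 < (1 - q) * t ^+ 3 * N%:R by rewrite !mulr_gt0.
apply: le_trans (_ : _ <= c1 * s m / ((1 - q) * t ^+ 3 * N%:R)) _.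
  apply: le_of_sqr; first by rewrite divr_ge0 ?(ltW D0)// mulr_ge0.
  apply: le_trans (walk_smoothing1 (w0 m) (w1 m) l0 lr _ N20) _.
    move=> u; have x2 := walk_symbol_le2 (w0 m) (w1 m) u.
    have x0 := walk_symbol_ge0 (w0 m) u; move: (walk_symbol _ _) x0 x2 => x x0 x2.
    have [h|h] := leP ((1 - q) * x) 1.
      rewrite ger0_norm ?subr_ge0//; apply: le_trans (expR_ge1Dx _) _.
      by rewrite ler_expR lerN2 /lam ler_wpM2r.
    rewrite ltr0_norm ?subr_lt0// opprB.
    apply: le_trans (_ : 1 - 2 * q <= _); first by nra.
    apply: le_trans (expR_ge1Dx (- (2 * q))) _.
    by rewrite ler_expR lerN2 /lam; nra.
  rewrite -sE -c1E le_eqVlt; apply/orP; left; apply/eqP.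
  by rewrite /lam -tq; field; rewrite tq !gt_eqF.
have c13 : c1 <= 3 by have := c1E; have := c10; rewrite expr2; nra.
rewrite ler_pdivrMr// mulrAC ler_pdivlMr ?(mulr_gt0 (mulr_gt0 r0 t3))//.
have -> : c1 * s m * ((1 - q) * t ^+ 3 * N.+1%:R) =
  s m * ((1 - q) * t ^+ 3) * (c1 * N.+1%:R) by ring.
have -> : 60 * s m * ((1 - q) * t ^+ 3 * N%:R) =
  s m * ((1 - q) * t ^+ 3) * (60 * N%:R) by ring.
rewrite ler_wpM2l//; first exact: (mulr_ge0 sm0 (mulr_ge0 (ltW r0) (ltW t3))).
apply: le_trans (_ : _ <= 3 * N.+1%:R) _; first by rewrite ler_wpM2r.
have : 20 <= N%:R :> R by rewrite ler_nat.
rewrite -natr1; lra.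
Qed.

Let K_inhab : exists m : 'I_K, True.
Proof.
apply: contrapT => h; move: pq; rewrite big1; first by move: q01; lra.
by move=> m _; case: h; exists m.
Qed.

Lemma model_estimate n M' : (0 < n)%N -> (7 <= M')%N ->
  nrm (F ^+ n - (1 - gcst V (12 * M')%N%:R^-1 * XX) ^+ (12 * M') ^+ n) / 2 <=
  176 / 100 / n%:R * S ^+ 2 * (1 + 480 ^+ 4 / (Num.sqrt n%:R * q ^+ 5) * S) +
  68 * n%:R ^+ 3 / (12 * M')%N%:R.
Proof.
move=> n0 M7; have n0' : 0 < n%:R :> R by rewrite ltr0n.
have M0 : 0 < (12 * M')%N%:R :> R by rewrite ltr0n muln_gt0 (leq_trans _ M7).
set E := _ ^+ (12 * M').
have E1 : nrm E <= 1.
  exact: nrmX1 (exp_step_contraction model_contraction q01 p0 pq M7).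
have F1 : nrm F <= 1 by exact: (mixture_contraction model_contraction q01 p0 pq).
have N2 : nrm (F ^+ n - E ^+ n) <= 2.
  have -> : 2 = 1 + 1 :> R by ring.
  by apply: nrmB_le; exact: nrmX1.
have [m _] := K_inhab.
have s0 i : 0 <= s i by rewrite (le_trans _ (s1 i)).
have sS : s m <= S by rewrite (bigD1 m)//= lerDl; apply: sumr_ge0.
have S1 : 1 <= S by apply: le_trans sS.
have nu0 : 0 < Num.sqrt n%:R :> R by rewrite sqrtr_gt0.
have nuE : Num.sqrt n%:R ^+ 2 = n%:R :> R by rewrite sqr_sqrtr// ltW.
have e0 : 0 <= 68 * n%:R ^+ 3 / (12 * M')%N%:R :> R.
  by rewrite divr_ge0 ?mulr_ge0 ?exprn_ge0// ltW.
have [n4|n4] := leqP 4 n.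
  have est := mixture_estimate model_contraction q01 p0 pq s1 t0 tq c10 c1E
    model_smooth1 model_smooth2 model_smooth3 M7 n4.
  have h := @final_bound R S _ t q (68 * n%:R ^+ 3 / (12 * M')%N%:R) _
    S1 nu0 t0 t1 (esym tq) N2.
  rewrite nuE in h; apply: h => //; apply: le_trans est _.
  by rewrite lerD2l; lra.
(* For [n <= 3] the leading term alone exceeds 1, because [S ^+ 2 >= 2] and [1.76 * 2 / 3 > 1]. *)
apply: le_trans (_ : 1 <= _); first by lra.
have S2 : 2 <= S ^+ 2.
  by apply: le_trans (s2 m) _; rewrite lerXn2r ?nnegrE// (le_trans (s0 m)).
rewrite -[leLHS]addr0; apply: lerD => //.
apply: le_trans (_ : _ <= 176 / 100 / n%:R * S ^+ 2 * 1) _.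
  rewrite mulr1 mulrAC ler_pdivlMr// mul1r.
  have : n%:R <= 3 :> R by rewrite ler_nat.
  lra.
have q5 : 0 < Num.sqrt n%:R * q ^+ 5.
  by rewrite mulr_gt0// exprn_gt0//; case/andP: q01.
have c0 : 0 <= 176 / 100 :> R by lra.
apply: (ler_wpM2l (mulr_ge0 (divr_ge0 c0 (ltW n0')) (sqr_ge0 _))).
have := mulr_ge0 (divr_ge0 (exprn_ge0 4 (ler0n R 480)) (ltW q5)) (le_trans ler01 S1).
by rewrite lerDl.
Qed.

End lattice_model.

(** * Convolution of signed measures *)

Section charge_integral.
Context (R : realType) (d : nat).
Local Notation E := 'rV[R]_d.
Implicit Types (M N : {charge set E -> \bar R}) (mu nu : {finite_measure set E -> \bar R}).

Definition shift_set (B : set E) (x : E) : set E := [set y | B (x + y)].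

Lemma measurable_preimage_add (B : set E) : measurable B ->
  measurable (@addrV R d @^-1` B).
Proof.
move=> mB; rewrite -[X in measurable X]setTI.
exact: (@measurable_addrV R d measurableT B mB).
Qed.

Lemma shift_setE (B : set E) (x : E) :
  xsection (@addrV R d @^-1` B) x = shift_set B x.
Proof. by rewrite xsectionE. Qed.

Lemma measurable_shift (B : set E) (x : E) : measurable B -> measurable (shift_set B x).
Proof.
by move=> mB; rewrite -shift_setE; apply: measurable_xsection;
  exact: measurable_preimage_add.
Qed.

Lemma mconvE mu nu (B : set E) : mconv mu nu B = (\int[mu]_x nu (shift_set B x))%E.
Proof.
rewrite /mconv /pushforward /product_measure1.
by apply: eq_integral => x _ /=; rewrite shift_setE.
Qed.

Lemma measurable_shift_measure nu (B : set E) : measurable B ->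
  measurable_fun [set: E] (fun x : E => fine (nu (shift_set B x))).
Proof.
move=> mB; apply: (measurableT_comp (@fine_measurable R setT measurableT)).
have := measurable_fun_xsection nu (measurable_preimage_add mB).
by apply: eq_measurable_fun => x _ /=; rewrite shift_setE.
Qed.

Definition bounded_meas (c : R) (f : E -> R) :=
  measurable_fun [set: E] f /\ forall x, `|f x| <= c.

Lemma bounded_meas_integrable mu c f : bounded_meas c f ->
  mu.-integrable [set: E] (EFin \o f).
Proof.
move=> [mf fc]; apply: measurable_bounded_integrable => //.
  by rewrite ltey_eq fin_num_measure.
exists c; split; first exact: num_real.
by move=> k ck x _ /=; apply: le_trans (fc x) (ltW ck).
Qed.

Lemma le_fine_measure nu (A : set E) : measurable A ->
  0 <= fine (nu A) <= fine (nu setT).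
Proof.
move=> mA; rewrite fine_ge0//= fine_le ?fin_num_measure//.
by apply: le_measure => //; rewrite inE.
Qed.

Lemma bounded_shift_measure nu (B : set E) : measurable B ->
  bounded_meas (fine (nu setT)) (fun x : E => fine (nu (shift_set B x))).
Proof.
move=> mB; split; first exact: measurable_shift_measure.
move=> x; have /andP[h1 h2] := le_fine_measure nu (measurable_shift x mB).
by rewrite ger0_norm.
Qed.

Lemma fine_mconv mu nu (B : set E) : measurable B ->
  fine (mconv mu nu B) = \int[mu]_x fine (nu (shift_set B x)).
Proof.
move=> mB; rewrite mconvE /Rintegral; congr fine.
by apply: eq_integral => x _; rewrite fineK// fin_num_measure//; exact: measurable_shift.
Qed.

Definition cint M (f : E -> R) : R := \int[cpos M]_x f x - \int[cneg M]_x f x.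
Definition tvar M : R := fine (cpos M setT) + fine (cneg M setT).

Lemma tvar_ge0 M : 0 <= tvar M.
Proof. by rewrite addr_ge0// fine_ge0. Qed.

Lemma charge_decomp M (A : set E) : measurable A ->
  fine (M A) = fine (cpos M A) - fine (cneg M A).
Proof.
move=> mA; rewrite (jordan_decomp (projT2 (hahn_sig M)) mA) /cadd /= cscaleN1.
by rewrite fineD ?fineN ?fin_numN ?fin_num_measure.
Qed.

Lemma Rintegral_indicE mu (A : set E) : measurable A ->
  \int[mu]_x \1_A x = fine (mu A).
Proof. by move=> mA; rewrite /Rintegral integral_indic// setIT. Qed.

Lemma cint_indic M (A : set E) : measurable A -> cint M \1_A = fine (M A).
Proof. by move=> mA; rewrite /cint !Rintegral_indicE// charge_decomp. Qed.

Lemma cintB M a b f g : bounded_meas a f -> bounded_meas b g ->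
  cint M (fun x => f x - g x) = cint M f - cint M g.
Proof.
move=> fa gb; rewrite /cint !RintegralB//; try exact: bounded_meas_integrable fa.
- by ring.
- exact: bounded_meas_integrable gb.
- exact: bounded_meas_integrable gb.
Qed.

Lemma cintD M a b f g : bounded_meas a f -> bounded_meas b g ->
  cint M (fun x => f x + g x) = cint M f + cint M g.
Proof.
move=> fa gb; rewrite /cint !RintegralD//; try exact: bounded_meas_integrable fa.
- by ring.
- exact: bounded_meas_integrable gb.
- exact: bounded_meas_integrable gb.
Qed.

Lemma cintZ M a f c : bounded_meas a f -> cint M (fun x => c * f x) = c * cint M f.
Proof.
move=> fa; rewrite /cint !RintegralZl//; try exact: bounded_meas_integrable fa.
by ring.
Qed.

Lemma cint_le M c f : bounded_meas c f -> `|cint M f| <= tvar M * c.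
Proof.
move=> fc; apply: le_trans (ler_normB _ _) _; rewrite mulrDl.
have bnd mu : `|\int[mu]_x f x| <= fine (mu setT) * c.
  apply: le_trans (le_normr_Rintegral _ _) _ => //.
    exact: bounded_meas_integrable fc.
  rewrite mulrC -Rintegral_cst//; apply: le_Rintegral => //.
  - apply: (@bounded_meas_integrable mu c); split.
      by apply: measurableT_comp => //; case: fc.
    by move=> x; rewrite normr_id; case: fc.
  - exact: finite_measure_integrable_cst.
  - by move=> x _; case: fc.
by apply: lerD; exact: bnd.
Qed.

(** The four products of Jordan parts recombine into a single integral of the translates of [N]. *)
Lemma fine_cconv M N (B : set E) : measurable B ->
  fine (cconv M N B) = cint M (fun x => fine (N (shift_set B x))).
Proof.
move=> mB.
have -> : (fun x => fine (N (shift_set B x))) = (fun x =>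
    fine (cpos N (shift_set B x)) - fine (cneg N (shift_set B x))).
  by apply/funext => x; rewrite charge_decomp//; exact: measurable_shift.
rewrite /cint !RintegralB//; try exact: bounded_meas_integrable (bounded_shift_measure _ mB).
rewrite -!fine_mconv//.
have -> : cconv M N B = (mconv (cpos M) (cpos N) B + mconv (cneg M) (cneg N) B -
  (mconv (cpos M) (cneg N) B + mconv (cneg M) (cpos N) B))%E by [].
have fm mu nu : mconv mu nu B \is a fin_num by exact: fin_num_measure.
move: (fm (cpos M) (cpos N)) (fm (cneg M) (cneg N)) (fm (cpos M) (cneg N)) (fm (cneg M) (cpos N)).
move: (mconv _ _ B) (mconv _ _ B) (mconv _ _ B) (mconv _ _ B).
by move=> [a||] // [b||] // [c||] // [e||] // _ _ _ _ /=; ring.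
Qed.

End charge_integral.

Section charge_approximation.
Context (R : realType) (d : nat).
Local Notation E := 'rV[R]_d.
Implicit Types (M N : {charge set E -> \bar R}) (a b : galg R E) (del : R).

(** [a \1_B 0] is the mass that [a] gives to [B]. The error is uniform over Borel sets, so it is not
    affected by translating [B], and this makes it compatible with convolution. *)
Definition approximates M a del :=
  forall B, measurable B -> `|fine (M B) - a \1_B 0| <= del.

Lemma bounded_shift_charge N c (B : set E) : measurable B ->
  (forall A, measurable A -> `|fine (N A)| <= c) ->
  bounded_meas c (fun x : E => fine (N (shift_set B x))).
Proof.
move=> mB Nc; split; last by move=> x; apply: Nc; exact: measurable_shift.
have -> : (fun x => fine (N (shift_set B x))) = (fun x =>
    fine (cpos N (shift_set B x)) - fine (cneg N (shift_set B x))).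
  by apply/funext => x; rewrite charge_decomp//; exact: measurable_shift.
by apply: measurable_funB; exact: measurable_shift_measure.
Qed.

Lemma charge_bounded N (A : set E) : measurable A -> `|fine (N A)| <= tvar N.
Proof.
move=> mA; rewrite charge_decomp//.
have /andP[h1 h2] := le_fine_measure (cpos N) mA.
have /andP[h3 h4] := le_fine_measure (cneg N) mA.
by rewrite /tvar ler_norml; apply/andP; split; lra.
Qed.

Lemma indic_shift (B : set E) (v x : E) : \1_B (x + v) = \1_(shift_set B v) x :> R.
Proof.
rewrite !indicE (_ : (x + v \in B) = (x \in shift_set B v))//.
by apply/idP/idP; rewrite !inE /shift_set /= addrC.
Qed.

Lemma bounded_indic (B : set E) : measurable B -> bounded_meas 1 (\1_B : E -> R).
Proof.
move=> mB; split; first exact: measurable_indic.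
by move=> x; rewrite indicE; case: (_ \in _); rewrite ?normr1 ?normr0.
Qed.

Lemma cint0 M : cint M (fun=> 0) = 0.
Proof. by rewrite /cint /Rintegral !integral0 /= subrr. Qed.

Lemma fcomb_bounded (l : seq (R * E)) (B : set E) : measurable B ->
  bounded_meas (\sum_(cv <- l) `|cv.1|) (fcomb l \1_B).
Proof.
move=> mB; split; last first.
  move=> x; rewrite -[leRHS]mulr1; apply: fcomb_le.
  by case: (bounded_indic mB).
apply: measurable_sum => cv; apply: measurable_funM; first exact: measurable_cst.
rewrite (_ : (fun x => _) = \1_(shift_set B cv.2)).
  by apply: measurable_indic; exact: measurable_shift.
by apply/funext => x; rewrite indic_shift.
Qed.

Lemma cint_fcomb M (l : seq (R * E)) (B : set E) : measurable B ->
  cint M (fcomb l \1_B) = \sum_(cv <- l) cv.1 * fine (M (shift_set B cv.2)).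
Proof.
move=> mB; elim: l => [|cv l IH].
  rewrite big_nil -[RHS](cint0 M); congr cint.
  by apply/funext => x; rewrite /fcomb big_nil.
rewrite big_cons -IH.
have b1 : bounded_meas 1 (\1_(shift_set B cv.2) : E -> R).
  by apply: bounded_indic; exact: measurable_shift.
have b2 : bounded_meas `|cv.1| (fun x => cv.1 * \1_(shift_set B cv.2) x).
  split; first by apply: measurable_funM; [exact: measurable_cst|case: b1].
  by move=> x; rewrite normrM -[leRHS]mulr1 ler_wpM2l//; case: b1.
rewrite -cint_indic; last exact: measurable_shift.
rewrite -(cintZ M _ b1) -(cintD M b2 (fcomb_bounded l mB)); congr cint.
by apply/funext => x; rewrite /fcomb big_cons indic_shift.
Qed.

(** The error splits as [M * (N - b) + (M - a) * b]: the first part is integrated against the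
    variation of [M], the second is summed over a list representing [b]. *)
Lemma approximates_cconv M N a b del del' c : approximates M a del -> approximates N b del' ->
  0 <= del -> lbnd b c ->
  approximates (cconv M N) (a * b) (tvar M * del' + c * del).
Proof.
move=> Ma Nb del0 [l bl lc] B mB; rewrite fine_cconv// gmulE.
have bN := bounded_shift_charge mB (@charge_bounded N).
have bF := fcomb_bounded l mB.
have bE : b \1_B = fcomb l \1_B by rewrite bl.
have -> : cint M (fun x => fine (N (shift_set B x))) - a (b \1_B) 0 =
   cint M (fun x => fine (N (shift_set B x)) - b \1_B x) +
   (cint M (b \1_B) - a (b \1_B) 0).
  by rewrite bE (cintB M bN bF); ring.
apply: le_trans (ler_normD _ _) _; apply: lerD.
  apply: cint_le; split.
    by rewrite bE; apply: measurable_funB; [case: bN|case: bF].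
  move=> x; rewrite gop0.
  have -> : (fun y => \1_B (y + x)) = \1_(shift_set B x) :> (E -> R).
    by apply/funext => y; rewrite indic_shift.
  by apply: Nb; exact: measurable_shift.
rewrite {1}bE cint_fcomb// bl.
have -> : a (gcomb l \1_B) 0 = \sum_(cv <- l) cv.1 * a \1_(shift_set B cv.2) 0.
  have -> : gcomb l \1_B = fun x => \sum_(cv <- l) cv.1 * \1_(shift_set B cv.2) x.
    by apply/funext => x; apply: eq_bigr => cv _; rewrite indic_shift.
  by rewrite gop_sum; apply: eq_bigr => cv _; rewrite gopZ.
rewrite -sumrB; apply: le_trans (ler_norm_sum _ _ _) _.
apply: le_trans (_ : _ <= \sum_(cv <- l) `|cv.1| * del) _.
  apply: ler_sum => cv _; rewrite -mulrBr normrM ler_wpM2l//.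
  by apply: Ma; exact: measurable_shift.
by rewrite -mulr_suml ler_wpM2r.
Qed.

Lemma approximates_cunit : approximates (@cunit R d) 1 0.
Proof.
move=> B mB; rewrite goneE.
have -> : @cunit R d B = \d_(0 : E) B by [].
by rewrite diracE indicE subrr normr0.
Qed.

(** The constant depends on [M], [c] and [j] alone, so that [a] can be chosen afterwards, fine
    enough for finitely many powers at once. *)
Lemma approximates_cpow M c j : 0 <= c -> exists2 C, 0 <= C & forall a del, 0 <= del ->
  approximates M a del -> lbnd a c -> approximates (cpow M j) (a ^+ j) (C * del).
Proof.
move=> c0; elim: j => [|j [C C0 IH]].
  exists 0 => // a del _ _ _; rewrite expr0 mul0r; exact: approximates_cunit.
exists (tvar M * C + c ^+ j).
  by rewrite addr_ge0 ?mulr_ge0 ?exprn_ge0// tvar_ge0.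
move=> a del d0 Ma ac; rewrite exprS mulrDl -mulrA.
by apply: approximates_cconv => //; [exact: IH|exact: lbndX].
Qed.

Lemma cpow_bounded M j (B : set E) : measurable B ->
  `|fine (cpow M j B)| <= tvar M ^+ j.
Proof.
elim: j B => [|j IH] B mB.
  have -> : cpow M 0 B = \d_(0 : E) B by [].
  rewrite diracE /= expr0.
  by case: (_ \in _); rewrite ?normr1 ?normr0.
rewrite [cpow _ _]/(cconv M (cpow M j)) fine_cconv// exprS.
by apply: cint_le; exact: bounded_shift_charge.
Qed.

Definition exp_partial M (B : set E) (J : nat) : R :=
  \sum_(j < J) j`!%:R^-1 * fine (cpow M j B).

(** Absolute convergence, by comparison with the exponential series of [tvar M]. *)
Lemma cexp_approx M (B : set E) : measurable B ->
  exists2 l : R, cexp M B = l%:E & exp_partial M B @ \oo --> l.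
Proof.
move=> mB; pose u j : R := j`!%:R^-1 * fine (cpow M j B).
have serE : series u = exp_partial M B.
  by apply/funext => J; rewrite /series /= big_mkord.
have cu : cvgn (series u).
  apply: normed_cvg; apply: (@series_le_cvg _ _ (exp_coeff (tvar M))).
  - by move=> j /=.
  - by move=> j; apply: exp_coeff_ge0; exact: tvar_ge0.
  - move=> j /=; rewrite /u normrM ger0_norm ?invr_ge0// /exp_coeff mulrC.
    by rewrite ler_wpM2r ?invr_ge0// cpow_bounded.
  - exact: is_cvg_series_exp_coeff.
exists (lim (series u @ \oo)); last by rewrite -serE.
rewrite /cexp (_ : (fun n => _) = EFin \o series u).
  by apply/cvg_lim => //; apply: cvg_EFin; [exact: nearW|].
apply/funext => n; rewrite /= /series /= -sumEFin.
by apply: eq_bigr => j _; rewrite EFinM fineK// fin_num_measure.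
Qed.

End charge_approximation.

(** * Lattice laws and their finite approximations *)

Section support.
Context (R : realType) (d : nat).
Local Notation E := 'rV[R]_d.

Lemma measurable_singleton (x : E) : measurable [set x].
Proof.
rewrite (_ : [set x] = \bigcap_(i in [set: 'I_d])
    (fun y : E => y ord0 i) @^-1` [set x ord0 i]).
  apply: fin_bigcap_measurable => // i _; rewrite -[X in measurable X]setTI.
  by apply: measurable_coord => //; exact: measurable_set1.
apply/seteqP; split => [y /= -> //|y /= yx].
by apply/rowP => i; exact: yx.
Qed.

(** Second countability: a point outside the support lies in a null open set, hence in a null ball
    with rational centre; [D] enumerates these balls, with the empty set as filler. *)
Lemma support_null (mu : {measure set E -> \bar R}) :
  mu.-negligible (~` msupport mu).
Proof.
pose rball (k : 'rV[rat]_d * nat) : set E :=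
  ball (map_mx (@ratr R) k.1) k.2.+1%:R^-1.
pose D n : set E := if @unpickle ('rV[rat]_d * nat)%type n is Some k
  then if pselect (mu.-negligible (rball k)) then rball k else set0 else set0.
have Dn n : mu.-negligible (D n).
  rewrite /D; case: unpickle => [k|]; last exact: negligible_set0.
  by case: pselect => [//|nk]; exact: negligible_set0.
apply: negligibleS (negligible_bigcup Dn).
move=> x; rewrite /msupport /= => /existsNP[U /not_implyP[oU /not_implyP[Ux muU]]].
have mU0 : mu.-negligible U.
  exists U; split => //; first exact: open_measurable_rV.
  apply/eqP; rewrite eq_le measure_ge0 andbT leNgt; exact/negP.
have : U x by [].
rewrite {1}(open_bigcup_rball oU) => -[k /= kU kx].
exists (pickle k) => //; rewrite /D pickleK; case: pselect => // nk; exfalso.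
by apply: nk; apply: negligibleS mU0.
Qed.

End support.

Section lattice_law.
Context (R : realType) (d : nat).
Local Notation E := 'rV[R]_d.
Context (mu : probability E R) (y : E).
Hypotheses (y0 : y != 0)
  (supp : msupport mu `<=` [set (y *~ k) | k in [set k : int | k != 0]])
  (sym : forall k : nat, (0 < k)%N -> mu [set (y *+ k)] = mu [set (- (y *+ k))]).

Definition atom (k : nat) : R := fine (mu [set y *+ k.+1]).
Definition atoms (L : nat) : set E :=
  [set x | exists2 k : nat, (k < L)%N & x = y *+ k.+1 \/ x = - (y *+ k.+1)].
Definition tail_mass (L : nat) : R := 1 - 2 * \sum_(k < L) atom k.

Lemma atom_ge0 k : 0 <= atom k.
Proof. by rewrite fine_ge0. Qed.

Lemma mulrn_inj_eq (j k : nat) : y *+ j = y *+ k -> j = k.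
Proof.
move=> /rowP jk; have [i yi] : exists i, y ord0 i != 0.
  apply: contrapT => /forallNP h; move/eqP: y0; apply; apply/rowP => i.
  by rewrite mxE; apply/eqP/negPn/negP; exact: h.
have := jk i; rewrite (mulmxnE y j) (mulmxnE y k).
rewrite -(mulr_natr _ j) -(mulr_natr _ k) => /(mulfI yi) /eqP.
by rewrite eqr_nat => /eqP.
Qed.

Lemma mulrn_opp_neq (j k : nat) : y *+ j.+1 <> - (y *+ k).
Proof.
move=> h; have := @mulrn_inj_eq (j.+1 + k) 0.
by rewrite mulrnDr h addNr mulr0n => /(_ erefl).
Qed.

Lemma atomsS L : atoms L.+1 = atoms L `|` ([set y *+ L.+1] `|` [set - (y *+ L.+1)]).
Proof.
apply/seteqP; split => x.
  move=> [k]; rewrite ltnS leq_eqVlt => /predU1P[->|kL] h; first by right.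
  by left; exists k.
move=> [[k kL h]|h]; first by exists k => //; rewrite ltnS ltnW.
by exists L.
Qed.

Lemma measurable_atoms L : measurable (atoms L).
Proof.
elim: L => [|L IH]; last first.
  by rewrite atomsS; apply: measurableU => //; apply: measurableU;
    exact: measurable_singleton.
rewrite (_ : atoms 0 = set0)//.
by apply/seteqP; split => // x [].
Qed.

Lemma fine_measureU (A B : set E) : measurable A -> measurable B -> A `&` B = set0 ->
  fine (mu (A `|` B)) = fine (mu A) + fine (mu B).
Proof.
move=> mA mB AB; rewrite measureU// fineD// fin_num_measure//.
Qed.

Lemma fine_measure_point (B : set E) (x : E) :
  fine (mu (B `&` [set x])) = \1_B x * fine (mu [set x]).
Proof.
rewrite indicE; have [xB|xB] := boolP (x \in B).
  rewrite mul1r; congr (fine (mu _)); apply/seteqP; split => z /=; first by case.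
  by move=> ->; split => //; rewrite inE in xB.
rewrite mul0r (_ : _ `&` _ = set0) ?measure0//.
apply/seteqP; split => // z /= [Bz zx]; move: xB; rewrite -zx => /negP; apply.
by rewrite inE.
Qed.

Lemma measure_atoms (B : set E) L : measurable B ->
  fine (mu (B `&` atoms L)) =
  \sum_(k < L) atom k * (\1_B (y *+ k.+1) + \1_B (- (y *+ k.+1))).
Proof.
move=> mB; elim: L => [|L IH].
  rewrite big_ord0 (_ : _ `&` _ = set0) ?measure0//.
  by apply/seteqP; split => // x [_ []].
have m1 := @measurable_singleton R d.
rewrite big_ord_recr /= -IH atomsS setIUr fine_measureU; last first.
- apply/seteqP; split => // x [[_ [k kL h1]] [_ h2]].
  case: h1 h2 => -> [] /=.
  + by move=> /mulrn_inj_eq [kL']; rewrite kL' ltnn in kL.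
  + exact: mulrn_opp_neq.
  + by move=> /esym; exact: mulrn_opp_neq.
  + by move=> /oppr_inj /mulrn_inj_eq [kL']; rewrite kL' ltnn in kL.
- by apply: measurableI => //; apply: measurableU; exact: m1.
- by apply: measurableI => //; exact: measurable_atoms.
congr (_ + _); rewrite setIUr fine_measureU; last first.
- apply/seteqP; split => // x [[_ /= h1] [_ /= h2]].
  by move: h2; rewrite h1; exact: mulrn_opp_neq.
- by apply: measurableI.
- by apply: measurableI.
rewrite !fine_measure_point -sym// -/(atom L); ring.
Qed.

Lemma measure_atomsT L : fine (mu (atoms L)) = 1 - tail_mass L.
Proof.
rewrite -[atoms L]setTI measure_atoms// /tail_mass opprB addrC subrK mulr_sumr.
by apply: eq_bigr => k _; rewrite !indicE !in_setT /=; ring.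
Qed.

Lemma tail_mass_ge0 L : 0 <= tail_mass L.
Proof.
have -> : tail_mass L = 1 - fine (mu (atoms L)) by rewrite measure_atomsT; ring.
rewrite subr_ge0 -lee_fin fineK ?fin_num_measure//; last exact: measurable_atoms.
by apply: probability_le1; exact: measurable_atoms.
Qed.

(** Turns the hypothesis on the support into one on mass: the union of the [atoms L] contains the
    support, and the complement of the support is null. *)
Lemma tail_mass_cvg0 : tail_mass L @[L --> \oo] --> 0.
Proof.
have mA : measurable (\bigcup_L atoms L).
  by apply: bigcup_measurable => L _; exact: measurable_atoms.
have A1 : mu (\bigcup_L atoms L) = 1%E.
  have : mu.-negligible (~` \bigcup_L atoms L).
    apply: negligibleS (support_null mu); apply: subsetC.
    move=> x /supp [[[|k]|k]] //= _ <-.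
      by exists k.+1 => //; exists k => //; left.
    by exists k.+1 => //; exists k => //; right; rewrite NegzE mulrNz.
  move=> /(negligibleP _ (measurableC mA)) h0.
  have : mu (~` \bigcup_L atoms L) = 0%E by exact: h0.
  rewrite probability_setC// => h.
  have := fin_num_measure mu _ mA; move: h.
  by case: (mu _) => [r| |] //=; rewrite -EFinB => -[] /eqP; rewrite subr_eq0 => /eqP <-.
have cv : mu (atoms L) @[L --> \oo] --> mu (\bigcup_L atoms L).
  apply: nondecreasing_cvg_mu => //; first by move=> L; exact: measurable_atoms.
  move=> m n mn; rewrite subsetEset => x [k km h]; exists k => //.
  exact: leq_trans mn.
have : (1 - fine (mu (atoms L))) @[L --> \oo] --> (1 - 1 : R).
  apply: cvgB; first exact: cvg_cst.
  by apply: fine_cvg; rewrite A1 in cv.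
rewrite subrr; apply: cvg_trans; apply: near_eq_cvg; apply: nearW => L /=.
by rewrite measure_atomsT; ring.
Qed.

End lattice_law.

Section lattice_walk.
Context (R : realType) (d : nat).
Local Notation E := 'rV[R]_d.
Context (mu : probability E R) (y : E).
Hypotheses (y0 : y != 0)
  (supp : msupport mu `<=` [set (y *~ k) | k in [set k : int | k != 0]])
  (sym : forall k : nat, (0 < k)%N -> mu [set (y *+ k)] = mu [set (- (y *+ k))]).
Local Notation atom := (atom mu y).
Local Notation tail := (tail_mass mu y).

(* The mass outside [atoms L.+1] is moved to [y] and [- y]: the law stays
   symmetric without an atom at [0], and its variance does not increase. *)
Definition law_weight L (k : 'I_L.+1) : R :=
  2 * atom k + (k == ord0)%:R * tail L.+1.

Lemma law_weight_ge0 L k : 0 <= @law_weight L k.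
Proof.
rewrite /law_weight addr_ge0 ?mulr_ge0// ?atom_ge0//.
exact: tail_mass_ge0.
Qed.

Lemma law_weight_sum L (f : nat -> R) : \sum_k @law_weight L k * f k =
  2 * \sum_(k < L.+1) atom k * f k + tail L.+1 * f 0%N.
Proof.
rewrite (eq_bigr (fun k : 'I_L.+1 => 2 * (atom k * f k) +
  (k == ord0)%:R * (tail L.+1 * f k))); last first.
  by move=> k _; rewrite /law_weight; ring.
rewrite big_split /= -mulr_sumr; congr (_ + _).
rewrite (bigD1 ord0) // eqxx mul1r big1 /= ?addr0// => k /negbTE ->.
by rewrite mul0r.
Qed.

Lemma law_weight_sum1 L : \sum_k @law_weight L k = 1.
Proof.
have := @law_weight_sum L (fun=> 1).
rewrite (eq_bigr (@law_weight L)); last by move=> k _; rewrite mulr1.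
move=> ->; rewrite (eq_bigr (fun k : 'I_L.+1 => atom k)); last by move=> k _; rewrite mulr1.
by rewrite /tail_mass; ring.
Qed.

Lemma law_approx L (B : set E) : measurable B ->
  `|fine (mu B) - (\sum_k gcst E (@law_weight L k) * avg2 R (y *~ k.+1%:Z)) \1_B 0|
  <= tail L.+1.
Proof.
move=> mB; rewrite gsumE.
rewrite (eq_bigr (fun k : 'I_L.+1 => law_weight k *
   ((\1_B (y *+ k.+1) + \1_B (- (y *+ k.+1))) / 2))); last first.
  by move=> k _; rewrite gmulE gcstE avg2E add0r sub0r.
rewrite (law_weight_sum L (fun k => (\1_B (y *+ k.+1) + \1_B (- (y *+ k.+1))) / 2)).
have mA := measurable_atoms y L.+1.
have -> : fine (mu B) = fine (mu (B `&` atoms y L.+1)) + fine (mu (B `\` atoms y L.+1)).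
  rewrite -fine_measureU; first by rewrite setUIDK.
  - exact: measurableI.
  - exact: measurableD.
  - by apply/seteqP; split => // x [[_ h] [_ h']].
rewrite measure_atoms//.
have -> : 2 * (\sum_(k < L.+1) atom k * ((\1_B (y *+ k.+1) + \1_B (- (y *+ k.+1))) / 2)) =
   \sum_(k < L.+1) atom k * (\1_B (y *+ k.+1) + \1_B (- (y *+ k.+1))).
  by rewrite mulr_sumr; apply: eq_bigr => k _; field.
have r0 : 0 <= fine (mu (B `\` atoms y L.+1)) by rewrite fine_ge0.
have r1 : fine (mu (B `\` atoms y L.+1)) <= tail L.+1.
  have -> : tail L.+1 = 1 - fine (mu (atoms y L.+1)) by rewrite measure_atomsT//; ring.
  rewrite lerBrDr -fine_measureU//; last 2 first.
  - exact: measurableD.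
  - by rewrite setDE -setIA setICl setI0.
  rewrite -lee_fin fineK ?fin_num_measure//; last first.
    by apply: measurableU => //; exact: measurableD.
  by apply: probability_le1; apply: measurableU => //; exact: measurableD.
have t0 := tail_mass_ge0 y0 sym L.+1.
rewrite !indicE; set a := \sum_(k < _) _.
(* The mass of [B] outside the atoms and the relocated mass that falls in [B] both lie between 0 and
   the tail, so they differ by at most the tail. *)
have := r0; have := r1; case: (_ \in B); case: (_ \in B) => /=;
  rewrite ler_norml => h1 h2; apply/andP; split; lra.
Qed.

Lemma law_var_le L (v : R) :
  (2%:E * \sum_(1 <= k <oo) (k%:R ^+ 2)%:E * mu [set (y *+ k)%R] = v%:E)%E ->
  walk_var (@law_weight L) <= v.
Proof.
move=> vE.
have part L' : 2 * \sum_(k < L') atom k * k.+1%:R ^+ 2 <= v.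
  rewrite -lee_fin -vE EFinM lee_wpmul2l//.
  apply: le_trans (nneseries_lim_ge (m := 1) L'.+1 _); last first.
    by move=> k _ _; rewrite mule_ge0// lee_fin sqr_ge0.
  rewrite big_add1 /= big_mkord -sumEFin; apply: lee_sum => k _.
  by rewrite EFinM fineK ?fin_num_measure//; [rewrite muleC|exact: measurable_singleton].
rewrite /walk_var (law_weight_sum L (fun k => k.+1%:R ^+ 2)) expr1n mulr1.
(* The mass relocated to distance 1 came from atoms at [k >= 1], which weigh at least as much in the
   variance; what lies beyond [L.+1 + n] disappears in the limit. *)
have key n : 2 * \sum_(k < L.+1) atom k * k.+1%:R ^+ 2 + tail L.+1 <= v + tail (L.+1 + n).
  rewrite -lerBlDr; apply: le_trans (part (L.+1 + n)%N).
  rewrite /tail_mass !big_split_ord /= -addrA mulrDr [leRHS]mulrDr lerD2l.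
  have -> : 1 - 2 * \sum_(k < L.+1) atom k - (1 - (2 * \sum_(k < L.+1) atom k +
     2 * \sum_(i < n) atom (L.+1 + i))) = 2 * \sum_(i < n) atom (L.+1 + i) by ring.
  rewrite ler_wpM2l//; apply: ler_sum => k _; rewrite ler_peMr ?atom_ge0//.
  by rewrite exprn_ege1// ler1n.
have cv : (v + tail (L.+1 + n)) @[n --> \oo] --> v + 0.
  apply: cvgD; first exact: cvg_cst.
  have h := tail_mass_cvg0 y0 supp sym; rewrite -(cvg_shiftn L.+1) in h.
  by apply: cvg_trans h; apply: near_eq_cvg; apply: nearW => n; rewrite /= addnC.
rewrite -[leRHS]addr0 -(cvg_lim _ cv)//.
apply: limr_ge; first by apply/cvg_ex; eexists; exact: cv.
by near=> n; exact: key.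
Unshelve. all: by end_near.
Qed.

End lattice_walk.

Section unital.
Context (R : realType) (V : zmodType).
Implicit Types (f g : galg R V).

Definition unital f := forall x, f (fun=> 1) x = 1.

Lemma unitalM f g : unital f -> unital g -> unital (f * g).
Proof. by move=> f1 g1 x; rewrite gmulE (funext g1). Qed.

Lemma unitalX f n : unital f -> unital (f ^+ n).
Proof.
move=> f1; elim: n => [|n IH] x; first by rewrite goneE.
by rewrite exprS unitalM.
Qed.

(** For total mass zero, the constant in [\1_B = (1 + (2 * \1_B - 1)) / 2] contributes nothing, and
    [2 * \1_B - 1] is a test function. This is the half between norm and total variation
    distance. *)
Lemma indic_half f (B : set V) : f (fun=> 1) 0 = 0 -> `|f \1_B 0| <= nrm f / 2.
Proof.
move=> f1.
have -> : \1_B = (fun x => 2^-1 * (1 + (2 * \1_B x - 1))) :> (V -> R).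
  by apply/funext => x; field.
rewrite gopZ gopD f1 add0r normrM ger0_norm ?invr_ge0// mulrC ler_wpM2r ?invr_ge0//.
apply: le_nrm1 => x; rewrite indicE; case: (_ \in _) => /=.
  by rewrite mulr1 ger0_norm; lra.
by rewrite mulr0 sub0r normrN1.
Qed.

End unital.

Lemma norm_sum5 (R : realFieldType) (x1 x2 x3 x4 x5 y1 y4 b e : R) :
  `|x1| <= y1 -> `|x2| <= b + e -> `|x3| <= e -> `|x4| <= y4 -> `|x5| <= e ->
  y1 + y4 <= e ->
  `|x1 + x2 - x3 - x4 - x5| <= b + (e + e + e + e + e).
Proof.
rewrite !ler_norml => /andP[? ?] /andP[? ?] /andP[? ?] /andP[? ?] /andP[? ?] ?.
by apply/andP; split; lra.
Qed.

(** * From finite combinations to the given laws *)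

Section assembly.
Context (R : realType) (d K : nat).
Local Notation E := 'rV[R]_d.
Context (F : probability E R) (q : R) (p : 'I_K -> R) (Fm : 'I_K -> probability E R)
  (y : 'I_K -> E).
Hypotheses (q01 : 0 < q < 1) (p01 : forall m, 0 < p m < 1)
  (pq : \sum_(m < K) p m = 1 - q)
  (FE : forall B : set E, measurable B ->
     F B = (q%:E * \d_(0%R : E) B + \sum_(m < K) (p m)%:E * Fm m B)%E)
  (y0 : forall m, y m != 0)
  (supp : forall m, msupport (Fm m) `<=`
     [set (y m *~ k) | k in [set k : int | k != 0]])
  (sym : forall m (k : nat), (0 < k)%N ->
     Fm m [set (y m *+ k)] = Fm m [set (- (y m *+ k))]).

Local Notation F1 := (charge_of_finite_measure F : {charge set E -> \bar R}).

Definition approx_weight L (m : 'I_K) : 'I_L.+1 -> R := @law_weight R d (Fm m) (y m) L.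
Definition approx_gen L : galg R E :=
  \sum_m gcst E (p m) * model_gen (@approx_weight L) y m.

Let w0 L m k : 0 <= @approx_weight L m k.
Proof. exact: (law_weight_ge0 (y0 m) (sym m)). Qed.
Let w1 L m : \sum_k @approx_weight L m k = 1.
Proof. exact: law_weight_sum1. Qed.
Let p0 m : 0 < p m. Proof. by case/andP: (p01 m). Qed.

Lemma approx_law L : 1 - approx_gen L = gcst E q + \sum_m gcst E (p m) *
  \sum_k gcst E (@approx_weight L m k) * avg2 R (y m *~ k.+1%:Z).
Proof.
rewrite (eq_bigr (fun m => gcst E (p m) * (1 - model_gen (@approx_weight L) y m))).
  have -> : gcst E q = 1 - \sum_m gcst E (p m).
    by rewrite -rmorph_sum pq rmorphB rmorph1; ring.
  rewrite /approx_gen -addrA -[X in _ = 1 + X]opprK; congr (1 - _).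
  rewrite opprD opprK -sumrB; apply: eq_bigr => m _; ring.
by move=> m _; rewrite model_law.
Qed.

Lemma lbnd_approx L : lbnd (1 - approx_gen L) 1.
Proof.
rewrite approx_law.
have -> : 1 = `|q| + \sum_m `|p m| * \sum_k `|@approx_weight L m k| * 1 :> R.
  rewrite (eq_bigr p); last first.
    move=> m _; rewrite -[RHS]mulr1 gtr0_norm//; congr (_ * _).
    rewrite -[RHS](w1 L m); apply: eq_bigr => k _; by rewrite mulr1 ger0_norm.
  by rewrite pq gtr0_norm; [ring|case/andP: q01].
apply: lbndD; first exact: lbnd_cst.
apply: lbnd_sum => m; apply: lbndM; first exact: lbnd_cst.
apply: lbnd_sum => k; apply: lbndM; first exact: lbnd_cst.
exact: lbnd_avg2.
Qed.

Lemma approximates_model L del : (forall m, tail_mass (Fm m) (y m) L.+1 <= del) ->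
  approximates F1 (1 - approx_gen L) del.
Proof.
move=> tdel B mB; rewrite approx_law gaddE gcstE gsumE.
have -> : fine (F1 B) = q * \1_B 0 + \sum_m p m * fine (Fm m B).
  have -> : F1 B = F B by [].
  rewrite FE// diracE indicE (eq_bigr (fun m => (p m * fine (Fm m B))%:E)).
    by rewrite sumEFin -EFinM -EFinD.
  by move=> m _; rewrite EFinM fineK// fin_num_measure.
rewrite [X in `|X - _|]addrC opprD addrA addrK -sumrB.
apply: le_trans (ler_norm_sum _ _ _) _.
apply: le_trans (_ : _ <= \sum_m p m * del) _.
  apply: ler_sum => m _; rewrite gmulE gcstE -mulrBr normrM gtr0_norm//.
  rewrite ler_wpM2l ?(ltW (p0 m))//; apply: le_trans (tdel m).
  exact: (law_approx (y0 m) (sym m) L mB).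
have [m _] : exists m : 'I_K, True.
  apply: contrapT => h; move: pq; rewrite big1; first by move: q01; lra.
  by move=> m _; case: h; exists m.
have d0 : 0 <= del by apply: le_trans (tdel m); exact: (tail_mass_ge0 (y0 m) (sym m)).
by rewrite -mulr_suml pq ler_piMl//; move: q01; lra.
Qed.

Lemma tail_uniform (del : R) : 0 < del ->
  exists L : nat, forall m, tail_mass (Fm m) (y m) L.+1 <= del.
Proof.
move=> d0.
have near_m (m : 'I_K) : \forall L \near \oo, tail_mass (Fm m) (y m) L <= del.
  have cv := tail_mass_cvg0 (y0 m) (@supp m) (sym m).
  have /cvgrPdist_le /(_ _ d0) := cv; apply: filterS => L.
  by rewrite sub0r normrN ger0_norm//; exact: (tail_mass_ge0 (y0 m) (sym m)).
have [L _ hL] := filter_forall _ near_m.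
by exists L => m; apply: hL => /=.
Qed.

Variables (v : 'I_K -> R) (n : nat).
Hypotheses (n0 : (0 < n)%N)
  (vE : forall m, (2%:E * \sum_(1 <= k <oo) (k%:R ^+ 2)%:E * Fm m [set (y m *+ k)%R]
     = (v m)%:E)%E).

Local Notation S := (\sum_m Num.sqrt (1 + Num.sqrt (v m))).
Local Notation A := (cscale n%:R (cadd F1 (copp (@cunit R d)))).

Lemma approximates_exponent a del : approximates F1 a del ->
  approximates A (gcst E n%:R * (a - 1)) (n%:R * del).
Proof.
move=> aF B mB.
have -> : fine (A B) = n%:R * (fine (F1 B) - \1_B 0).
  have -> : A B = (n%:R%:E * (F B - \d_(0%R : E) B))%E by [].
  rewrite diracE indicE; have -> : F1 B = F B by [].
  by rewrite -[F B]fineK ?fin_num_measure//= -EFinB.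
rewrite gmulE gcstE gsubE goneE -mulrBr normrM ger0_norm// ler_wpM2l//.
by apply: le_trans (aF B mB); rewrite le_eqVlt; apply/orP; left; apply/eqP; congr `|_|; ring.
Qed.

(** The bound increases with [S], and by [law_var_le] the approximating walks have variances at most
    [v m]. *)
Lemma approx_estimate L M' : (7 <= M')%N ->
  nrm ((1 - approx_gen L) ^+ n -
    (1 - gcst E (12 * M')%N%:R^-1 * approx_gen L) ^+ (12 * M') ^+ n) / 2 <=
  176 / 100 / n%:R * S ^+ 2 * (1 + 480 ^+ 4 / (Num.sqrt n%:R * q ^+ 5) * S) +
  68 * n%:R ^+ 3 / (12 * M')%N%:R.
Proof.
move=> M7.
apply: le_trans (@model_estimate R E K L.+1 (@approx_weight L) y p q
  (w0 (L:=L)) (w1 L) q01 p0 pq n M' n0 M7) _.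
have wS : \sum_m model_weight (@approx_weight L) m <= S.
  apply: ler_sum => m _; rewrite /model_weight ler_wsqrtr// lerD2l ler_wsqrtr//.
  exact: (law_var_le (y0 m) (@supp m) (sym m) L (vE m)).
set T := \sum_m model_weight _ _ in wS *.
have T0 : 0 <= T by apply: sumr_ge0 => m _; exact: sqrtr_ge0.
have n0' : 0 < n%:R :> R by rewrite ltr0n.
have q5 : 0 < Num.sqrt n%:R * q ^+ 5.
  by rewrite mulr_gt0 ?sqrtr_gt0// exprn_gt0//; case/andP: q01.
have c0 : 0 <= 480 ^+ 4 / (Num.sqrt n%:R * q ^+ 5) :=
  divr_ge0 (exprn_ge0 4 (ler0n R 480)) (ltW q5).
have c1 : 0 <= 176 / 100 / n%:R :> R by rewrite divr_ge0 ?(ltW n0')//; lra.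
rewrite lerD2r; move: (480 ^+ 4 / _) c0 (176 / 100 / _) c1 => a a0 b b0.
apply: ler_pM; [exact: (mulr_ge0 b0 (sqr_ge0 _)) | | |].
- by rewrite addr_ge0// mulr_ge0.
- by rewrite ler_wpM2l// lerXn2r ?nnegrE// (le_trans T0).
- by rewrite lerD2l ler_wpM2l.
Qed.

Lemma model_unital L m : unital (1 - model_gen (@approx_weight L) y m).
Proof.
move=> x; rewrite model_law// gsumE -[RHS](w1 L m); apply: eq_bigr => k _.
by rewrite gmulE gcstE avg2E -[RHS]mulr1; congr (_ * _); field.
Qed.

Lemma approx_unital L : unital (1 - approx_gen L).
Proof.
move=> x; rewrite approx_law gaddE gcstE gsumE mulr1.
rewrite (eq_bigr p) ?pq; first by ring.
move=> m _; rewrite gmulE gcstE -model_law//.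
by rewrite (model_unital L m x) mulr1.
Qed.

Lemma approx_unital_step L M : unital (1 - gcst E M%:R^-1 * approx_gen L).
Proof.
move=> x; rewrite gsubE goneE gmulE gcstE.
have := approx_unital L x; rewrite gsubE goneE => h.
have -> : approx_gen L (fun=> 1) x = 0 by lra.
by rewrite mulr0 subr0.
Qed.

(** The parameters are fixed in the order [J], [M'], [L]: the tolerance [del] for the lattice
    cut-off depends on the error constants of all powers below [J], while the choices of [J] and
    [M'] are uniform in the approximating law. *)
Lemma setwise_bound (B : set E) (l : R) : measurable B -> exp_partial A B @ \oo --> l ->
  `|fine (cpow F1 n B) - l| <=
  176 / 100 / n%:R * S ^+ 2 * (1 + 480 ^+ 4 / (Num.sqrt n%:R * q ^+ 5) * S).
Proof.
move=> mB cvl; set RHS := (X in _ <= X).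
have n0' : 0 < n%:R :> R by rewrite ltr0n.
apply/ler_addgt0Pr => eps eps0; pose eta := eps / 5.
have eta0 : 0 < eta by rewrite divr_gt0.
have [J0 hJ0] := exp_trunc_approx E (ler0n R (2 * n)) eta0.
have [J1 _ hJ1] : \forall J \near \oo, `|l - exp_partial A B J| <= eta.
  by have /cvgrPdist_le /(_ _ eta0) := cvl.
pose J := maxn J0 J1.
have [N0 hN0] := hJ0 J (leq_maxl _ _).
have {}hJ1 := hJ1 J (leq_maxr _ _).
pose M' := maxn (maxn 7 N0) (Num.trunc (68 * n%:R ^+ 3 / eta)).+1.
have M7 : (7 <= M')%N by rewrite /M' !leq_max leqnn.
have MN : (N0 <= M')%N by rewrite /M' !leq_max leqnn orbT.
have Meta : 68 * n%:R ^+ 3 / (12 * M')%N%:R <= eta.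
  have h : 68 * n%:R ^+ 3 / eta <= M'%:R.
    by apply: le_trans (ltW (truncnS_gt _)) _; rewrite ler_nat leq_maxr.
  have M0 : 0 < (12 * M')%N%:R :> R by rewrite ltr0n muln_gt0 (leq_trans _ M7).
  have M12 : M'%:R <= (12 * M')%N%:R :> R by rewrite ler_nat leq_pmull.
  by rewrite ler_pdivrMr// [leRHS]mulrC -ler_pdivrMr// (le_trans h).
have [Cn Cn0 hCn] := approximates_cpow F1 n (ler01 : 0 <= 1 :> R).
have hC j : {C : R | 0 <= C /\ forall a del, 0 <= del -> approximates A a del ->
    lbnd a (2 * n)%:R -> approximates (cpow A j) (a ^+ j) (C * del)}.
  by apply: cid; have [C C0 h] := approximates_cpow A j (ler0n R (2 * n)); exists C.
pose C j := projT1 (hC j).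
have C0 j : 0 <= C j := (projT2 (hC j)).1.
have hCj j := (projT2 (hC j)).2.
pose W : R := Cn + \sum_(j < J) j`!%:R^-1 * (C j * n%:R) + 1.
have W0' : 0 <= \sum_(j < J) j`!%:R^-1 * (C j * n%:R).
  by apply: sumr_ge0 => j _; rewrite !mulr_ge0.
have W0 : 0 < W := ltr_wpDl (addr_ge0 Cn0 W0') ltr01.
pose del := eta / W.
have del0 : 0 < del by rewrite divr_gt0.
have [L hL] := tail_uniform del0.
have cF := approximates_model hL; have lF := lbnd_approx L.
set a := 1 - approx_gen L in cF lF.
pose b := gcst E n%:R * (a - 1).
have cA : approximates A b (n%:R * del) by exact: approximates_exponent.
have lA : lbnd b (2 * n)%:R.
  have -> : (2 * n)%:R = `|n%:R| * (1 + `|-1|) :> R.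
    by rewrite normrN1 ger0_norm// natrM; ring.
  apply: lbndM; first exact: lbnd_cst.
  apply: lbndD => //; have := lbnd_cst E (-1 : R).
  by rewrite rmorphN rmorph1.
pose P := (1 - gcst E (12 * M')%N%:R^-1 * approx_gen L) ^+ (12 * M') ^+ n.
have e1 : `|fine (cpow F1 n B) - (a ^+ n) \1_B 0| <= Cn * del.
  exact: (hCn a del (ltW del0) cF lF B mB).
have e2 : `|(a ^+ n - P) \1_B 0| <= RHS + eta.
  apply: le_trans (indic_half _ _) _.
    rewrite gsubE unitalX ?unitalX ?subrr//; last exact: approx_unital.
    by apply: unitalX; exact: approx_unital_step.
  by apply: le_trans (approx_estimate L M7) _; rewrite lerD2l.
have e3 : `|(exp_trunc b J - P) \1_B 0| <= eta.
  apply: le_trans (le_nrm1 _ _ _) _.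
    by move=> x; rewrite indicE; case: (_ \in _); rewrite ?normr1 ?normr0.
  have NM : (N0 <= n * (12 * M'))%N.
    by apply: leq_trans MN _; rewrite mulnA leq_pmull// muln_gt0 n0.
  have := hN0 _ NM b (nrm_lbnd lA).
  (* [b] is [- n] times the generator, so with exponent [n * (12 * M')] the approximation of [exp b]
     coincides with [P]. *)
  have -> : (1 + gcst E (n * (12 * M'))%N%:R^-1 * b) ^+ (n * (12 * M')) = P.
    have gE : gcst E (n * (12 * M'))%N%:R^-1 * gcst E n%:R = gcst E ((12 * M')%N%:R^-1 : R).
      rewrite -rmorphM; congr gcst; rewrite natrM invfM mulrAC mulVf ?mul1r//.
      by rewrite gt_eqF.
    rewrite mulnC exprM /P -gE /b /a; congr (_ ^+ _ ^+ _).
    by rewrite mulnC; ring.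
  by [].
have e4 : `|exp_partial A B J - (exp_trunc b J) \1_B 0| <=
    (\sum_(j < J) j`!%:R^-1 * (C j * n%:R)) * del.
  rewrite /exp_partial /exp_trunc gsumE -sumrB mulr_suml.
  apply: le_trans (ler_norm_sum _ _ _) _; apply: ler_sum => j _.
  rewrite gmulE gcstE -mulrBr normrM ger0_norm ?invr_ge0// -!mulrA ler_wpM2l ?invr_ge0//.
  exact: (hCj j b (n%:R * del) (mulr_ge0 (ltW n0') (ltW del0)) cA lA B mB).
have e5 : (Cn + \sum_(j < J) j`!%:R^-1 * (C j * n%:R)) * del <= eta.
  by rewrite /del mulrCA ler_piMr ?(ltW eta0)// ler_pdivrMr// mul1r /W lerDl.
have -> : fine (cpow F1 n B) - l = (fine (cpow F1 n B) - (a ^+ n) \1_B 0) +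
   (a ^+ n - P) \1_B 0 - (exp_trunc b J - P) \1_B 0 -
   (exp_partial A B J - (exp_trunc b J) \1_B 0) - (l - exp_partial A B J).
  by rewrite !gsubE; ring.
have epsE : eps = eta + eta + eta + eta + eta by rewrite /eta; field.
rewrite mulrDl in e5; rewrite epsE.
exact: (norm_sum5 e1 e2 e3 e4 hJ1 e5).
Qed.

End assembly.

Local Open Scope ereal_scope.

Theorem theorem7 (R : realType) :
  exists C : R, (0 < C)%R /\
  forall (d K : nat), (0 < d)%N -> (d <= K)%N ->
  forall (F : probability 'rV[R]_d R)
    (q : R) (p : 'I_K -> R) (Fm : 'I_K -> probability 'rV[R]_d R)
    (y : 'I_K -> 'rV[R]_d),
  (0 < q < 1)%R ->
  (forall m, (0 < p m < 1)%R) ->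
  (\sum_(m < K) p m)%R = (1 - q)%R ->
  (forall B : set 'rV[R]_d, measurable B ->
     F B = q%:E * \d_(0%R : 'rV[R]_d) B + \sum_(m < K) (p m)%:E * Fm m B) ->
  (forall m, y m != 0%R) ->
  (forall m, msupport (Fm m) `<=`
     [set (y m *~ k)%R | k in [set k : int | k != 0%R]]) ->
  (forall m k : 'I_K, k != m -> msupport (Fm m) `&` msupport (Fm k) = set0) ->
  (forall m, msupport (Fm m) !=set0) ->
  (forall m (k : nat), (0 < k)%N ->
     Fm m [set (y m *+ k)%R] = Fm m [set (- (y m *+ k))%R]) ->
  (forall m, exists k0 : int,
     0 < Fm m [set (y m *~ k0)%R] /\ 0 < Fm m [set (y m *~ (k0 + 1))%R]) ->
  forall n : nat, (0 < n)%N ->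
  let F1 : {charge set 'rV[R]_d -> \bar R} := charge_of_finite_measure F in
  let S : \bar R := \sum_(m < K) sqrte (1 + lattice_sigma (Fm m) (y m)) in
  dTV (cpow F1 n)
      (cexp (cscale n%:R (cadd F1 (copp (@cunit R d)))))
  <= ((176 / 100) / n%:R)%:E * S ^+ 2
     * (1 + (C / (Num.sqrt n%:R * q ^+ 5))%:E * S).
Proof.
have a0 : (0 < 480 :> R)%R by rewrite ltr0n.
exists (480 ^+ 4)%R; split; first exact: exprn_gt0.
move=> d K _ _ F q p Fm y q01 p01 pq FE y0 supp _ _ sym _ n n0; cbv zeta.
set F1 : {charge set _ -> \bar R} := charge_of_finite_measure F.
set S := (\sum_(m < K) sqrte _).
have n0' : (0 < n%:R :> R)%R by rewrite ltr0n.
have c0 : (0 < 176 / 100 / n%:R :> R)%R by rewrite divr_gt0//; lra.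
have q5 : (0 < Num.sqrt n%:R * q ^+ 5)%R.
  by rewrite mulr_gt0 ?sqrtr_gt0// exprn_gt0//; case/andP: q01.
have b0 : (0 < 480 ^+ 4 / (Num.sqrt n%:R * q ^+ 5))%R := divr_gt0 (exprn_gt0 4 a0) q5.
pose W m := 2%:E * \sum_(1 <= k <oo) (k%:R ^+ 2)%:E * Fm m [set (y m *+ k)%R].
have sE m : lattice_sigma (Fm m) (y m) = sqrte (W m) by [].
have s0 m : 0 <= sqrte (1 + lattice_sigma (Fm m) (y m)) by exact: sqrte_ge0.
have W0 m : 0 <= W m.
  by rewrite mule_ge0// nneseries_ge0// => k _ _; rewrite mule_ge0// lee_fin sqr_ge0.
(* An infinite variance makes [S] infinite, and then the right-hand side is [+oo] because its real
   coefficients are positive. *)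
have [[m Wm]|Wfin] := pselect (exists m, W m = +oo).
  have -> : S = +oo.
    rewrite /S (bigD1 m)//= sE Wm /= addye//.
    by rewrite gt_eqF// (@lt_le_trans _ _ 0)// sume_ge0.
  rewrite expe2 mulyy gt0_muley ?lte_fin// (gt0_muley (x := _%:E)) ?lte_fin//.
  by rewrite addey// mulyy leey.
pose v m := fine (W m).
have vE m : W m = (v m)%:E.
  rewrite /v fineK// fin_numE -ltNye (lt_le_trans _ (W0 m))//=.
  by apply/eqP => Wm; apply: Wfin; exists m.
have SE : S = (\sum_(m < K) Num.sqrt (1 + Num.sqrt (v m)))%R%:E.
  by rewrite /S -sumEFin; apply: eq_bigr => m _; rewrite sE vE.
rewrite SE -EFin_expe -!EFinM.
apply: ge_ereal_sup => _ [B mB <-].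
have [l [-> hl]] := cexp_approx (cscale n%:R (cadd F1 (copp (@cunit R d)))) mB.
have fB : cpow F1 n B \is a fin_num by exact: fin_num_measure.
rewrite -(fineK fB) -EFinB /= lee_fin.
exact: (setwise_bound q01 p01 pq FE y0 (@supp) sym n0 vE mB hl).
Qed.
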